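(* Let $\{P_\theta:\theta\in\Theta\}$, $\Theta\subseteq\mathbb{R}^d$, be a statistical model that is Hellinger differentiable at all $\theta\in\Theta$ with Fisher information $\mathcal{I}(\theta)$, let $\theta_0$ be an interior point of $\Theta$ with $\mathcal{I}(\theta_0)$ invertible, and let $\psi:\Theta\to\mathbb{R}$. Assume that $t\mapsto\psi(t)$ and $t\mapsto\mathcal{I}(t)$ are continuously differentiable at $t=\theta_0$. Put $V:=\nabla\psi(\theta_0)^\top\mathcal{I}(\theta_0)^{-1}\nabla\psi(\theta_0)$. Let $L^{(1)}_n(c),\dots,L^{(4)}_n(c)$ be the four lower bounds, defined in the context, for the local minimax risk $\inf_T\sup_{\|\theta-\theta_0\|_2<cn^{-1/2}}\mathbb{E}_{P_\theta^n}|T(X_1,\dots,X_n)-\psi(\theta)|^2$. Then: (i) $\liminf_{c\to\infty}\liminf_{n\to\infty}n\,L^{(1)}_n(c)\ge V$; (ii) if the square-root-density regularity condition (R) at $\theta_0$ (see context) holds and the Fisher defect is zero at $\theta_0$, then $\liminf_{c\to\infty}\liminf_{n\to\infty}n\,L^{(2)}_n(c)\ge V$; (iii) $\liminf_{c\to\infty}\liminf_{n\to\infty}n\,L^{(3)}_n(c)\ge V$; (iv) $\liminf_{c\to\infty}\liminf_{n\to\infty}n\,L^{(4)}_n(c)\ge C\,V$ with $C=\sup_{\varepsilon\ge0}\varepsilon^2\left(\tfrac12e^{-\varepsilon^2/8}-\tfrac14\right)\approx0.28953$. In particular the corresponding lower bounds hold for $\liminf_{c\to\infty}\liminf_{n\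to\infty}\inf_T\sup_{\|\theta-\theta_0\|_2<cn^{-1/2}}n\,\mathbb{E}_{P_\theta^n}|T(X_1,\dots,X_n)-\psi(\theta)|^2$.
   Context: All $P_\theta$ have densities $dP_\theta$ with respect to a common $\sigma$-finite measure $\nu$; $P^n$ is the $n$-fold product; $[x]_+=\max(x,0)$. Hellinger differentiability at $t$: there is $\dot\xi_t:\mathcal{X}\to\mathbb{R}^d$, square integrable with respect to $\nu$, with $\int[dP_{t+h}^{1/2}-dP_t^{1/2}-h^\top\dot\xi_t]^2d\nu=o(\|h\|_2^2)$; $\mathcal{I}(t)=4\int\dot\xi_t\dot\xi_t^\top d\nu$. Condition (R) at $\theta_0$: there is $\delta>0$ such that (a) for $\nu$-almost every $x$ and each unit vector $u$, $t\mapsto dP^{1/2}_{\theta_0+tu}(x)$ is absolutely continuous on $0<t<\delta$ with derivative $u^\top\dot\gamma_{t,u}(x)$; (b) for all unit vectors $u$, $\lim_{t\to0}u^\top\dot\gamma_{t,u}=u^\top\dot\gamma_0$ $\nu$-almost everywhere, and $\int\sup_{0<t_1,t_2<\delta}u^\top\dot\gamma_{t_1,u}\dot\gamma_{t_2,u}^\top u\,d\nu<\infty$. The Fisher defect at $\theta_0$ is $4\int\dot\gamma_0\dot\gamma_0^\top\mathbf{1}\{dP_{\theta_0}=0\}\,d\nu$. $H^2(P,P')=\int(dP^{1/2}-dP'^{1/2})^2$; $\chi^2(P'\|P)=\int(dP'/dP-1)^2dP$ if $P'\ll P$, and $\infty$ otherwise. Let $\Theta_n=\{\theta:\|\theta-\theta_0\|_2<cn^{-1/2}\}$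 ($n$ large enough that $\Theta_n\subseteq\Theta$). $L^{(1)}_n(c)=\sup_{\phi,Q}\big[\Gamma_n^{1/2}-(\int|\psi-\phi|^2dQ)^{1/2}\big]_+^2$ with $\Gamma_n=(\int\nabla\phi\,dQ)^\top(\mathcal{I}(Q)+n\int\mathcal{I}(t)dQ(t))^{-1}(\int\nabla\phi\,dQ)$, the supremum over absolutely continuous $\phi:\Theta_n\to\mathbb{R}$ and nice priors $Q$ on $\Theta_n$: (1) $Q$ has an absolutely continuous Lebesgue density $q$ and $\mathcal{I}(Q)=\int\nabla q\nabla q^\top q^{-1}\mathbf{1}\{q>0\}dt$ is positive definite; (2) $\phi$ and $\|\nabla\phi\|$ are $Q$-integrable and $\int\mathrm{tr}(\mathcal{I}(t))dQ(t)<\infty$; (3) $q(\theta)\to0$ as $\theta$ approaches any boundary point of $\Theta_n$ along some canonical direction. (Absolute continuity on an open set: along each segment $t\mapsto\theta+tu$, $0<t<\delta$, $u$ a unit vector, for every ball $B(\theta,\delta)$ in the set.) For a diffeomorphism $\varphi:\mathbb{R}^d\to\Theta_n$, a probability measure $Q$ on $\mathbb{R}^d$ and $h\in\mathbb{R}^d$, let $\widetilde{\mathbb{P}}_h$ be the law of $(X,\vartheta-h)$ when $\vartheta\sim Q$, $X\mid\vartheta\sim P_{\varphi(\vartheta)}^n$, i.e. $d\widetilde{\mathbb{P}}_h(x,t)=dP^n_{\varphi(t+h)}(x)dQ(t+h)$; let $\widetilde\psi=\psi\circ\varphi$, $D=\left|\int(\widetilde\psi(t)-\widetilde\psi(t-h))dQ(t)\right|^2$,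 $B=\int|\widetilde\psi(t)-\widetilde\psi(t-h)|^2dQ(t)$. Then $$L^{(2)}_n(c)=\sup_{\varphi,Q,\lambda\in[0,1],h}\Big[(1-\lambda)\Big(\tfrac{D}{\chi^2(\widetilde{\mathbb{P}}_h\|\lambda\widetilde{\mathbb{P}}_h+(1-\lambda)\widetilde{\mathbb{P}}_0)}\Big)^{1/2}-(\lambda B)^{1/2}\Big]_+^2,\qquad L^{(3)}_n(c)=\sup_{\varphi,Q,h}\Big[\Big(\tfrac{D}{4H^2(\widetilde{\mathbb{P}}_0,\widetilde{\mathbb{P}}_h)}\Big)^{1/2}-B^{1/2}\Big]_+^2,$$ $$L^{(4)}_n(c)=\sup_{\theta_1,\theta_2\in\Theta_n}\Big[\tfrac{1-H^2(P^n_{\theta_1},P^n_{\theta_2})}{4}\Big]_+|\psi(\theta_1)-\psi(\theta_2)|^2 .$$ Conventions: $0/0=0$, the first term in $L^{(2)}$ is $0$ for $\lambda=1$, the suprema run over choices for which the integrals are well defined. *)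

(* Defs.v *)
From HB Require Import structures.
From mathcomp Require Import all_boot all_order all_algebra.
From mathcomp Require Import all_classical all_reals all_analysis.
From mathcomp Require Import measurable_realfun.

Set Implicit Arguments.
Unset Strict Implicit.
Unset Printing Implicit Defensive.

Import Order.TTheory GRing.Theory Num.Theory.
Import numFieldNormedType.Exports.

Local Open Scope classical_set_scope.
Local Open Scope ring_scope.
Local Open Scope charge_scope.

Section euclidean.
Context {R : realType} {d : nat}.
Implicit Types (u v t : 'rV[R]_d) (f : 'rV[R]_d -> R) (S : set 'rV[R]_d).

Definition dotp u v : R := \sum_i u 0 i * v 0 i.

(* The norm `|u| of the library is the maximum norm on 'rV[R]_d. *)
Definition enorm u : R := Num.sqrt (dotp u u).

Definition eball t (r : R) : set 'rV[R]_d := [set s | enorm (s - t) < r].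

(* Partial derivatives take a junk value where they do not exist; for
   absolutely continuous f this happens on a Lebesgue null set only. *)
Definition gradient f t : 'rV[R]_d := \row_i 'D_(delta_mx 0 i) f t.

Definition C1_at f t : Prop :=
  (\forall s \near t, differentiable f s) /\ {for t, continuous (gradient f)}.

Definition posdef (A : 'M[R]_d) : Prop :=
  A^T = A /\ forall v, v != 0 -> 0 < (v *m A *m v^T) 0 0.

Definition qform_inv (v : 'rV[R]_d) (A : 'M[R]_d) : R :=
  (v *m invmx A *m v^T) 0 0.

Definition abs_continuous (a b : R) (f : R -> R) : Prop :=
  forall e : R, 0 < e -> exists2 r : R, 0 < r &
  forall (m : nat) (x y : 'I_m -> R),
    (forall i, [/\ a < x i, x i <= y i & y i < b]) ->
    (forall i j, i != j -> y i <= x j \/ y j <= x i) ->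
    \sum_i (y i - x i) < r ->
    \sum_i `|f (y i) - f (x i)| < e.

Definition abs_continuous_on S f : Prop :=
  forall t r, 0 < r -> eball t r `<=` S ->
  forall u, enorm u = 1 -> abs_continuous 0 r (fun s => f (t + s *: u)).

Definition diffeomorphism S (phi : 'rV[R]_d -> 'rV[R]_d) : Prop :=
  exists g : 'rV[R]_d -> 'rV[R]_d,
  [/\ forall t, S (phi t),
      forall t, g (phi t) = t,
      forall t, S t -> phi (g t) = t,
      forall t j, C1_at (fun s => phi s 0 j) t &
      forall t j, S t -> C1_at (fun s => g s 0 j) t].

End euclidean.

(* The Borel sigma-algebra of R^d, generated by the coordinates. *)
Definition rV_display : measure_display.
Proof. exact: default_measure_display. Qed.

Section rV_measurable.
Context {R : realType} {d : nat}.

Let coord (i : 'I_d) (v : 'rV[R]_d) : R := v 0 i.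

Let rV_set0 : g_sigma_preimage coord set0.
Proof. exact: sigma_algebra0. Qed.

Let rV_setC A : g_sigma_preimage coord A -> g_sigma_preimage coord (~` A).
Proof. exact: sigma_algebraC. Qed.

Let rV_bigcup (F : (set _)^nat) : (forall i, g_sigma_preimage coord (F i)) ->
  g_sigma_preimage coord (\bigcup_i F i).
Proof. exact: sigma_algebra_bigcup. Qed.

HB.instance Definition _ := @isMeasurable.Build rV_display 'rV[R]_d
  (g_sigma_preimage coord) rV_set0 rV_setC rV_bigcup.

Lemma measurable_coord (i : 'I_d) :
  measurable_fun [set: 'rV[R]_d] (fun v : 'rV[R]_d => v 0 i).
Proof.
move=> _ Y mY; rewrite setTI; apply: sub_sigma_algebra => /=.
rewrite -bigcup_seq/=; exists i => /=; first by rewrite mem_index_enum.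
by exists Y => //; rewrite setTI.
Qed.

Definition row_of_tuple (t : d.-tuple (measurableTypeR R)) : 'rV[R]_d := \row_i tnth t i.

Lemma measurable_row_of_tuple :
  measurable_fun [set: d.-tuple (measurableTypeR R)] row_of_tuple.
Proof.
move=> _ A mA; rewrite setTI.
suff : g_sigma_preimage coord `<=` [set B | measurable (row_of_tuple @^-1` B)].
  exact.
apply: smallest_sub.
  split=> [|B mB|F mF] /=.
  - by rewrite preimage_set0.
  - by rewrite setTD preimage_setC; exact: measurableC.
  - by rewrite preimage_bigcup; apply: bigcup_measurable => k _; exact: mF.
rewrite -bigcup_seq => B/= [i _ [C mC <-]].
rewrite setTI /= (_ : _ @^-1` _ = (fun t : d.-tuple (measurableTypeR R) => tnth t i) @^-1` C).
  by rewrite -[X in measurable X]setTI; exact: measurable_tnth.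
by apply/seteqP; split=> t; rewrite /= /coord mxE.
Qed.

HB.instance Definition _ := isMeasurableFun.Build _ _ _ _
  row_of_tuple measurable_row_of_tuple.

End rV_measurable.

Section image_measure.
Context {d1 d2 : measure_display} {T1 : measurableType d1}
  {T2 : measurableType d2} {R : realType}.
Variables (m : {measure set T1 -> \bar R}) (f : {mfun T1 >-> T2}).

Definition image_measure : set T2 -> \bar R := pushforward m f.

Let image_measure0 : image_measure set0 = 0%E.
Proof. exact: measure0. Qed.

Let image_measure_ge0 A : (0 <= image_measure A)%E.
Proof. exact: measure_ge0. Qed.

Let image_measure_sigma_additive : semi_sigma_additive image_measure.
Proof. exact: measure_semi_sigma_additive. Qed.

HB.instance Definition _ := isMeasure.Build _ _ _ image_measure
  image_measure0 image_measure_ge0 image_measure_sigma_additive.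

End image_measure.

Section tuple_products.
Context {R : realType} {dT : measure_display} {T : measurableType dT}.

Definition consT n (xt : T * n.-tuple T) : n.+1.-tuple T :=
  [the n.+1.-tuple T of xt.1 :: xt.2].

Lemma measurable_consT n : measurable_fun setT (@consT n).
Proof. exact: measurable_cons. Qed.

HB.instance Definition _ n := isMeasurableFun.Build _ _ _ _
  (@consT n) (@measurable_consT n).

Fixpoint tuple_measure (mu : {sigma_finite_measure set T -> \bar R}) n :
    {measure set (n.-tuple T) -> \bar R} :=
  match n with
  | 0 => \d_[tuple]
  | m.+1 => image_measure (mu \x^ tuple_measure mu m)%E (@consT m)
  end.

Fixpoint tuple_probability (P : probability T R) n :
    probability (n.-tuple T) R :=
  match n with
  | 0 => \d_[tuple]
  | m.+1 => distribution (P \x tuple_probability P m)%E (@consT m)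
  end.

End tuple_products.

Definition lebesgue_rV (R : realType) (d : nat) :
    {measure set 'rV[R]_d -> \bar R} :=
  image_measure (tuple_measure (@lebesgue_measure R) d) row_of_tuple.

Section divergences.
Context {dT : measure_display} {T : measurableType dT} {R : realType}.

Section finite_measure_add.
Variables m1 m2 : {finite_measure set T -> \bar R}.

Let measure_add_fin : fin_num_fun (measure_add m1 m2).
Proof.
by move=> A mA; rewrite measure_addE fin_numD !fin_num_measure.
Qed.

HB.instance Definition _ := Measure.on (measure_add m1 m2).

HB.instance Definition _ := Measure_isFinite.Build _ _ _
  (measure_add m1 m2) measure_add_fin.

End finite_measure_add.

Definition mixture (l : {i01 R}) (P P' : probability T R) :
    {finite_measure set T -> \bar R} :=
  measure_add (mscale l%:num%:nng P) (mscale (1 - l%:num)%:nng P').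

(* P + P' is a dominating measure; the integral does not depend on it. *)
Definition hellinger2 (P P' : probability T R) : R :=
  let mu := measure_add P P' in
  \int[mu]_x
    (Num.sqrt (fine (('d (charge_of_finite_measure P) '/d mu) x)) -
     Num.sqrt (fine (('d (charge_of_finite_measure P') '/d mu) x))) ^+ 2.

Definition chi2 (P' : probability T R)
    (P : {finite_measure set T -> \bar R}) : \bar R :=
  if `[< P' `<< P >] then
    (\int[P]_x
      ((fine (('d (charge_of_finite_measure P') '/d P) x) - 1) ^+ 2)%:E)%E
  else +oo%E.

End divergences.

Section model.
Context {R : realType} {d : nat} {dX : measure_display}
  {X : measurableType dX}.
Variable nu : {sigma_finite_measure set X -> \bar R}.
Implicit Types (Theta S : set 'rV[R]_d) (t u h : 'rV[R]_d).

Definition has_density (P : 'rV[R]_d -> probability X R) Theta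
    (p : 'rV[R]_d -> X -> R) : Prop :=
  forall t, Theta t ->
  [/\ forall x, 0 <= p t x,
      measurable_fun [set: X] (p t) &
      forall A, measurable A -> P t A = (\int[nu]_(x in A) (p t x)%:E)%E].

Definition hellinger_differentiable Theta (p : 'rV[R]_d -> X -> R) t
    (xi : X -> 'rV[R]_d) : Prop :=
  [/\ forall i, measurable_fun [set: X] (fun x => xi x 0 i),
      forall i, nu.-integrable [set: X] (fun x => (xi x 0 i ^+ 2)%:E) &
      forall e : R, 0 < e -> \forall h \near (0 : 'rV[R]_d), Theta (t + h) ->
        (\int[nu]_x ((Num.sqrt (p (t + h) x) - Num.sqrt (p t x)
                       - dotp h (xi x)) ^+ 2)%:E
         <= (e * enorm h ^+ 2)%:E)%E].

Definition fisher_information (xi : X -> 'rV[R]_d) : 'M[R]_d :=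
  \matrix_(i, j) (4 * \int[nu]_x (xi x 0 i * xi x 0 j)).

Definition fisher_defect (p0 : X -> R) (gamma0 : X -> 'rV[R]_d) : 'M[R]_d :=
  \matrix_(i, j) (4 * \int[nu]_x
    (if p0 x == 0 then gamma0 x 0 i * gamma0 x 0 j else 0)).

(* gamma s u is the derivative along the ray theta0 + s u. *)
Definition regularity_R Theta (p : 'rV[R]_d -> X -> R) (theta0 : 'rV[R]_d)
    (gamma : R -> 'rV[R]_d -> X -> 'rV[R]_d) (gamma0 : X -> 'rV[R]_d) : Prop :=
  (forall i, measurable_fun [set: X] (fun x => gamma0 x 0 i)) /\
  exists2 delta : R, 0 < delta /\ eball theta0 delta `<=` Theta &
  [/\ {ae nu, forall x, forall u, enorm u = 1 ->
        let f := fun s => Num.sqrt (p (theta0 + s *: u) x) in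
        abs_continuous 0 delta f /\
        {ae (@lebesgue_measure R), forall s, 0 < s < delta ->
           is_derive s (1 : R) f (dotp u (gamma s u x))}},
      forall u, enorm u = 1 ->
        {ae nu, forall x,
          dotp u (gamma s u x) @[s --> (0 : R)^'+] --> dotp u (gamma0 x)} &
      forall u, enorm u = 1 ->
        nu.-integrable [set: X] (fun x => ereal_sup
          [set (dotp u (gamma s.1 u x) * dotp u (gamma s.2 u x))%:E
          | s in `]0, delta[ `*` `]0, delta[])].

End model.

Section lower_bounds.
Context {R : realType} {d : nat} {dX : measure_display}
  {X : measurableType dX}.
Variables (P : 'rV[R]_d -> probability X R) (I : 'rV[R]_d -> 'M[R]_d)
  (psi : 'rV[R]_d -> R) (theta0 : 'rV[R]_d).
Implicit Types (S : set 'rV[R]_d) (t u h : 'rV[R]_d) (q : 'rV[R]_d -> R).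

Definition local_ball (n : nat) (c : R) : set 'rV[R]_d :=
  eball theta0 (c / Num.sqrt n%:R).

Definition prior_information_entry q (i j : 'I_d) t : R :=
  if 0 < q t then gradient q t 0 i * gradient q t 0 j / q t else 0.

Definition prior_information S q : 'M[R]_d :=
  \matrix_(i, j)
    \int[lebesgue_rV R d]_(t in S) prior_information_entry q i j t.

(* q tends to 0 at every boundary point, along every ray parallel to a
   coordinate axis that reaches this point from inside S. *)
Definition vanishes_at_boundary S q : Prop :=
  forall t, (closure S `\` S°) t -> forall (i : 'I_d) (b : bool),
    let ray := fun s : R => t + (s * (-1) ^+ b) *: delta_mx 0 i in
    (\forall s \near (0 : R)^'+, S (ray s)) ->
    q (ray s) @[s --> (0 : R)^'+] --> (0 : R).

Record nice_prior S (phi : 'rV[R]_d -> R) (Q : probability 'rV[R]_d R) q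
    : Prop := NicePrior {
  prior_density_ge0 : forall t, S t -> 0 <= q t;
  prior_density_measurable : measurable_fun S q;
  prior_densityE : forall A, measurable A ->
    Q A = (\int[lebesgue_rV R d]_(t in A `&` S) (q t)%:E)%E;
  prior_density_ac : abs_continuous_on S q;
  prior_information_finite : forall i j,
    (lebesgue_rV R d).-integrable S
      (fun t => (prior_information_entry q i j t)%:E);
  prior_information_posdef : posdef (prior_information S q);
  prior_phi_integrable : Q.-integrable S (fun t => (phi t)%:E);
  prior_gradient_measurable : forall i,
    measurable_fun S (fun t => gradient phi t 0 i);
  prior_gradient_integrable : Q.-integrable S
    (fun t => (enorm (gradient phi t))%:E);
  prior_fisher_measurable : forall i j, measurable_fun S (fun t => I t i j);
  prior_fisher_trace : (\int[Q]_(t in S) (\tr (I t))%:E < +oo)%E;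
  prior_boundary : vanishes_at_boundary S q
}.

Definition van_trees_information S (phi : 'rV[R]_d -> R)
    (Q : probability 'rV[R]_d R) q (n : nat) : R :=
  qform_inv (\row_i \int[Q]_(t in S) gradient phi t 0 i)
    (prior_information S q
     + n%:R *: \matrix_(i, j) \int[Q]_(t in S) I t i j).

(* Choices for which the integral of |psi - phi|^2 is infinite only contribute
   the value [Gamma^(1/2) - oo]_+ = 0 to the supremum and are left out. *)
Definition L1 (n : nat) (c : R) : \bar R :=
  let S := local_ball n c in
  ereal_sup [set z | exists phi Q q,
    [/\ abs_continuous_on S phi,
        nice_prior S phi Q q,
        Q.-integrable S (fun t => ((psi t - phi t) ^+ 2)%:E) &
        z = ((Num.max 0
          (Num.sqrt (van_trees_information S phi Q q n)
           - Num.sqrt (\int[Q]_(t in S) ((psi t - phi t) ^+ 2)))) ^+ 2)%:E]].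

(* M is the law of (X, t - h) for t ~ Q and X | t ~ P_(phi t)^n; its existence
   includes the measurability of the conditional law in t. *)
Definition shifted_law (phi : 'rV[R]_d -> 'rV[R]_d)
    (Q : probability 'rV[R]_d R) (n : nat) h
    (M : probability (n.-tuple X * 'rV[R]_d)%type R) : Prop :=
  forall A, measurable A ->
  let k t := tuple_probability (P (phi t)) n [set x | A (x, t - h)] in
  measurable_fun [set: 'rV[R]_d] k /\ M A = (\int[Q]_t k t)%E.

Definition increment (phi : 'rV[R]_d -> 'rV[R]_d) h t : R :=
  psi (phi t) - psi (phi (t - h)).

Definition bias_D phi (Q : probability 'rV[R]_d R) h : R :=
  (\int[Q]_t increment phi h t) ^+ 2.

Definition bias_B phi (Q : probability 'rV[R]_d R) h : R :=
  \int[Q]_t (increment phi h t ^+ 2).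

(* The integrals in D and B are required to be finite; a choice with B = oo
   would contribute [. - oo]_+ = 0 (in L2, unless l = 0). *)
Definition admissible S phi (Q : probability 'rV[R]_d R) h : Prop :=
  [/\ diffeomorphism S phi,
      Q.-integrable [set: 'rV[R]_d] (fun t => (increment phi h t)%:E) &
      Q.-integrable [set: 'rV[R]_d] (fun t => (increment phi h t ^+ 2)%:E)].

(* As fine +oo = 0 and x / 0 = 0, the quotient below is 0 when the chi-square
   divergence is infinite, as well as in the case 0 / 0. *)
Definition L2 (n : nat) (c : R) : \bar R :=
  ereal_sup [set z | exists phi Q (l : {i01 R}) h
      (M0 Mh : probability (n.-tuple X * 'rV[R]_d)%type R),
    [/\ admissible (local_ball n c) phi Q h,
        shifted_law phi Q 0 M0,
        shifted_law phi Q h Mh &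
        z = ((Num.max 0
          ((1 - l%:num)
             * Num.sqrt (bias_D phi Q h / fine (chi2 Mh (mixture l Mh M0)))
           - Num.sqrt (l%:num * bias_B phi Q h))) ^+ 2)%:E]].

Definition L3 (n : nat) (c : R) : \bar R :=
  ereal_sup [set z | exists phi Q h
      (M0 Mh : probability (n.-tuple X * 'rV[R]_d)%type R),
    [/\ admissible (local_ball n c) phi Q h,
        shifted_law phi Q 0 M0,
        shifted_law phi Q h Mh &
        z = ((Num.max 0
          (Num.sqrt (bias_D phi Q h / (4 * hellinger2 M0 Mh))
           - Num.sqrt (bias_B phi Q h))) ^+ 2)%:E]].

Definition L4 (n : nat) (c : R) : \bar R :=
  ereal_sup [set z | exists t1 t2,
    [/\ local_ball n c t1, local_ball n c t2 &
        z = (Num.max 0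
          ((1 - hellinger2 (tuple_probability (P t1) n)
                           (tuple_probability (P t2) n)) / 4)
          * `|psi t1 - psi t2| ^+ 2)%:E]].

Definition minimax_risk (n : nat) (c : R) : \bar R :=
  ereal_inf [set ereal_sup
      [set (\int[tuple_probability (P t) n]_x (`|T x - psi t| ^+ 2)%:E)%E
      | t in local_ball n c]
    | T in [set T : n.-tuple X -> R | measurable_fun setT T]].

End lower_bounds.

Definition liminf_scaled (R : realType) (L : nat -> R -> \bar R) : \bar R :=
  limf_einf (fun c : R => limn_einf (fun n => (n%:R%:E * L n c)%E)) +oo%R.

Definition constant_C (R : realType) : R :=
  sup [set e ^+ 2 * (expR (- (e ^+ 2 / 8)) / 2 - 1 / 4)
      | e in [set e : R | 0 <= e]].

(* Main.v *)
Require Import Defs.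
From HB Require Import structures.
From mathcomp Require Import all_boot all_order all_algebra.
From mathcomp Require Import all_classical all_reals all_analysis.
From mathcomp Require Import measurable_realfun.
From mathcomp Require Import ring lra.

Set Implicit Arguments.
Unset Strict Implicit.
Unset Printing Implicit Defensive.

Import Order.TTheory GRing.Theory Num.Theory.
Import numFieldNormedType.Exports.

Local Open Scope classical_set_scope.
Local Open Scope ring_scope.
Local Open Scope charge_scope.

Lemma measurable_fun_sqrt {d} {T : measurableType d} {R : realType}
    (D : set T) (f : T -> R) :
  measurable_fun D f -> measurable_fun D (fun x => Num.sqrt (f x)).
Proof.
move=> mf; apply: measurableT_comp mf.
by apply: continuous_measurable_fun; exact: sqrt_continuous.
Qed.

Lemma measurable_fun_inv_gt0 {d} {T : measurableType d} {R : realType}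
    (f : T -> R) :
  (forall x, 0 < f x) -> measurable_fun setT f ->
  measurable_fun setT (fun x => (f x)^-1).
Proof.
move=> f0 mf.
rewrite -[X in measurable_fun _ X]/((fun y : R => y^-1) \o f).
have mF : measurable (`]0, +oo[%classic : set R) by exact: measurable_itv.
refine (measurable_comp mF _ _ mf).
- by move=> _ /= [x _ <-]; rewrite in_itv/= andbT.
- apply: subspace_continuous_measurable_fun => //.
  apply: continuous_in_subspaceT => x; rewrite inE/= in_itv/= andbT => x0.
  by apply: inv_continuous; rewrite gt_eqF.
Qed.

Lemma integrable_realZ {d} {T : measurableType d} {R : realType}
    (mu : {measure set T -> \bar R}) (D : set T) (k : R) (f : T -> R) :
  measurable D ->
  mu.-integrable D (fun x => (f x)%:E) ->
  mu.-integrable D (fun x => (k * f x)%:E).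
Proof.
move=> mD fi; rewrite [X in _.-integrable _ X](_ : _ = (fun x => k%:E * (f x)%:E)%E).
  exact: integrableZl.
by apply/funext => x; rewrite EFinM.
Qed.

Lemma integrable_realD {d} {T : measurableType d} {R : realType}
    (mu : {measure set T -> \bar R}) (D : set T) (f g : T -> R) :
  measurable D ->
  mu.-integrable D (fun x => (f x)%:E) ->
  mu.-integrable D (fun x => (g x)%:E) ->
  mu.-integrable D (fun x => (f x + g x)%:E).
Proof.
move=> mD fi gi.
rewrite [X in _.-integrable _ X](_ : _ = (fun x => (f x)%:E + (g x)%:E)%E).
  exact: integrableD.
by apply/funext => x; rewrite EFinD.
Qed.

Section density.
Context {d} {T : measurableType d} {R : realType}.

Lemma ge0_integral_density (mu : {sigma_finite_measure set T -> \bar R})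
    (P : {finite_measure set T -> \bar R}) (p : T -> R) (f : T -> \bar R) :
  (forall x, 0 <= p x) -> measurable_fun [set: T] p ->
  (forall A, measurable A -> P A = (\int[mu]_(x in A) (p x)%:E)%E) ->
  (forall x, (0 <= f x)%E) -> measurable_fun [set: T] f ->
  (\int[P]_x f x = \int[mu]_x (f x * (p x)%:E))%E.
Proof.
move=> p0 mp Pp f0 mf.
have Pmu : P `<< mu.
  apply/null_content_dominatesP => A mA muA0; rewrite Pp//.
  by rewrite null_set_integral//; exact/measurable_EFinP/measurable_funTS.
rewrite -(Radon_Nikodym_SigmaFinite.change_of_variables Pmu)//.
have mr := measurable_int _ (Radon_Nikodym_SigmaFinite.f_integrable Pmu).
apply: ge0_ae_eq_integral => //.
- exact: emeasurable_funM.
- by apply: emeasurable_funM => //; exact/measurable_EFinP.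
- by move=> x _; rewrite mule_ge0//; exact: Radon_Nikodym_SigmaFinite.f_ge0.
- by move=> x _; rewrite mule_ge0// lee_fin.
- apply: ae_eqe_mul2l; apply: integral_ae_eq => //.
  + exact: Radon_Nikodym_SigmaFinite.f_integrable.
  + exact/measurable_EFinP.
  + move=> A _ mA; rewrite -Pp//.
    by rewrite -(Radon_Nikodym_SigmaFinite.f_integral Pmu).
Qed.

End density.

(* Two probabilities P, P' have densities r, 1 - r w.r.t. P + P' *)
Section densities_of_pair.
Context {d} {T : measurableType d} {R : realType}.
Variables P P' : probability T R.
Let mu : {finite_measure set T -> \bar R} := measure_add P P'.

Lemma mu_dominatesl : P `<< mu.
Proof.
apply/null_content_dominatesP => A mA muA0.
have : measure_add P P' A == 0%E by apply/eqP.
by rewrite measure_addE padde_eq0// => /andP[/eqP].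
Qed.

Lemma mu_dominatesr : P' `<< mu.
Proof.
apply/null_content_dominatesP => A mA muA0.
have : measure_add P P' A == 0%E by apply/eqP.
by rewrite measure_addE padde_eq0// => /andP[_ /eqP].
Qed.
End densities_of_pair.

Lemma densities_of_pair {d} {T : measurableType d} {R : realType}
    (P P' : probability T R) :
  let mu : {finite_measure set T -> \bar R} := measure_add P P' in
  exists r : T -> R,
  [/\ measurable_fun [set: T] r, forall x, 0 <= r x <= 1,
      ae_eq mu setT ('d (charge_of_finite_measure P) '/d mu) (fun x => (r x)%:E) &
      ae_eq mu setT ('d (charge_of_finite_measure P') '/d mu)
        (fun x => (1 - r x)%:E)].
Proof.
move=> mu.
have Pmu : P `<< mu by exact: mu_dominatesl.
have P'mu : P' `<< mu by exact: mu_dominatesr.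
pose g := 'd (charge_of_finite_measure P) '/d mu.
pose g' := 'd (charge_of_finite_measure P') '/d mu.
have ig : mu.-integrable setT g by exact: Radon_Nikodym_integrable.
have /integrableP[mg _] := ig.
have ig' : mu.-integrable setT g' by exact: Radon_Nikodym_integrable.
have gint A : measurable A -> P A = (\int[mu]_(x in A) g x)%E.
  by move=> mA; rewrite -Radon_Nikodym_integral.
have g'int A : measurable A -> P' A = (\int[mu]_(x in A) g' x)%E.
  by move=> mA; rewrite -Radon_Nikodym_integral.
have gf x : g x \is a fin_num by exact: Radon_Nikodym_fin_num.
have g'f x : g' x \is a fin_num by exact: Radon_Nikodym_fin_num.
have gg' : ae_eq mu setT (g \+ g')%E (cst 1%E).
  apply: integral_ae_eq => //.
  - exact: integrableD.
  - move=> A _ mA; rewrite integralD//;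
      [|exact: integrableS ig|exact: integrableS ig'].
    by rewrite -gint// -g'int// integral_cst// mul1e; exact/esym/measure_addE.
have g0 : {ae mu, forall x, setT x -> (0 <= g x)%E}.
  have := ae_eq_Radon_Nikodym_SigmaFinite Pmu measurableT.
  apply: filterS => x /(_ Logic.I) h _; rewrite /g -h.
  exact: Radon_Nikodym_SigmaFinite.f_ge0.
have g'0 : {ae mu, forall x, setT x -> (0 <= g' x)%E}.
  have := ae_eq_Radon_Nikodym_SigmaFinite P'mu measurableT.
  apply: filterS => x /(_ Logic.I) h _; rewrite /g' -h.
  exact: Radon_Nikodym_SigmaFinite.f_ge0.
pose r x := Num.min 1 (Num.max 0 (fine (g x))).
exists r.
have key : {ae mu, forall x, (g x = (r x)%:E /\ g' x = (1 - r x)%:E)%E}.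
  apply: filterS3 gg' g0 g'0 => x /(_ Logic.I)/= h /(_ Logic.I) h0 /(_ Logic.I) h0'.
  move: h h0 h0'; rewrite /r -(fineK (gf x)) -(fineK (g'f x)) /= -EFinD !lee_fin.
  move=> [] h h0 h0'; rewrite (max_idPr h0) (min_idPr _); last first.
    by rewrite -h lerDl.
  by rewrite -h addrC addKr.
split.
- apply: measurable_minr => //; apply: measurable_maxr => //.
  exact: measurableT_comp.
- by move=> x; rewrite /r le_min ler01 /= le_max lexx /= ge_min lexx.
- by apply: filterS key => x [].
- by apply: filterS key => x [].
Qed.
Lemma hellinger_density {d} {T : measurableType d} {R : realType}
    (P P' : probability T R) :
  let mu : {finite_measure set T -> \bar R} := measure_add P P' in
  exists r : T -> R,
  [/\ measurable_fun [set: T] r, forall x, 0 <= r x <= 1,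
      forall A, measurable A -> P A = (\int[mu]_(x in A) (r x)%:E)%E,
      forall A, measurable A -> P' A = (\int[mu]_(x in A) (1 - r x)%:E)%E &
      hellinger2 P P' = \int[mu]_x (Num.sqrt (r x) - Num.sqrt (1 - r x)) ^+ 2].
Proof.
move=> mu.
have [r [mr r01 rP rP']] := densities_of_pair P P'.
have mr' : measurable_fun setT (fun x => 1 - r x) by exact: measurable_funB.
exists r; split => //.
- move=> A mA.
  apply: (etrans (Radon_Nikodym_integral (nu := charge_of_finite_measure P) (mu := mu) (mu_dominatesl (P := P) (P' := P')) mA)).
  have hi := Radon_Nikodym_integrable (nu := charge_of_finite_measure P) (mu := mu) (mu_dominatesl (P := P) (P' := P')).
  apply: ae_eq_integral => //.
  + by apply: measurable_funTS; case/integrableP : hi.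
  + exact/measurable_EFinP/measurable_funTS.
  + by apply: filterS rP => x /(_ Logic.I).
- move=> A mA.
  apply: (etrans (Radon_Nikodym_integral (nu := charge_of_finite_measure P') (mu := mu) (mu_dominatesr (P := P) (P' := P')) mA)).
  have hi := Radon_Nikodym_integrable (nu := charge_of_finite_measure P') (mu := mu) (mu_dominatesr (P := P) (P' := P')).
  apply: ae_eq_integral => //.
  + by apply: measurable_funTS; case/integrableP : hi.
  + exact/measurable_EFinP/measurable_funTS.
  + by apply: filterS rP' => x /(_ Logic.I).
- rewrite /hellinger2 /Rintegral; congr fine; apply: ae_eq_integral => //.
  + apply/measurable_EFinP; apply: measurable_funX; apply: measurable_funB.
      apply: measurable_fun_sqrt.
      by apply: measurableT_comp => //; case/integrableP: (Radon_Nikodym_integrable (nu := charge_of_finite_measure P) (mu := mu) (mu_dominatesl (P := P) (P' := P'))).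
    apply: measurable_fun_sqrt.
    by apply: measurableT_comp => //; case/integrableP: (Radon_Nikodym_integrable (nu := charge_of_finite_measure P') (mu := mu) (mu_dominatesr (P := P) (P' := P'))).
  + apply/measurable_EFinP; apply: measurable_funX; apply: measurable_funB;
      exact: measurable_fun_sqrt.
  + by apply: filterS2 rP rP' => x /(_ Logic.I) -> /(_ Logic.I) ->.
Qed.

Lemma ge0_le_integralT {d} {T : measurableType d} {R : realType}
  (mu : {measure set T -> \bar R}) (f g : T -> \bar R) :
  (forall x, (0 <= f x)%E) -> measurable_fun setT f -> measurable_fun setT g ->
  (forall x, (f x <= g x)%E) -> (\int[mu]_x f x <= \int[mu]_x g x)%E.
Proof.
move=> f0 mf mg fg; apply: ge0_le_integral => //.
Qed.

Section hellinger_theory.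
Context {d} {T : measurableType d} {R : realType}.
Implicit Types P : probability T R.

(* affinity lower bound, dual form *)
Definition affinity_ge P (P' : probability T R) (a : R) :=
  forall (f : T -> R) (m M : R), measurable_fun [set: T] f -> 0 < m ->
    (forall x, m <= f x <= M) ->
  ((2 * a)%:E <= \int[P]_x (f x)%:E + \int[P']_x ((f x)^-1)%:E)%E.

Lemma bounded_integrable (mu : {finite_measure set T -> \bar R}) (f : T -> R) (M : R) :
  measurable_fun [set: T] f -> (forall x, `|f x| <= M) ->
  mu.-integrable [set: T] (fun x => (f x)%:E).
Proof.
move=> mf fM.
apply: measurable_bounded_integrable => //.
  by rewrite -ge0_fin_numE//; exact: fin_num_measure.
exists M; split; first exact: num_real.
by move=> y My x _ /=; exact: le_trans (fM x) (ltW My).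
Qed.

Lemma affinity_ge_hellinger2 P (P' : probability T R) a :
  affinity_ge P P' a -> hellinger2 P P' <= 2 - 2 * a.
Proof.
move=> aff.
pose mu : {finite_measure set T -> \bar R} := measure_add P P'.
have [r [mr r01 rP rP' ->]] := hellinger_density P P'.
pose r' x := 1 - r x.
have r0 x : 0 <= r x by case/andP: (r01 x).
have r'0 x : 0 <= r' x by rewrite /r' subr_ge0; case/andP: (r01 x).
have mr' : measurable_fun setT r' by exact: measurable_funB.
have muT : mu setT = 2%:E.
  have -> : mu setT = (P setT + P' setT)%E by exact: measure_addE.
  by rewrite !probability_setT -EFinD.
have msq (f : T -> R) : measurable_fun setT f -> measurable_fun setT (fun x => Num.sqrt (f x)).
  exact: measurable_fun_sqrt.
pose s x := Num.sqrt (r x) * Num.sqrt (r' x).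
have ms : measurable_fun setT s by apply: measurable_funM; exact: msq.
have s0 x : 0 <= s x by rewrite mulr_ge0 ?sqrtr_ge0.
have sqrt1 (x y : R) : 0 <= x <= 1 -> 0 <= y <= 1 -> 0 <= Num.sqrt x * Num.sqrt y <= 1.
  move=> /andP[x0 x1] /andP[y0 y1]; rewrite mulr_ge0 ?sqrtr_ge0//=.
  by rewrite mulr_ile1 ?sqrtr_ge0// -sqrtr1 ler_wsqrtr.
have s1 x : 0 <= s x <= 1.
  by apply: sqrt1 => //; rewrite r'0 /r' gerBl r0.
have int_s : mu.-integrable setT (fun x => (s x)%:E).
  apply: (@bounded_integrable _ _ 1) => // x.
  by have /andP[? ?] := s1 x; rewrite ger0_norm.
pose S := \int[mu]_x s x.
have -> : \int[mu]_x (Num.sqrt (r x) - Num.sqrt (1 - r x)) ^+ 2 = 2 - 2 * S.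
  transitivity (\int[mu]_x (1 - 2 * s x)).
    apply: eq_Rintegral => x _.
    rewrite sqrrB !sqr_sqrtr//; last exact: r'0.
    by rewrite /s -/(r' x) -mulr_natl /r'; ring.
  rewrite RintegralB//; last 2 first.
  - exact: finite_measure_integrable_cst.
  - exact: integrable_realZ.
  rewrite RintegralZl// Rintegral_cst// /S.
  by congr (_ - _); rewrite mul1r -[X in fine X]/(mu setT) muT.
suff : a <= S by lra.
apply/ler_addgt0Pl => e e0.
(* regularisation *)
pose k := Num.min 1 ((e / 4) ^+ 2).
have k0 : 0 < k by rewrite lt_min ltr01 exprn_gt0// divr_gt0.
have k1 : k <= 1 by rewrite ge_min lexx.
have kk : k + k <= (e / 2) ^+ 2.
  have : k <= (e / 4) ^+ 2 by rewrite ge_min lexx orbT.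
  have := sqr_ge0 e; rewrite !expr_div_n; lra.
pose f x := Num.sqrt (r' x + k) / Num.sqrt (r x + k).
have rk x : 0 < r x + k by rewrite ltr_wpDl.
have r'k x : 0 < r' x + k by rewrite ltr_wpDl.
have sk (y : R) : 0 <= y <= 1 -> Num.sqrt k <= Num.sqrt (y + k) <= 2.
  move=> /andP[y0 y1]; rewrite ler_wsqrtr ?lerDr//=.
  rewrite (_ : 2 = Num.sqrt (2 ^+ 2)); last by rewrite sqrtr_sqr ger0_norm.
  by rewrite ler_wsqrtr// expr2; lra.
have sk0 : 0 < Num.sqrt k by rewrite sqrtr_gt0.
have r'01 x : 0 <= r' x <= 1 by rewrite r'0 /r' gerBl r0.
have mf : measurable_fun setT f.
  apply: measurable_funM; first by apply: msq; apply: measurable_funD.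
  apply: measurable_fun_inv_gt0; first by move=> x; rewrite sqrtr_gt0.
  by apply: msq; apply: measurable_funD.
have fi x : (f x)^-1 = Num.sqrt (r x + k) / Num.sqrt (r' x + k).
  by rewrite /f invf_div.
have m0 : 0 < Num.sqrt k / 2 by rewrite divr_gt0.
have fb x : Num.sqrt k / 2 <= f x <= 2 / Num.sqrt k.
  have /andP[a1 a2] := sk _ (r01 x); have /andP[b1 b2] := sk _ (r'01 x).
  have p1 : 0 < Num.sqrt (r x + k) by rewrite sqrtr_gt0.
  rewrite /f ler_pdivlMr// ler_pdivrMr//.
  apply/andP; split.
    apply: le_trans b1; rewrite mulrAC ler_pdivrMr// ler_pM2l//.
  apply: (le_trans b2); rewrite mulrAC ler_pdivlMr//.
  by rewrite ler_pM2l.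
have := aff f _ _ mf m0 fb.
have f0 x : 0 <= f x by rewrite divr_ge0 ?sqrtr_ge0.
have mfi : measurable_fun setT (fun x => (f x)^-1).
  under eq_fun do rewrite fi.
  apply: measurable_funM; first by apply: msq; apply: measurable_funD.
  apply: measurable_fun_inv_gt0; first by move=> x; rewrite sqrtr_gt0.
  by apply: msq; apply: measurable_funD.
rewrite (ge0_integral_density (mu := mu) r0 mr rP); last 2 first.
- by move=> x; rewrite lee_fin.
- exact/measurable_EFinP.
rewrite (ge0_integral_density (mu := mu) r'0 mr' rP'); last 2 first.
- by move=> x; rewrite lee_fin invr_ge0.
- exact/measurable_EFinP.
(* pointwise bound *)
have pw (u v : R) : 0 <= u -> 0 <= v -> u + v = 1 ->
    Num.sqrt (v + k) / Num.sqrt (u + k) * u <= Num.sqrt u * Num.sqrt v + e / 2.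
  move=> u0 v0 uv.
  have uk : 0 < Num.sqrt (u + k) by rewrite sqrtr_gt0 ltr_wpDl.
  apply: (@le_trans _ _ (Num.sqrt (v + k) * Num.sqrt (u + k))).
    rewrite mulrAC -mulrA ler_wpM2l ?sqrtr_ge0// ler_pdivrMr//.
    rewrite -expr2 sqr_sqrtr; last by rewrite addr_ge0// ltW.
    by rewrite lerDl ltW.
  rewrite -sqrtrM; last by rewrite addr_ge0// ltW.
  have t0 : 0 <= Num.sqrt u * Num.sqrt v by rewrite mulr_ge0 ?sqrtr_ge0.
  rewrite -(@ger0_norm _ (_ + e / 2)); last by rewrite addr_ge0// divr_ge0// ltW.
  rewrite -sqrtr_sqr ler_wsqrtr//.
  rewrite sqrrD exprMn !sqr_sqrtr//.
  have : 0 <= Num.sqrt u * Num.sqrt v * (e / 2) *+ 2.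
    by rewrite mulrn_wge0// mulr_ge0// divr_ge0// ltW.
  have -> : (v + k) * (u + k) = u * v + k * (u + v) + k * k by ring.
  rewrite uv mulr1; have : k * k <= k by rewrite ler_piMr// ltW.
  lra.
rewrite -ge0_integralD//; last 4 first.
- by move=> x _; rewrite -EFinM lee_fin mulr_ge0.
- by apply/measurable_EFinP; apply: measurable_funM.
- by move=> x _; rewrite -EFinM lee_fin mulr_ge0// invr_ge0.
- by apply/measurable_EFinP; apply: measurable_funM.
move=> /le_trans.
have /[swap]/[apply] : ((\int[mu]_x ((f x)%:E * (r x)%:E + ((f x)^-1)%:E * (r' x)%:E)
      <= \int[mu]_x (2 * s x + e)%:E)%E).
  apply: ge0_le_integral => //.
  - by move=> x _; rewrite -!EFinM -EFinD lee_fin addr_ge0// mulr_ge0// invr_ge0.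
  - by apply/measurable_EFinP; apply: measurable_funD; apply: measurable_funM.
  - apply/measurable_EFinP; apply: measurable_funD => //; exact: measurable_funM.
  move=> x _; rewrite -!EFinM -EFinD lee_fin.
  have h : r x + r' x = 1 by rewrite /r' addrC subrK.
  have := pw _ _ (r0 x) (r'0 x) h.
  have := pw _ _ (r'0 x) (r0 x) (etrans (addrC _ _) h).
  rewrite -/(f x) -fi (mulrC (Num.sqrt (r' x))) -/(s x); lra.
have -> : (\int[mu]_x (2 * s x + e)%:E)%E = (2 * S + 2 * e)%:E.
  rewrite -[LHS]fineK; last first.
    apply: integrable_fin_num => //.
    apply: integrable_realD => //; first exact: integrable_realZ.
    exact: finite_measure_integrable_cst.
  congr _%:E; rewrite -[LHS]/(\int[mu]_x (2 * s x + e)) RintegralD//; last 2 first.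
  - exact: integrable_realZ.
  - exact: finite_measure_integrable_cst.
  rewrite RintegralZl// Rintegral_cst// -[X in fine X]/(mu setT) muT /S /=; ring.
by rewrite lee_fin; lra.
Qed.
End hellinger_theory.
Section affinity_tensor.
Context {R : realType}.

Lemma integral_between {d} {T : measurableType d} (P : probability T R)
    (f : T -> R) (m M : R) :
  measurable_fun [set: T] f -> 0 <= m -> (forall x, m <= f x <= M) ->
  exists u : R, (\int[P]_x (f x)%:E = u%:E)%E /\ m <= u <= M.
Proof.
move=> mf m0 fmM.
have iP c : (\int[P]_x c%:E = c%:E)%E.
  by rewrite integral_cst// [X in (_ * X)%E]probability_setT mule1.
have f0 x : 0 <= f x by case/andP : (fmM x) => + _; exact: le_trans.
have l1 : (m%:E <= \int[P]_x (f x)%:E)%E.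
  rewrite -(iP m); apply: ge0_le_integralT => //.
  - exact/measurable_EFinP.
  - by move=> x; rewrite lee_fin; case/andP : (fmM x).
have l2 : (\int[P]_x (f x)%:E <= M%:E)%E.
  rewrite -(iP M); apply: ge0_le_integralT => //.
  - exact/measurable_EFinP.
  - by move=> x; rewrite lee_fin; case/andP : (fmM x).
exists (fine (\int[P]_x (f x)%:E)).
have fi : (\int[P]_x (f x)%:E)%E \is a fin_num.
  rewrite fin_numE; apply/andP; split.
    by rewrite -ltNye (lt_le_trans _ l1)// ltNyr.
  by rewrite -ltey (le_lt_trans l2)// ltry.
by rewrite -!lee_fin !fineK// l1 l2.
Qed.

Lemma inv_between (m M x : R) : 0 < m -> m <= x <= M -> M^-1 <= x^-1 <= m^-1.
Proof.
move=> m0 /andP[mx xM]; have x0 := lt_le_trans m0 mx.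
by rewrite !lef_pV2 ?posrE ?mx ?xM// (lt_le_trans x0).
Qed.

Lemma affinity_ge_mul {d} {T : measurableType d} (P P' : probability T R)
    (a m M u u' : R) (f : T -> R) :
  affinity_ge P P' a -> 0 <= a -> measurable_fun [set: T] f -> 0 < m ->
  (forall x, m <= f x <= M) ->
  (\int[P]_x (f x)%:E = u%:E)%E -> (\int[P']_x ((f x)^-1)%:E = u'%:E)%E ->
  a ^+ 2 <= u * u'.
Proof.
move=> aff a0 mf m0 fmM ui u'i.
have f0 x : 0 < f x by case/andP : (fmM x) => + _; exact: lt_le_trans.
have mfi : measurable_fun setT (fun x => (f x)^-1).
  exact: measurable_fun_inv_gt0.
have mM : 0 < M.
  have /andP[] := fmM point; exact: (fun h1 h2 => lt_le_trans m0 (le_trans h1 h2)).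
have u0 : 0 < u.
  have [v [vi /andP[mv _]]] := integral_between P mf (ltW m0) fmM.
  by move: vi; rewrite ui => -[->]; exact: lt_le_trans mv.
have u'0 : 0 < u'.
  have Mi : 0 <= M^-1 by rewrite invr_ge0 ltW.
  have [v [vi /andP[mv _]]] := integral_between P' mfi Mi
    (fun x => inv_between m0 (fmM x)).
  by move: vi; rewrite u'i => -[->]; apply: lt_le_trans mv; rewrite invr_gt0.
pose c := Num.sqrt (u' / u).
have c0 : 0 < c by rewrite sqrtr_gt0 divr_gt0.
have mcf : measurable_fun setT (fun x => c * f x) by exact: measurable_funM.
have cb x : c * m <= c * f x <= c * M by rewrite !ler_pM2l.
have /= := aff _ _ _ mcf (mulr_gt0 c0 m0) cb.
under eq_integral do rewrite EFinM.
rewrite ge0_integralZl//; last 3 first.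
- exact/measurable_EFinP.
- by move=> x _; rewrite lee_fin ltW.
- by rewrite lee_fin ltW.
under [X in (_ + X)%E]eq_integral do rewrite invfM EFinM.
rewrite ge0_integralZl//; last 3 first.
- exact/measurable_EFinP.
- by move=> x _; rewrite lee_fin invr_ge0 ltW.
- by rewrite lee_fin invr_ge0 ltW.
rewrite ui u'i -!EFinM -EFinD lee_fin.
have cc : c ^+ 2 = u' / u by rewrite sqr_sqrtr// ltW// divr_gt0.
have -> : c^-1 * u' = c * u.
  have cn0 : c != 0 by rewrite gt_eqF.
  apply: (mulfI cn0); rewrite mulVKf// mulrA -expr2 cc divfK// gt_eqF//.
have -> : u * u' = (c * u) ^+ 2.
  by rewrite exprMn cc; field; rewrite gt_eqF.
move=> h; rewrite ler_pXn2r// ?nnegrE//; last by rewrite mulr_ge0// ltW.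
by lra.
Qed.

Lemma affinity_ge_prod {d d'} {T : measurableType d} {T' : measurableType d'}
    (P1 P2 : probability T R) (Q1 Q2 : probability T' R) (a b : R) :
  affinity_ge P1 P2 a -> affinity_ge Q1 Q2 b -> 0 <= b ->
  forall (f : T * T' -> R) (m M : R), measurable_fun [set: T * T'] f -> 0 < m ->
    (forall x, m <= f x <= M) ->
  ((2 * (a * b))%:E <= \int[P1 \x Q1]_x (f x)%:E + \int[P2 \x Q2]_x ((f x)^-1)%:E)%E.
Proof.
move=> affP affQ b0 f m M mf m0 fmM.
have f0 x : 0 < f x by case/andP : (fmM x) => + _; exact: lt_le_trans.
have mfi : measurable_fun setT (fun x => (f x)^-1).
  exact: measurable_fun_inv_gt0.
move: b0; rewrite le_eqVlt => /orP[/eqP <-|b0].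
  rewrite mulr0 mulr0; apply: adde_ge0; apply: integral_ge0 => x _.
    by rewrite lee_fin ltW.
  by rewrite lee_fin invr_ge0 ltW.
have msec (g : T * T' -> R) x : measurable_fun setT g -> measurable_fun setT (fun y => g (x, y)).
  by move=> mg; apply: (measurableT_comp mg); exact: measurable_pair1.
rewrite (fubini_tonelli1 (fun z => (f z)%:E))//; last 2 first.
- exact/measurable_EFinP.
- by move=> x; rewrite lee_fin ltW.
rewrite (fubini_tonelli1 (fun z => ((f z)^-1)%:E))//; last 2 first.
- exact/measurable_EFinP.
- by move=> x; rewrite lee_fin invr_ge0 ltW.
rewrite /fubini_F.
pose Phi x := fine (\int[Q1]_y (f (x, y))%:E)%E.
pose Psi x := fine (\int[Q2]_y ((f (x, y))^-1)%:E)%E.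
have PhiE x : (\int[Q1]_y (f (x, y))%:E = (Phi x)%:E)%E /\ m <= Phi x <= M.
  have [u [ui umM]] := integral_between Q1 (msec f x mf) (ltW m0) (fun y => fmM (x, y)).
  by rewrite /Phi ui.
have M0 : 0 < M.
  have /andP[] := fmM point; exact: (fun h1 h2 => lt_le_trans m0 (le_trans h1 h2)).
have Mi : 0 <= M^-1 by rewrite invr_ge0 ltW.
have PsiE x : (\int[Q2]_y ((f (x, y))^-1)%:E = (Psi x)%:E)%E /\ M^-1 <= Psi x <= m^-1.
  have [u [ui umM]] := integral_between Q2 (msec _ x mfi) Mi
     (fun y => inv_between m0 (fmM (x, y))).
  by rewrite /Psi ui.
have mPhi : measurable_fun setT Phi.
  rewrite /Phi; apply: (measurableT_comp (@fine_measurable R setT measurableT)).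
  apply: (measurable_fun_fubini_tonelli_F (m2 := Q1) (fun z => (f z)%:E)).
    exact/measurable_EFinP.
  by move=> x; rewrite lee_fin ltW.
have mPsi : measurable_fun setT Psi.
  rewrite /Psi; apply: (measurableT_comp (@fine_measurable R setT measurableT)).
  apply: (measurable_fun_fubini_tonelli_F (m2 := Q2) (fun z => ((f z)^-1)%:E)).
    exact/measurable_EFinP.
  by move=> x; rewrite lee_fin invr_ge0 ltW.
have key x : b ^+ 2 <= Phi x * Psi x.
  exact: (affinity_ge_mul affQ (ltW b0) (msec f x mf) m0 (fun y => fmM (x, y))
    (PhiE x).1 (PsiE x).1).
have Phi0 x : 0 < Phi x by case/andP : (PhiE x).2 => + _; exact: lt_le_trans.
under eq_integral do rewrite (PhiE _).1.
under [X in (_ + X)%E]eq_integral do rewrite (PsiE _).1.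
have mb : measurable_fun setT (fun x => b^-1 * Phi x) by exact: measurable_funM.
have bi0 : 0 < b^-1 by rewrite invr_gt0.
have bb x : b^-1 * m <= b^-1 * Phi x <= b^-1 * M by rewrite !ler_pM2l// (PhiE x).2.
have /= := affP _ _ _ mb (mulr_gt0 bi0 m0) bb.
under eq_integral do rewrite EFinM.
rewrite ge0_integralZl//; last 3 first.
- exact/measurable_EFinP.
- by move=> x _; rewrite lee_fin ltW.
- by rewrite lee_fin ltW.
move=> h.
have : (b%:E * (2 * a)%:E <= \int[P1]_x (Phi x)%:E + b%:E * \int[P2]_x ((b^-1 * Phi x)^-1)%:E)%E.
  apply: (le_trans (lee_wpmul2l _ h)); first by rewrite lee_fin ltW.
  rewrite ge0_muleDr ?integral_ge0//; last 2 first.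
  - by rewrite mule_ge0// ?lee_fin ?(ltW bi0)// integral_ge0// => x _; rewrite lee_fin ltW.
  - by move=> x _; rewrite lee_fin invr_ge0 mulr_ge0// ltW.
  by rewrite muleA -EFinM divff ?gt_eqF// mul1e.
rewrite -EFinM (_ : b * (2 * a) = 2 * (a * b)); last by ring.
move=> /le_trans; apply; rewrite leeD2l//.
rewrite -ge0_integralZl//; last 3 first.
- apply/measurable_EFinP/measurable_fun_inv_gt0 => // x; exact: mulr_gt0.
- by move=> x _; rewrite lee_fin invr_ge0 mulr_ge0// ltW.
- by rewrite lee_fin ltW.
apply: ge0_le_integralT => //.
- by move=> x; rewrite -EFinM lee_fin mulr_ge0// ?(ltW b0)// invr_ge0 mulr_ge0// ltW.
- apply/measurable_EFinP; apply: measurable_funM => //.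
  by apply: measurable_fun_inv_gt0 => // x; exact: mulr_gt0.
- exact/measurable_EFinP.
move=> x; rewrite -EFinM lee_fin invfM invrK mulrA -expr2 ler_pdivrMr//.
by rewrite mulrC.
Qed.

Lemma affinity_ge_tuple {d} {T : measurableType d} (P P' : probability T R)
    (a : R) n :
  affinity_ge P P' a -> 0 <= a ->
  affinity_ge (tuple_probability P n) (tuple_probability P' n) (a ^+ n).
Proof.
move=> aff a0; elim: n => [|n IH].
  move=> f m M mf m0 fmM /=.
  rewrite !integral_dirac//; last 2 first.
  - apply/measurable_EFinP/measurable_fun_inv_gt0 => // x.
    by case/andP : (fmM x) => + _; exact: lt_le_trans.
  - exact/measurable_EFinP.
  rewrite !diracT !mul1e expr0 mulr1 -EFinD lee_fin.
  have : 0 < f [tuple] by case/andP : (fmM [tuple]) => + _; exact: lt_le_trans.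
  set x := f _ => x0; rewrite -subr_ge0.
  have -> : x + x^-1 - 2 = (x - 1) ^+ 2 / x by field; rewrite gt_eqF.
  by rewrite divr_ge0 ?sqr_ge0// ltW.
move=> f m M mf m0 fmM /=.
have f0 x : 0 < f x by case/andP : (fmM x) => + _; exact: lt_le_trans.
have mfi : measurable_fun setT (fun x => (f x)^-1).
  exact: measurable_fun_inv_gt0.
rewrite !ge0_integral_distribution//; last 4 first.
- exact/measurable_EFinP.
- by move=> x; rewrite lee_fin invr_ge0 ltW.
- exact/measurable_EFinP.
- by move=> x; rewrite lee_fin ltW.
rewrite exprS.
have mfc := measurableT_comp mf (@measurable_consT _ T n).
exact: (affinity_ge_prod aff IH (exprn_ge0 n a0) mfc m0 (fun z => fmM _)).
Qed.

Lemma affinity_ge_density {d} {T : measurableType d}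
    (nu : {sigma_finite_measure set T -> \bar R}) (P P' : probability T R)
    (p p' : T -> R) (h : R) :
  (forall x, 0 <= p x) -> measurable_fun [set: T] p ->
  (forall A, measurable A -> P A = (\int[nu]_(x in A) (p x)%:E)%E) ->
  (forall x, 0 <= p' x) -> measurable_fun [set: T] p' ->
  (forall A, measurable A -> P' A = (\int[nu]_(x in A) (p' x)%:E)%E) ->
  (\int[nu]_x ((Num.sqrt (p x) - Num.sqrt (p' x)) ^+ 2)%:E <= h%:E)%E ->
  affinity_ge P P' (1 - h / 2).
Proof.
move=> p0 mp Pp p'0 mp' Pp' Hh f m M mf m0 fmM.
have f0 x : 0 < f x by case/andP : (fmM x) => + _; exact: lt_le_trans.
have mfi : measurable_fun setT (fun x => (f x)^-1).
  exact: measurable_fun_inv_gt0.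
rewrite (ge0_integral_density p0 mp Pp); last 2 first.
- by move=> x; rewrite lee_fin ltW.
- exact/measurable_EFinP.
rewrite (ge0_integral_density p'0 mp' Pp'); last 2 first.
- by move=> x; rewrite lee_fin invr_ge0 ltW.
- exact/measurable_EFinP.
have mh : measurable_fun setT (fun x => (Num.sqrt (p x) - Num.sqrt (p' x)) ^+ 2).
  by apply: measurable_funX; apply: measurable_funB; exact: measurable_fun_sqrt.
have two : (2%:E <= \int[nu]_x ((f x)%:E * (p x)%:E) +
    \int[nu]_x (((f x)^-1)%:E * (p' x)%:E) +
    \int[nu]_x ((Num.sqrt (p x) - Num.sqrt (p' x)) ^+ 2)%:E)%E.
  have -> : (2%:E = \int[nu]_x (p x + p' x)%:E :> \bar R)%E.
    under eq_integral do rewrite EFinD.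
    rewrite ge0_integralD//; last 4 first.
    - by move=> x _; rewrite lee_fin.
    - exact/measurable_EFinP.
    - by move=> x _; rewrite lee_fin.
    - exact/measurable_EFinP.
    by rewrite -Pp// -Pp'// !probability_setT -EFinD.
  rewrite -ge0_integralD//; last 4 first.
  - by move=> x _; rewrite -EFinM lee_fin mulr_ge0// ltW.
  - by apply/measurable_EFinP; exact: measurable_funM.
  - by move=> x _; rewrite -EFinM lee_fin mulr_ge0// invr_ge0 ltW.
  - by apply/measurable_EFinP; exact: measurable_funM.
  rewrite -ge0_integralD//; last 4 first.
  - move=> x _; rewrite -!EFinM -EFinD lee_fin.
    by rewrite addr_ge0// mulr_ge0// ?invr_ge0 ltW.
  - by apply/measurable_EFinP; apply: measurable_funD; exact: measurable_funM.
  - by move=> x _; rewrite lee_fin sqr_ge0.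
  - exact/measurable_EFinP.
  apply: ge0_le_integralT => //.
  - by move=> x; rewrite lee_fin addr_ge0.
  - by apply/measurable_EFinP; exact: measurable_funD.
  - apply/measurable_EFinP; apply: measurable_funD => //.
    by apply: measurable_funD; exact: measurable_funM.
  move=> x; rewrite -!EFinM -!EFinD lee_fin sqrrB !sqr_sqrtr//.
  have fx := f0 x.
  set s := Num.sqrt (p x); set s' := Num.sqrt (p' x).
  have ps : p x = s ^+ 2 by rewrite sqr_sqrtr.
  have ps' : p' x = s' ^+ 2 by rewrite sqr_sqrtr.
  rewrite -subr_ge0 ps ps'.
  have -> : f x * s ^+ 2 + (f x)^-1 * s' ^+ 2 +
    (s ^+ 2 - s * s' *+ 2 + s' ^+ 2) - (s ^+ 2 + s' ^+ 2) = (f x * s - s') ^+ 2 / f x.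
    by field; rewrite gt_eqF.
  by rewrite divr_ge0 ?sqr_ge0// ltW.
rewrite (_ : 2 * _ = 2 - h); last by lra.
rewrite EFinB leeBlDr//; apply: (le_trans two); exact: leeD2l.
Qed.

End affinity_tensor.
Section hellinger_consequences.
Context {d} {T : measurableType d} {R : realType}.
Implicit Types P : probability T R.

Lemma hellinger2_integral P (P' : probability T R) (mu : {finite_measure set T -> \bar R}) (r : T -> R) :
  measurable_fun [set: T] r -> (forall x, 0 <= r x <= 1) ->
  hellinger2 P P' = \int[mu]_x (Num.sqrt (r x) - Num.sqrt (1 - r x)) ^+ 2 ->
  (\int[mu]_x ((Num.sqrt (r x) - Num.sqrt (1 - r x)) ^+ 2)%:E = (hellinger2 P P')%:E)%E.
Proof.
move=> mr r01 ->; rewrite [RHS]fineK//; apply: integrable_fin_num => //.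
apply: (@bounded_integrable _ _ _ _ _ 1) => //.
  apply: measurable_funX; apply: measurable_funB; apply: measurable_fun_sqrt => //.
  exact: measurable_funB.
have sq (y : R) : 0 <= y <= 1 -> 0 <= Num.sqrt y <= 1.
  by move=> /andP[y0 y1]; rewrite sqrtr_ge0/= -sqrtr1 ler_wsqrtr.
move=> x; have /andP[a0 a1] := sq _ (r01 x).
have /andP[b0 b1] : 0 <= Num.sqrt (1 - r x) <= 1.
  by apply: sq; have /andP[? ?] := r01 x; apply/andP; split; lra.
rewrite ger0_norm ?sqr_ge0//.
move: a0 a1 b0 b1; set u := Num.sqrt (r x); set v := Num.sqrt _ => a0 a1 b0 b1.
rewrite -subr_ge0 (_ : 1 - _ = (1 - (u - v)) * (1 + (u - v))); last by ring.
by apply: mulr_ge0; lra.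
Qed.

Lemma square_integrable P (f : T -> R) :
  measurable_fun [set: T] f -> (\int[P]_x (f x ^+ 2)%:E < +oo)%E ->
  P.-integrable [set: T] (fun x => (f x ^+ 2)%:E) /\
  P.-integrable [set: T] (fun x => (f x)%:E).
Proof.
move=> mf f2.
have i2 : P.-integrable [set: T] (fun x => (f x ^+ 2)%:E).
  apply/integrableP; split; first exact/measurable_EFinP/measurable_funX.
  by under eq_integral do rewrite gee0_abs ?lee_fin ?sqr_ge0//.
split => //.
apply: (@le_integrable _ _ _ P setT _ _ (fun x => (1 + f x ^+ 2)%:E)) => //.
- exact/measurable_EFinP.
- move=> x _ /=; rewrite lee_fin.
  rewrite [leRHS]ger0_norm ?addr_ge0 ?sqr_ge0// ler_norml.
  by apply/andP; split; have := sqr_ge0 (f x + 1); have := sqr_ge0 (f x - 1);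
    have := sqr_ge0 (f x); rewrite sqrrB sqrrD; lra.
- by apply: integrable_realD => //; exact: finite_measure_integrable_cst.
Qed.

Lemma hellinger_mean_gap P (P' : probability T R) (f : T -> R) (k : R) :
  measurable_fun [set: T] f -> 0 < k ->
  (\int[P]_x (f x ^+ 2)%:E < +oo)%E -> (\int[P']_x (f x ^+ 2)%:E < +oo)%E ->
  \int[P]_x f x - \int[P']_x f x <=
  k * (\int[P]_x (f x ^+ 2) + \int[P']_x (f x ^+ 2)) + hellinger2 P P' / (2 * k).
Proof.
move=> mf k0 fP fP'.
have [i2 i1] := square_integrable mf fP.
have [i2' i1'] := square_integrable mf fP'.
have [r [mr r01 rP rP' hE]] := hellinger_density P P'.
have hI := hellinger2_integral mr r01 hE.
move: rP rP' hE hI; set mu := measure_add P P' => rP rP' hE hI.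
have r0 x : 0 <= r x by case/andP: (r01 x).
have r'0 x : 0 <= 1 - r x by rewrite subr_ge0; case/andP: (r01 x).
have mr' : measurable_fun setT (fun x => 1 - r x) by exact: measurable_funB.
pose g (s : R) x := k * f x ^+ 2 + (s * f x + (4 * k)^-1).
have k4 : 0 < (4 * k)^-1 by rewrite invr_gt0 mulr_gt0.
have kn0 : k != 0 by rewrite gt_eqF.
have g0 s x : s ^+ 2 = 1 -> 0 <= g s x.
  move=> s1; have -> : g s x = k * (f x + s / (2 * k)) ^+ 2.
    rewrite /g sqrrD !mulrDr exprMn s1; field; rewrite kn0//.
  by rewrite mulr_ge0 ?sqr_ge0// ltW.
have mg s : measurable_fun setT (g s).
  apply: measurable_funD; first by apply: measurable_funM => //; exact: measurable_funX.
  by apply: measurable_funD => //; exact: measurable_funM.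
have ig (Q : probability T R) s :
    Q.-integrable [set: T] (fun x => (f x ^+ 2)%:E) ->
    Q.-integrable [set: T] (fun x => (f x)%:E) ->
    (\int[Q]_x (g s x)%:E =
      (k * \int[Q]_x (f x ^+ 2) + (s * \int[Q]_x f x + (4 * k)^-1))%:E)%E.
  move=> j2 j1.
  have t1 := integrable_realZ k measurableT j2.
  have t2 := integrable_realZ s measurableT j1.
  have t3 : Q.-integrable setT (fun=> ((4 * k)^-1)%:E) by exact: finite_measure_integrable_cst.
  have t4 := integrable_realD measurableT t2 t3.
  have t5 := integrable_realD measurableT t1 t4.
  rewrite -[LHS]fineK; last exact: integrable_fin_num.
  congr _%:E; rewrite -[LHS]/(\int[Q]_x g s x) /g.
  rewrite RintegralD// RintegralD// !RintegralZl// Rintegral_cst//.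
  by rewrite [X in fine X]probability_setT mulr1.
have main : ((2 * (4 * k)^-1)%:E <= \int[P]_x (g (-1) x)%:E + \int[P']_x (g 1 x)%:E
     + ((2 * k)^-1)%:E * (hellinger2 P P')%:E)%E.
  rewrite -hI.
  rewrite (ge0_integral_density r0 mr rP); last 2 first.
  - by move=> x; rewrite lee_fin g0// sqrrN expr1n.
  - exact/measurable_EFinP.
  rewrite (ge0_integral_density r'0 mr' rP'); last 2 first.
  - by move=> x; rewrite lee_fin g0// expr1n.
  - exact/measurable_EFinP.
  have mh : measurable_fun setT (fun x => (Num.sqrt (r x) - Num.sqrt (1 - r x)) ^+ 2).
    by apply: measurable_funX; apply: measurable_funB; exact: measurable_fun_sqrt.
  have k2 : 0 <= (2 * k)^-1 by rewrite invr_ge0 mulr_ge0// ltW.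
  rewrite -ge0_integralZl//; last 2 first.
  - exact/measurable_EFinP.
  - by move=> x _; rewrite lee_fin sqr_ge0.
  rewrite -ge0_integralD//; last 4 first.
  - by move=> x _; rewrite -EFinM lee_fin mulr_ge0// g0// sqrrN expr1n.
  - by apply/measurable_EFinP; exact: measurable_funM.
  - by move=> x _; rewrite -EFinM lee_fin mulr_ge0// g0// expr1n.
  - by apply/measurable_EFinP; exact: measurable_funM.
  rewrite -ge0_integralD//; last 4 first.
  - move=> x _; rewrite -!EFinM -EFinD lee_fin.
    by rewrite addr_ge0// mulr_ge0// g0// ?sqrrN expr1n.
  - by apply/measurable_EFinP; apply: measurable_funD; exact: measurable_funM.
  - by move=> x _; rewrite -EFinM lee_fin mulr_ge0// sqr_ge0.
  - by apply/measurable_EFinP; exact: measurable_funM.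
  have muT : mu setT = 2%:E.
    have -> : mu setT = (P setT + P' setT)%E by exact: measure_addE.
    by rewrite !probability_setT -EFinD.
  have -> : ((2 * (4 * k)^-1)%:E = \int[mu]_x (4 * k)^-1%:E :> \bar R)%E.
    by rewrite integral_cst// [X in (_ * X)%E]muT -EFinM mulrC.
  apply: ge0_le_integralT => //.
  - by move=> x; rewrite lee_fin ltW.
  - apply/measurable_EFinP; apply: measurable_funD; last exact: measurable_funM.
    by apply: measurable_funD; exact: measurable_funM.
  move=> x; rewrite -!EFinM -!EFinD lee_fin.
  have h0 := r0 x; have h0' := r'0 x.
  set s := Num.sqrt (r x); set s' := Num.sqrt (1 - r x).
  have s0 : 0 <= s by exact: sqrtr_ge0.
  have s'0 : 0 <= s' by exact: sqrtr_ge0.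
  have ss : s ^+ 2 = r x by rewrite sqr_sqrtr.
  have ss' : s' ^+ 2 = 1 - r x by rewrite sqr_sqrtr.
  rewrite -subr_ge0 /g -ss' -ss.
  have ss1 : s ^+ 2 + s' ^+ 2 = 1 by rewrite ss ss'; ring.
  pose y := f x.
  have -> : (k * f x ^+ 2 + (-1 * f x + (4 * k)^-1)) * s ^+ 2 +
     (k * f x ^+ 2 + (1 * f x + (4 * k)^-1)) * s' ^+ 2 +
     (2 * k)^-1 * (s - s') ^+ 2 - (4 * k)^-1 =
     (k * f x ^+ 2) * (s ^+ 2 + s' ^+ 2) - f x * ((s - s') * (s + s')) +
     (4 * k)^-1 * (s ^+ 2 + s' ^+ 2) - (4 * k)^-1 +
     (2 * k)^-1 * (s - s') ^+ 2 by ring.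
  rewrite ss1 !mulr1 addrK.
  pose D := s - s'; pose S := s + s'.
  have SD : S ^+ 2 = 2 - D ^+ 2.
    by move: ss1; rewrite /S /D !expr2; lra.
  rewrite -/D -/S.
  have -> : k * f x ^+ 2 - f x * (D * S) + (2 * k)^-1 * D ^+ 2 =
    k * (f x - D * S / (2 * k)) ^+ 2 + (2 * k)^-1 * D ^+ 2 * (1 - S ^+ 2 / 2).
    by field; rewrite kn0.
  rewrite SD; apply: addr_ge0; first by rewrite mulr_ge0 ?sqr_ge0// ltW.
  apply: mulr_ge0; first by rewrite mulr_ge0 ?sqr_ge0.
  by have := sqr_ge0 D; lra.
move: main; rewrite (ig P _ i2 i1) (ig P' _ i2' i1') -EFinM -!EFinD lee_fin.
have -> : 2 * (4 * k)^-1 = (4 * k)^-1 + (4 * k)^-1 by ring.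
rewrite -(mulrC (2 * k)^-1).
lra.
Qed.

End hellinger_consequences.
Lemma chi2_mixture_half {d} {T : measurableType d} {R : realType}
    (P P' : probability T R) (l : {i01 R}) :
  l%:num = 2^-1 ->
  exists x : R, [/\ chi2 P' (mixture l P' P) = x%:E, 0 <= x,
    x <= hellinger2 P P' & x = 0 -> hellinger2 P P' = 0].
Proof.
move=> l2.
have [r [mr r01 rP rP' hE]] := hellinger_density P P'.
have hI := hellinger2_integral mr r01 hE.
move: rP rP' hE hI; set mu := measure_add P P' => rP rP' hE hI.
have r0 x : 0 <= r x by case/andP: (r01 x).
have r'0 x : 0 <= 1 - r x by rewrite subr_ge0; case/andP: (r01 x).
have mr' : measurable_fun setT (fun x => 1 - r x) by exact: measurable_funB.
pose mix := mixture l P' P.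
have h0 : 0 <= 2^-1 :> R by rewrite invr_ge0.
have mixE A : mix A = mscale (NngNum h0) mu A.
  have -> : mix A = (l%:num%:E * P' A + (1 - l%:num)%:E * P A)%E.
    exact: measure_addE.
  have -> : mscale (NngNum h0) mu A = (2^-1%:E * (P A + P' A))%E.
    by rewrite -measure_addE.
  by rewrite l2 (_ : 1 - 2^-1 = 2^-1); [rewrite ge0_muleDr// addeC|lra].
have mix_int D f : measurable D -> measurable_fun D f -> (forall x, D x -> (0 <= f x)%E) ->
    (\int[mix]_(x in D) f x = 2^-1%:E * \int[mu]_(x in D) f x)%E.
  move=> mD mf f0; rewrite (eq_measure_integral (mscale (NngNum h0) mu)).
    by rewrite ge0_integral_mscale.
  by move=> A mA _; exact: mixE.
have Pmix : P' `<< mix.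
  apply/null_content_dominatesP => A mA muA0.
  have : mscale (NngNum h0) mu A == 0%E by rewrite -mixE; apply/eqP.
  rewrite /mscale /= mule_eq0 eqe invr_eq0 (_ : 2 == 0 = false)/=; last first.
    by apply/eqP; apply/eqP; rewrite pnatr_eq0.
  by rewrite measure_addE padde_eq0// => /andP[_ /eqP].
pose dP := 'd (charge_of_finite_measure P') '/d mix.
have idP := Radon_Nikodym_integrable (nu := charge_of_finite_measure P') (mu := mix) Pmix.
have mdP : measurable_fun setT dP by case/integrableP : idP.
have dPE : ae_eq mix setT dP (fun x => (2 * (1 - r x))%:E).
  apply: integral_ae_eq => //.
    exact/measurable_EFinP/measurable_funM.
  move=> A _ mA.
  rewrite [RHS]mix_int//; last 2 first.
  - apply: measurable_funTS; exact/measurable_EFinP/measurable_funM.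
  - by move=> x _; rewrite lee_fin mulr_ge0.
  under [in RHS]eq_integral do rewrite EFinM.
  rewrite ge0_integralZl//; last 2 first.
  - apply: measurable_funTS; exact/measurable_EFinP.
  - by move=> x _; rewrite lee_fin.
  rewrite muleA -EFinM mulVf ?pnatr_eq0// mul1e -rP'//.
  by rewrite -(Radon_Nikodym_integral (mu := mix)).
have m1 : measurable_fun setT (fun x => (1 - 2 * r x) ^+ 2).
  by apply: measurable_funX; apply: measurable_funB => //; exact: measurable_funM.
have chiE : chi2 P' (mixture l P' P) = (2^-1%:E * \int[mu]_x ((1 - 2 * r x) ^+ 2)%:E)%E.
  rewrite /chi2 asboolT// -/mix -mix_int//; last 2 first.
  - exact/measurable_EFinP.
  - by move=> x _; rewrite lee_fin sqr_ge0.
  apply: ae_eq_integral => //.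
  - apply/measurable_EFinP; apply: measurable_funX; apply: measurable_funB => //.
    exact: measurableT_comp.
  - exact/measurable_EFinP.
  - apply: filterS dPE => x /(_ Logic.I); rewrite /dP => -> _ /=.
    by congr (_ ^+ 2)%:E; ring.
have fin1 : mu.-integrable setT (fun x => ((1 - 2 * r x) ^+ 2)%:E).
  apply: (@bounded_integrable _ _ _ mu _ 1) => // x.
  have /andP[a b] := r01 x.
  rewrite ger0_norm ?sqr_ge0// -subr_ge0.
  have -> : 1 - (1 - 2 * r x) ^+ 2 = 4 * (r x * (1 - r x)) by ring.
  by rewrite mulr_ge0// mulr_ge0// subr_ge0.
have mh : measurable_fun setT (fun x => (Num.sqrt (r x) - Num.sqrt (1 - r x)) ^+ 2).
  by apply: measurable_funX; apply: measurable_funB; exact: measurable_fun_sqrt.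
exists (2^-1 * \int[mu]_x (1 - 2 * r x) ^+ 2).
have chiF : chi2 P' (mixture l P' P) = (2^-1 * \int[mu]_x (1 - 2 * r x) ^+ 2)%:E.
  by rewrite chiE EFinM fineK//; exact: integrable_fin_num.
have pw x : (1 - 2 * r x) ^+ 2 =
    (Num.sqrt (r x) - Num.sqrt (1 - r x)) ^+ 2 * (Num.sqrt (r x) + Num.sqrt (1 - r x)) ^+ 2.
  rewrite -exprMn -subr_sqr !sqr_sqrtr//; ring.
have s2 x : (Num.sqrt (r x) - Num.sqrt (1 - r x)) ^+ 2 + (Num.sqrt (r x) + Num.sqrt (1 - r x)) ^+ 2 = 2.
  by rewrite sqrrB sqrrD !sqr_sqrtr//; ring.
split => //.
- by rewrite mulr_ge0// Rintegral_ge0// => x _; rewrite sqr_ge0.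
- rewrite -lee_fin -chiF chiE -hI -ge0_integralZl//; last 2 first.
  + exact/measurable_EFinP.
  + by move=> x _; rewrite lee_fin sqr_ge0.
  apply: ge0_le_integralT.
  + by move=> x; rewrite -EFinM lee_fin mulr_ge0// sqr_ge0.
  + by apply/measurable_EFinP; exact: measurable_funM.
  + exact/measurable_EFinP.
  move=> x; rewrite -EFinM lee_fin pw.
  have := s2 x; set a := (_ - _) ^+ 2; set b := (_ + _) ^+ 2 => ab.
  have a0 : 0 <= a by exact: sqr_ge0.
  have : a * b <= a * 2 by rewrite ler_wpM2l//; lra.
  lra.
- move=> /eqP; rewrite mulf_eq0 invr_eq0 pnatr_eq0/= => /eqP x0.
  have e0 : (\int[mu]_x `|((1 - 2 * r x) ^+ 2)%:E| = 0)%E.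
    under eq_integral do rewrite gee0_abs ?lee_fin ?sqr_ge0//.
    by rewrite -[LHS]fineK ?integrable_fin_num// [X in X%:E]x0.
  have m1E : measurable_fun setT (fun x => ((1 - 2 * r x) ^+ 2)%:E).
    exact/measurable_EFinP.
  have /(ae_eq_integral_abs _ measurableT m1E) a0 := e0.
  apply: EFin_inj; rewrite -hI.
  rewrite (ae_eq_integral (cst 0%E)) ?integral0//.
  + exact/measurable_EFinP.
  + apply: filterS a0 => x /(_ Logic.I) [] /eqP; rewrite sqrf_eq0 => /eqP h _.
    have -> : 1 - r x = r x by move: h; lra.
    by rewrite subrr expr0n.
Qed.
Section euclidean_lemmas.
Context {R : realType} {d : nat}.
Implicit Types u v w : 'rV[R]_d.

Lemma dotpC u v : dotp u v = dotp v u.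
Proof. by apply: eq_bigr => i _; rewrite mulrC. Qed.

Lemma dotpDr u v w : dotp u (v + w) = dotp u v + dotp u w.
Proof. by rewrite -big_split; apply: eq_bigr => i _; rewrite mxE mulrDr. Qed.

Lemma dotpZl a u v : dotp (a *: u) v = a * dotp u v.
Proof. by rewrite mulr_sumr; apply: eq_bigr => i _; rewrite mxE mulrA. Qed.

Lemma dotpZr a u v : dotp u (a *: v) = a * dotp u v.
Proof. by rewrite dotpC dotpZl dotpC. Qed.

Lemma dotp_ge0 u : 0 <= dotp u u.
Proof. by apply: sumr_ge0 => i _; rewrite -expr2 sqr_ge0. Qed.

Lemma enorm_ge0 u : 0 <= enorm u. Proof. exact: sqrtr_ge0. Qed.

Lemma enorm_sqr u : enorm u ^+ 2 = dotp u u.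
Proof. by rewrite sqr_sqrtr// dotp_ge0. Qed.

Lemma enormZ a u : enorm (a *: u) = `|a| * enorm u.
Proof.
rewrite /enorm dotpZl dotpZr mulrA -expr2 sqrtrM ?sqr_ge0//.
by rewrite sqrtr_sqr.
Qed.

Lemma dotp_mx u v : dotp u v = (u *m v^T) 0 0.
Proof. by rewrite mxE; apply: eq_bigr => i _; rewrite mxE. Qed.

Lemma coord_le_enorm u i : `|u 0 i| <= enorm u.
Proof.
rewrite -sqrtr_sqr ler_wsqrtr// /dotp (bigD1 i)//= -expr2 lerDl.
by apply: sumr_ge0 => j _; rewrite -expr2 sqr_ge0.
Qed.

Lemma coord_le_norm u i : `|u 0 i| <= `|u|.
Proof. by rewrite /Num.norm/= mx_normrE; exact: (le_bigmax _ (fun ij => `|u ij.1 ij.2|) (0, i)). Qed.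

Lemma norm_le_enorm u : `|u| <= enorm u.
Proof.
rewrite /Num.norm/= mx_normrE; apply: bigmax_le; first exact: enorm_ge0.
by move=> [i j] _ /=; rewrite ord1 coord_le_enorm.
Qed.

Lemma enorm_lt (r : R) u : 0 < r -> (forall i, `|u 0 i| <= r) -> (0 < d)%N -> enorm u <= d%:R * r.
Proof.
move=> r0 ur d0.
rewrite -[leRHS]ger0_norm; last by rewrite mulr_ge0// ltW.
rewrite -sqrtr_sqr ler_wsqrtr// exprMn.
apply: (@le_trans _ _ (\sum_(i < d) r ^+ 2)).
  apply: ler_sum => i _; rewrite -expr2 -real_normK ?num_real//.
  by rewrite lerXn2r ?nnegrE// ltW.
rewrite sumr_const card_ord -[X in X <= _]mulr_natl; apply: ler_wpM2r.
  exact: sqr_ge0.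
by rewrite [leRHS]expr2 ler_peMl ?ler1n.
Qed.

End euclidean_lemmas.

Section differentiable_expansion.
Context {R : realType} {d : nat}.

Lemma differential_gradient (f : 'rV[R]_d -> R) t h :
  differentiable f t -> 'd f t h = dotp (gradient f t) h.
Proof.
move=> ft; rewrite {1}(row_sum_delta h) linear_sum/=.
apply: eq_bigr => i _; rewrite linearZ/= mxE deriveE//.
by rewrite mulrC.
Qed.

Lemma differentiable_expansion (f : 'rV[R]_d -> R) t (e : R) :
  differentiable f t -> 0 < e ->
  exists2 r : R, 0 < r & forall h, `|h| < r ->
    `|f (t + h) - f t - dotp (gradient f t) h| <= e * `|h|.
Proof.
move=> ft e0.
have /eqaddoP/(_ _ e0) := diff_locally ft.
move=> /nbhs_normP[r /= r0 hr]; exists r => // h hlt.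
have := hr h; rewrite /= sub0r normrN => /(_ hlt).
rewrite /= -differential_gradient//.
by rewrite !fctE /= [h + t]addrC opprD addrA.
Qed.

End differentiable_expansion.

Section hellinger_expansion.
Context {R : realType} {d : nat} {dX : measure_display} {X : measurableType dX}.
Variable nu : {sigma_finite_measure set X -> \bar R}.

Lemma integrable_dotp (xi : X -> 'rV[R]_d) :
  (forall i, measurable_fun [set: X] (fun x => xi x 0 i)) ->
  (forall i, nu.-integrable [set: X] (fun x => (xi x 0 i ^+ 2)%:E)) ->
  forall i j, nu.-integrable [set: X] (fun x => (xi x 0 i * xi x 0 j)%:E).
Proof.
move=> mxi ixi i j.
apply: (@le_integrable _ _ _ nu setT _ _ (fun x => (xi x 0 i ^+ 2 + xi x 0 j ^+ 2)%:E)) => //.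
- by apply/measurable_EFinP; exact: measurable_funM.
- move=> x _ /=; rewrite lee_fin.
  rewrite [leRHS]ger0_norm ?addr_ge0 ?sqr_ge0// ler_norml.
  have := sqr_ge0 (xi x 0 i + xi x 0 j); have := sqr_ge0 (xi x 0 i - xi x 0 j).
  have := sqr_ge0 (xi x 0 i); have := sqr_ge0 (xi x 0 j).
  by rewrite sqrrB sqrrD => *; apply/andP; split; lra.
- exact: integrable_realD.
Qed.

Lemma fisher_quadratic (xi : X -> 'rV[R]_d) (w : 'rV[R]_d) :
  (forall i, measurable_fun [set: X] (fun x => xi x 0 i)) ->
  (forall i, nu.-integrable [set: X] (fun x => (xi x 0 i ^+ 2)%:E)) ->
  nu.-integrable [set: X] (fun x => (dotp w (xi x) ^+ 2)%:E) /\
  4 * \int[nu]_x (dotp w (xi x) ^+ 2) = (w *m fisher_information nu xi *m w^T) 0 0.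
Proof.
move=> mxi ixi.
have ij := integrable_dotp mxi ixi.
have E x : dotp w (xi x) ^+ 2 =
    \sum_(k : 'I_d * 'I_d) (w 0 k.1 * w 0 k.2) * (xi x 0 k.1 * xi x 0 k.2).
  rewrite expr2 /dotp mulr_suml -(pair_bigA _ (fun i j => (w 0 i * w 0 j) * (xi x 0 i * xi x 0 j)))/=.
  by apply: eq_bigr => i _; rewrite mulr_sumr; apply: eq_bigr => j _; ring.
have ik (k : 'I_d * 'I_d) : nu.-integrable [set: X]
    (fun x => ((w 0 k.1 * w 0 k.2) * (xi x 0 k.1 * xi x 0 k.2))%:E).
  exact: integrable_realZ.
have int2 : nu.-integrable [set: X] (fun x => (dotp w (xi x) ^+ 2)%:E).
  rewrite [X in _.-integrable _ X](_ : _ = (fun x => \sum_(k : 'I_d * 'I_d)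
     ((w 0 k.1 * w 0 k.2) * (xi x 0 k.1 * xi x 0 k.2))%:E)%E).
    by apply: integrable_sum => //.
  by apply/funext => x; rewrite E sumEFin.
split => //.
rewrite /Rintegral.
under eq_integral do rewrite E -sumEFin.
rewrite integral_sum//=.
rewrite (eq_bigr (fun k : 'I_d * 'I_d =>
   ((w 0 k.1 * w 0 k.2) * \int[nu]_x (xi x 0 k.1 * xi x 0 k.2))%:E)); last first.
  move=> k _; rewrite -[LHS]fineK; last exact: integrable_fin_num (ik k).
  congr _%:E; rewrite -[LHS]/(\int[nu]_x ((w 0 k.1 * w 0 k.2) * (xi x 0 k.1 * xi x 0 k.2))).
  by rewrite RintegralZl//; exact: (ij k.1 k.2).
rewrite sumEFin /= mulr_sumr.
rewrite -(pair_bigA _ (fun i j => 4 * ((w 0 i * w 0 j) * \int[nu]_x (xi x 0 i * xi x 0 j))))/=.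
rewrite -mulmxA mxE; apply: eq_bigr => i _.
rewrite mxE mulr_sumr; apply: eq_bigr => j _.
rewrite !mxE; ring.
Qed.

Lemma hellinger_expansion (Theta : set 'rV[R]_d) (p : 'rV[R]_d -> X -> R)
    (theta0 w : 'rV[R]_d) (xi : X -> 'rV[R]_d) (Z e : R) :
  (forall t, Theta t -> measurable_fun [set: X] (p t)) ->
  hellinger_differentiable nu Theta p theta0 xi ->
  (interior Theta) theta0 -> 0 < Z -> 0 < e ->
  exists2 r : R, 0 < r & forall s, 0 < s < r -> forall z z', `|z| <= Z -> `|z'| <= Z ->
   [/\ Theta (theta0 + (s * z) *: w), Theta (theta0 + (s * z') *: w) &
    (\int[nu]_x ((Num.sqrt (p (theta0 + (s * z) *: w) x) -
       Num.sqrt (p (theta0 + (s * z') *: w) x)) ^+ 2)%:E <=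
     (((z - z') ^+ 2 * (w *m fisher_information nu xi *m w^T) 0 0 / 4 + e) * s ^+ 2)%:E)%E].
Proof.
move=> mp [mxi ixi hd] Tin Z0 e0.
have [intw <-] := fisher_quadratic w mxi ixi.
set J := \int[nu]_x (dotp w (xi x) ^+ 2).
have J0 : 0 <= J by apply: Rintegral_ge0 => x _; exact: sqr_ge0.
(* (1 + tau) inflates the main term, 1 + tau^-1 the two remainders *)
pose tau := e / (8 * Z ^+ 2 * (J + 1)).
have J1 : 0 < J + 1 by rewrite ltr_wpDl.
have tau0 : 0 < tau by rewrite divr_gt0// !mulr_gt0// exprn_gt0.
pose e1 := e / (8 * (1 + tau^-1) * Z ^+ 2 * (enorm w ^+ 2 + 1)).
have ew : 0 < enorm w ^+ 2 + 1 by rewrite ltr_wpDl// sqr_ge0.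
have ti : 0 < 1 + tau^-1 by rewrite addr_gt0// invr_gt0.
have e10 : 0 < e1 by rewrite divr_gt0// !mulr_gt0// exprn_gt0.
have /nbhs_normP[r1 /= r10 hr1] := hd _ e10.
move/nbhs_normP : Tin => -[r2 /= r20 hr2].
have nw : 0 < Z * (`|w| + 1) by rewrite mulr_gt0// ltr_wpDl.
exists (Num.min r1 r2 / (Z * (`|w| + 1))).
  by rewrite divr_gt0// lt_min r10.
move=> s /andP[s0 sr].
have small z : `|z| <= Z -> `|(s * z) *: w| < Num.min r1 r2.
  move=> zZ; rewrite normrZ normrM (gtr0_norm s0).
  move: sr; rewrite ltr_pdivlMr//; apply: le_lt_trans.
  by rewrite -mulrA ler_wpM2l ?(ltW s0)// ler_pM// lerDl.
have inT z : `|z| <= Z -> Theta (theta0 + (s * z) *: w).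
  move=> /small; rewrite lt_min => /andP[_ h]; apply: hr2 => /=.
  by rewrite opprD addrA subrr sub0r normrN.
pose rem z x := Num.sqrt (p (theta0 + (s * z) *: w) x) - Num.sqrt (p theta0 x)
                       - dotp ((s * z) *: w) (xi x).
have T0 : Theta theta0 by apply: hr2; rewrite /= subrr normr0.
have mdot u : measurable_fun setT (fun x => dotp u (xi x)).
  by apply: measurable_sum => i; exact: measurable_funM.
have mrem z : `|z| <= Z -> measurable_fun setT (rem z).
  move=> zZ; apply: measurable_funB => //; apply: measurable_funB;
    apply: measurable_fun_sqrt; apply: mp => //; exact: inT.
have rem_le z : `|z| <= Z ->
    (\int[nu]_x ((rem z x) ^+ 2)%:E <= (e1 * Z ^+ 2 * enorm w ^+ 2 * s ^+ 2)%:E)%E.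
  move=> zZ.
  have := hr1 ((s * z) *: w); rewrite /= sub0r normrN => /(_ _ (inT _ zZ)).
  have := small _ zZ; rewrite lt_min => /andP[h _] /(_ h) /le_trans; apply.
  rewrite lee_fin [leRHS](_ : _ = e1 * (Z ^+ 2 * (enorm w ^+ 2 * s ^+ 2))); last by ring.
  apply: ler_wpM2l; first exact: ltW.
  rewrite enormZ normrM (gtr0_norm s0).
  have -> : (s * `|z| * enorm w) ^+ 2 = `|z| ^+ 2 * (enorm w ^+ 2 * s ^+ 2) by ring.
  rewrite ler_wpM2r//; first by rewrite mulr_ge0 ?sqr_ge0.
  by rewrite lerXn2r ?nnegrE// ltW.
move=> z z' zZ z'Z; split; [exact: inT|exact: inT|].
pose main x := (1 + tau) * (s * (z - z')) ^+ 2 * dotp w (xi x) ^+ 2.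
pose rest x := (2 * (1 + tau^-1)) * (rem z x ^+ 2 + rem z' x ^+ 2).
have mmain : measurable_fun setT main by apply: measurable_funM => //; exact: measurable_funX.
have mrest : measurable_fun setT rest.
  apply: measurable_funM => //; apply: measurable_funD;
    apply: measurable_funX; exact: mrem.
have t1 : 0 <= 1 + tau by apply: addr_ge0 => //; exact: ltW.
have main0 x : 0 <= main x.
  by apply: mulr_ge0; rewrite ?sqr_ge0//; apply: mulr_ge0; rewrite ?sqr_ge0.
have rest0 x : 0 <= rest x by rewrite mulr_ge0 ?addr_ge0 ?sqr_ge0// mulr_ge0// ltW.
apply: (@le_trans _ _ (\int[nu]_x ((main x)%:E + (rest x)%:E))%E).
  apply: ge0_le_integralT.
  - by move=> x; rewrite lee_fin sqr_ge0.
  - apply/measurable_EFinP; apply: measurable_funX; apply: measurable_funB;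
      apply: measurable_fun_sqrt; apply: mp; exact: inT.
  - by apply/measurable_EFinP; exact: measurable_funD.
  move=> x; rewrite -EFinD lee_fin /main /rest.
  have -> : Num.sqrt (p (theta0 + (s * z) *: w) x) - Num.sqrt (p (theta0 + (s * z') *: w) x)
    = s * (z - z') * dotp w (xi x) + (rem z x - rem z' x).
    rewrite /rem !dotpZl; ring.
  move: (rem z x) (rem z' x) (dotp w (xi x)) => A B D.
  rewrite -subr_ge0.
  have tn0 : tau != 0 by rewrite gt_eqF.
  have -> : (1 + tau) * (s * (z - z')) ^+ 2 * D ^+ 2 + 2 * (1 + tau^-1) * (A ^+ 2 + B ^+ 2)
     - (s * (z - z') * D + (A - B)) ^+ 2 =
     tau * (s * (z - z') * D - (A - B) / tau) ^+ 2 + (1 + tau^-1) * (A + B) ^+ 2.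
    by field.
  by apply: addr_ge0; apply: mulr_ge0; rewrite ?sqr_ge0// ltW.
rewrite ge0_integralD//; last 4 first.
- by move=> x _; rewrite lee_fin.
- exact/measurable_EFinP.
- by move=> x _; rewrite lee_fin.
- exact/measurable_EFinP.
have c1 : 0 <= (1 + tau) * (s * (z - z')) ^+ 2 by apply: mulr_ge0; rewrite ?sqr_ge0.
have -> : (\int[nu]_x (main x)%:E = ((1 + tau) * (s * (z - z')) ^+ 2 * J)%:E)%E.
  under eq_integral do rewrite EFinM.
  rewrite ge0_integralZl//; last 2 first.
  - by apply/measurable_EFinP; exact: measurable_funX.
  - by move=> x _; rewrite lee_fin sqr_ge0.
  by rewrite [in RHS]EFinM /J fineK//; exact: integrable_fin_num.
have restle : (\int[nu]_x (rest x)%:E <= (4 * (1 + tau^-1) * e1 * Z ^+ 2 * enorm w ^+ 2 * s ^+ 2)%:E)%E.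
  under eq_integral do rewrite EFinM EFinD.
  rewrite ge0_integralZl//; last 3 first.
  - apply: emeasurable_funD; apply/measurable_EFinP/measurable_funX; exact: mrem.
  - by move=> x _; rewrite -EFinD lee_fin addr_ge0// sqr_ge0.
  - by rewrite lee_fin mulr_ge0// ltW.
  rewrite ge0_integralD//; last 4 first.
  - by move=> x _; rewrite lee_fin sqr_ge0.
  - by apply/measurable_EFinP/measurable_funX; exact: mrem.
  - by move=> x _; rewrite lee_fin sqr_ge0.
  - by apply/measurable_EFinP/measurable_funX; exact: mrem.
  have := leeD (rem_le _ zZ) (rem_le _ z'Z); rewrite -EFinD => h.
  have tt : (0 <= (2 * (1 + tau^-1))%:E :> \bar R)%E by rewrite lee_fin mulr_ge0// ltW.
  apply: (le_trans (lee_wpmul2l tt h)).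
  by rewrite -EFinM lee_fin le_eqVlt; apply/orP; left; apply/eqP; ring.
apply: (le_trans (leeD2l _ restle)); rewrite -EFinD lee_fin.
rewrite -subr_ge0.
have b1 : tau * (z - z') ^+ 2 * J <= e / 2.
  have zz : (z - z') ^+ 2 <= 4 * Z ^+ 2.
    rewrite -real_normK ?num_real// (_ : 4 * Z ^+ 2 = (Z + Z) ^+ 2); last by ring.
    rewrite lerXn2r ?nnegrE ?addr_ge0 ?(ltW Z0)//.
    by apply: (le_trans (ler_normB _ _)); exact: lerD.
  have -> : e / 2 = tau * (4 * Z ^+ 2) * (J + 1).
    by rewrite /tau; field; rewrite !gt_eqF.
  apply: ler_pM => //; last by rewrite lerDl.
    by rewrite mulr_ge0 ?sqr_ge0// ltW.
  by rewrite ler_wpM2l// ltW.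
have b2 : 4 * (1 + tau^-1) * e1 * Z ^+ 2 * enorm w ^+ 2 <= e / 2.
  have -> : e / 2 = 4 * (1 + tau^-1) * e1 * Z ^+ 2 * (enorm w ^+ 2 + 1).
    by rewrite /e1; field; rewrite !gt_eqF// addr_gt0.
  apply: ler_wpM2l; last by rewrite lerDl.
  by apply: mulr_ge0; rewrite ?sqr_ge0//; apply: mulr_ge0; apply: ltW => //; rewrite mulr_gt0.
have -> : ((z - z') ^+ 2 * (4 * J) / 4 + e) * s ^+ 2 -
  ((1 + tau) * (s * (z - z')) ^+ 2 * J + 4 * (1 + tau^-1) * e1 * Z ^+ 2 * enorm w ^+ 2 * s ^+ 2)
  = (e - tau * (z - z') ^+ 2 * J - 4 * (1 + tau^-1) * e1 * Z ^+ 2 * enorm w ^+ 2) * s ^+ 2.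
  by field; rewrite gt_eqF.
by rewrite mulr_ge0 ?sqr_ge0//; lra.
Qed.

End hellinger_expansion.
Section borel_row_vectors.
Context {R : realType} {d : nat}.

Lemma open_measurable_rV (A : set 'rV[R]_d) : open A -> measurable A.
Proof.
move=> oA.
pose box (q : 'rV[rat]_d * nat) : set 'rV[R]_d :=
  [set t | forall i, `|t 0 i - ratr (q.1 0 i)| < q.2.+1%:R^-1].
have mbox q : measurable (box q).
  rewrite (_ : box q = \bigcap_(i in [set: 'I_d])
     ((fun t : 'rV[R]_d => t 0 i) @^-1` [set y : R | `|y - ratr (q.1 0 i)| < q.2.+1%:R^-1])).
    apply: fin_bigcap_measurable => // i _.
    rewrite -[X in measurable X]setTI; apply: measurable_coord => //.
    rewrite (_ : [set _ | _] = `](ratr (q.1 0 i) - q.2.+1%:R^-1), (ratr (q.1 0 i) + q.2.+1%:R^-1)[%classic); first exact: measurable_itv.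
    by apply/seteqP; split=> y; rewrite /= in_itv/= ltr_distl.
  apply/seteqP; split=> [t h i _|t h i]; [exact: h|exact: (h i Logic.I)].
pose F n := if unpickle n is Some q then
   if `[< box q `<=` A >] then box q else set0 else set0.
rewrite (_ : A = \bigcup_n F n).
  apply: bigcupT_measurable => n; rewrite /F.
  case: unpickle => // q; case: ifP => // _; exact: mbox.
apply/seteqP; split=> [t At|t [n _]]; last first.
  rewrite /F; case: unpickle => // q; case: asboolP => // qA; exact: qA.
move: (oA t At) => /nbhs_normP[r /= r0 hr].
pose k := Num.truncn (r / 2)^-1.
have kr : k.+1%:R^-1 < r / 2.
  rewrite -[ltRHS]invrK ltf_pV2 ?posrE ?invr_gt0 ?divr_gt0//.
  by rewrite /k truncnS_gt.
have k0 : 0 < k.+1%:R^-1 :> R by rewrite invr_gt0.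
have qP i : exists q : rat, `|t 0 i - ratr q| < k.+1%:R^-1.
  have /rat_in_itvoo[q] : t 0 i - k.+1%:R^-1 < t 0 i + k.+1%:R^-1.
    by rewrite ltrD2l (lt_trans _ k0)// oppr_lt0.
  by rewrite in_itv/= => hq; exists q; rewrite distrC ltr_distl.
pose q : 'rV[rat]_d := \row_i sval (cid (qP i)).
have tq : box (q, k) t by move=> i /=; rewrite mxE; exact: (svalP (cid (qP i))).
exists (pickle (q, k)) => //; rewrite /F pickleK asboolT//.
move=> s sq; apply: hr => /=.
rewrite /Num.norm/= mx_normrE; apply: bigmax_lt => // -[i j] _ /=.
rewrite ord1 !mxE.
rewrite (_ : t 0 j - s 0 j = (t 0 j - ratr (q 0 j)) - (s 0 j - ratr (q 0 j))); last by ring.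
apply: (le_lt_trans (ler_normB _ _)).
rewrite [ltRHS]splitr; apply: ltrD; apply: lt_trans kr; [exact: tq|exact: sq].
Qed.

Lemma continuous_measurable_rV (S : set 'rV[R]_d) (f : 'rV[R]_d -> R) :
  open S -> (forall t, S t -> {for t, continuous f}) -> measurable_fun S f.
Proof.
move=> oS cf.
apply: (measurability _ (RGenOInfty.measurableE R)) => _ [_ [x ->] <-].
apply: open_measurable_rV.
rewrite openE => t [St] /=; rewrite in_itv/= andbT => xft.
have h1 : \forall s \near t, S s by exact: oS.
have h2 : \forall s \near t, x < f s by exact: (cvgr_gt (f t) (cf t St) x xft).
by apply: filterS2 h1 h2 => s Ss xs; split => //=; rewrite in_itv/= andbT.
Qed.

Lemma measurable_rV {d'} {T : measurableType d'} (F : T -> 'rV[R]_d) :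
  (forall i, measurable_fun [set: T] (fun x => F x 0 i)) ->
  measurable_fun [set: T] F.
Proof.
move=> mF _ A mA; rewrite setTI.
suff : g_sigma_preimage (fun (i : 'I_d) (v : 'rV[R]_d) => v 0 i) `<=`
    [set B | measurable (F @^-1` B)] by exact.
apply: smallest_sub.
  split=> [|B mB|G mG] /=.
  - by rewrite preimage_set0.
  - by rewrite setTD preimage_setC; exact: measurableC.
  - by rewrite preimage_bigcup; apply: bigcup_measurable => k _; exact: mG.
rewrite -bigcup_seq => B/= [i _ [C mC <-]].
rewrite setTI -comp_preimage -[X in measurable X]setTI.
exact: mF.
Qed.

Lemma measurable_translation (h : 'rV[R]_d) :
  measurable_fun [set: 'rV[R]_d] (fun t => t - h).
Proof.
apply: measurable_rV => i; under eq_fun do rewrite !mxE.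
by apply: measurable_funB => //; exact: measurable_coord.
Qed.

End borel_row_vectors.

(** The family is packed as a probability kernel. *)
Section kernel_of_family.
Context {d d'} {T : measurableType d} {Y : measurableType d'} {R : realType}.
Variable K : T -> probability Y R.

Definition family_kernel
  (mK : forall B, measurable B -> measurable_fun [set: T] (K ^~ B)) :
  T -> {measure set Y -> \bar R} := K.

Hypothesis mK : forall B, measurable B -> measurable_fun [set: T] (K ^~ B).

HB.instance Definition _ := @isKernel.Build _ _ T Y R (family_kernel mK) mK.

Let family_kernel_prob x : family_kernel mK x [set: Y] = 1%E.
Proof. exact: probability_setT. Qed.

HB.instance Definition _ :=
  @Kernel_isProbability.Build _ _ T Y R (family_kernel mK) family_kernel_prob.

Lemma measurable_kernel_section (A : set (T * Y)) : measurable A ->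
  measurable_fun [set: T] (fun t => K t [set y | A (t, y)]).
Proof.
move=> mA.
have -> : (fun t => K t [set y | A (t, y)]) = (fun t => family_kernel mK t (xsection A t)).
  by apply/funext => t; rewrite xsectionE.
apply: measurable_fun_xsection_finite_kernel; exact/mem_set.
Qed.

Lemma measurable_kernel_integral (f : T * Y -> \bar R) :
  (forall z, (0 <= f z)%E) -> measurable_fun [set: T * Y] f ->
  measurable_fun [set: T] (fun t => (\int[K t]_y f (t, y))%E).
Proof.
move=> f0 mf.
exact: (@measurable_fun_integral_finite_kernel _ _ _ _ _ f (family_kernel mK)).
Qed.

End kernel_of_family.

Lemma measurable_tuple_probability {d d'} {T : measurableType d}
    {Y : measurableType d'} {R : realType} (K : T -> probability Y R) n :
  (forall B, measurable B -> measurable_fun [set: T] (K ^~ B)) ->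
  forall B, measurable B ->
  measurable_fun [set: T] (fun t => tuple_probability (K t) n B).
Proof.
move=> mK; elim: n => [|n IH] B mB; first exact: measurable_cst.
pose K' (z : T * Y) := tuple_probability (K z.1) n.
have mK' C : measurable C -> measurable_fun [set: T * Y] (K' ^~ C).
  by move=> mC; apply: (measurableT_comp (IH C mC)); exact: measurable_fst.
pose A : set ((T * Y) * n.-tuple Y) := [set z | B (consT (z.1.2, z.2))].
have mA : measurable A.
  rewrite -[A]setTI; apply: (measurableT_comp (@measurable_consT _ Y n)) => //.
  apply: measurable_fun_pair => //.
  by apply: (measurableT_comp measurable_snd); exact: measurable_fst.
have mg := measurable_kernel_section mK' mA.
have g0 z : (0 <= K' z [set y | A (z, y)])%E by [].
have := measurable_kernel_integral mK g0 mg.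
congr (measurable_fun _ _); apply/funext => t.
rewrite /= /distribution /pushforward /= /product_measure1.
by apply: eq_integral => x _; rewrite /= xsectionE.
Qed.

Lemma measurable_joint_section {d d1 d'} {T : measurableType d}
    {T1 : measurableType d1}
    {Y : measurableType d'} {R : realType} (K : T -> probability Y R)
    (s : T -> T1) :
  (forall B, measurable B -> measurable_fun [set: T] (K ^~ B)) ->
  measurable_fun [set: T] s ->
  forall A : set (Y * T1), measurable A ->
  measurable_fun [set: T] (fun t => K t [set x | A (x, s t)]).
Proof.
move=> mK ms A mA.
apply: (measurable_kernel_section mK (A := [set z | A (z.2, s z.1)])).
rewrite -[X in measurable X]setTI.
have mF : measurable_fun [set: T * Y] (fun z => (z.2, s z.1)).
  by apply: measurable_fun_pair => //; apply: (measurableT_comp ms).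
exact: (mF measurableT).
Qed.

(** Uniform mixture of finitely many probability measures. *)
Section average.
Context {d} {T : measurableType d} {R : realType}.
Variables (m : nat -> probability T R) (K : nat).

Let w0 : 0 <= K.+1%:R^-1 :> R. Proof. by rewrite invr_ge0. Qed.

Definition average : set T -> \bar R :=
  mscale (NngNum w0) (msum (fun k => m k : {measure set T -> \bar R}) K.+1).

HB.instance Definition _ := Measure.on average.

Lemma averageE A : average A = (K.+1%:R^-1%:E * \sum_(k < K.+1) m k A)%E.
Proof. by []. Qed.

Let average1 : average [set: T] = 1%E.
Proof.
rewrite averageE (eq_bigr (fun=> 1%:E)); last by move=> k _; exact: probability_setT.
by rewrite sumEFin sumr_const card_ord -EFinM mulVf// pnatr_eq0.
Qed.

HB.instance Definition _ := Measure_isProbability.Build _ _ _ average average1.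

Lemma ge0_integral_average (f : T -> \bar R) :
  measurable_fun [set: T] f -> (forall x, (0 <= f x)%E) ->
  (\int[average]_x f x = K.+1%:R^-1%:E * \sum_(k < K.+1) \int[m k]_x f x)%E.
Proof.
move=> mf f0.
rewrite ge0_integral_mscale//; congr (_ * _)%E.
by rewrite ge0_integral_measure_sum.
Qed.

End average.
Section discrete_laws.
Context {R : realType}.

Lemma average_dirac {d} {T : measurableType d} (y : nat -> T) K (f : T -> R) :
  measurable_fun [set: T] f ->
  (average (fun k => \d_(y k)) K).-integrable [set: T] (fun t => (f t)%:E) /\
  \int[average (fun k => \d_(y k)) K]_t f t = K.+1%:R^-1 * \sum_(k < K.+1) f (y k).
Proof.
move=> mf; pose Q : probability T R := average (fun k => \d_(y k)) K; rewrite -/Q.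
have ge0E (g : T -> R) : measurable_fun [set: T] g -> (forall x, 0 <= g x) ->
    (\int[Q]_t (g t)%:E = (K.+1%:R^-1 * \sum_(k < K.+1) g (y k))%:E)%E.
  move=> mg g0; rewrite ge0_integral_average//; last exact/measurable_EFinP.
  rewrite EFinM -sumEFin; congr (_ * _)%E; apply: eq_bigr => k _.
  rewrite integral_dirac//; last exact/measurable_EFinP.
  by rewrite diracT mul1e.
have mn : measurable_fun setT (fun x => `|f x|) by exact: measurableT_comp.
have ig (g : T -> R) : measurable_fun [set: T] g -> (forall x, 0 <= g x) -> Q.-integrable [set: T] (fun t => (g t)%:E).
  move=> mg g0; apply/integrableP; split; first exact/measurable_EFinP.
  under eq_integral do rewrite gee0_abs ?lee_fin//.
  by rewrite ge0E// ltry.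
have i : Q.-integrable [set: T] (fun t => (f t)%:E).
  apply: (@le_integrable _ _ _ Q setT _ _ (fun x => `|f x|%:E)) => //.
  - exact/measurable_EFinP.
  - by move=> x _ /=; rewrite normr_id.
  - exact: ig.
split => //.
have mp : measurable_fun setT (fun x => f x + `|f x|) by exact: measurable_funD.
have p0 x : 0 <= f x + `|f x|.
  by rewrite -lerBlDl sub0r; have := ler_norm (- f x); rewrite normrN.
have -> : \int[Q]_t f t = \int[Q]_t ((f t + `|f t|) - `|f t|).
  by apply: eq_Rintegral => x _; rewrite addrK.
rewrite RintegralB//; [|exact: ig|exact: ig].
rewrite /Rintegral !ge0E//= -mulrBr -sumrB.
by congr (_ * _); apply: eq_bigr => k _; rewrite addrK.
Qed.

(** The law of (X, y) for X distributed as P. *)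
Definition pair_with {d1 d2} {T1 : measurableType d1} {T2 : measurableType d2}
  (y : T2) (x : T1) : T1 * T2 := (x, y).

Lemma measurable_pair_with {d1 d2} {T1 : measurableType d1}
  {T2 : measurableType d2} (y : T2) : measurable_fun [set: T1] (pair_with y).
Proof. exact: measurable_fun_pair. Qed.

HB.instance Definition _ {d1 d2} {T1 : measurableType d1}
  {T2 : measurableType d2} (y : T2) := isMeasurableFun.Build _ _ T1 _
  (pair_with y) (measurable_pair_with y).

Definition joint_law {d1 d2} {T1 : measurableType d1} {T2 : measurableType d2}
  (P : nat -> probability T1 R) (y : nat -> T2) K : probability (T1 * T2)%type R :=
  average (fun k => distribution (P k) (pair_with (y k))) K.

Lemma joint_lawE {d1 d2} {T1 : measurableType d1} {T2 : measurableType d2}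
  (P : nat -> probability T1 R) (y : nat -> T2) K A :
  joint_law P y K A =
  (K.+1%:R^-1%:E * \sum_(k < K.+1) distribution (P k) (pair_with (y k)) A)%E.
Proof. by []. Qed.

Lemma affinity_ge_joint_law {d1 d2} {T1 : measurableType d1}
    {T2 : measurableType d2} (P : nat -> probability T1 R)
    (y y' : nat -> T2) K (a : R) :
  (forall k, y k = y' k.+1) ->
  (forall k, (k < K)%N -> affinity_ge (P k) (P k.+1) a) ->
  affinity_ge (joint_law P y K) (joint_law P y' K) (K%:R / K.+1%:R * a).
Proof.
move=> yy' aff f m M mf m0 fmM.
have f0 x : 0 < f x by case/andP : (fmM x) => + _; exact: lt_le_trans.
have mfi : measurable_fun setT (fun x => (f x)^-1).
  exact: measurable_fun_inv_gt0.
rewrite !ge0_integral_average//; last 4 first.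
- exact/measurable_EFinP.
- by move=> x; rewrite lee_fin invr_ge0 ltW.
- exact/measurable_EFinP.
- by move=> x; rewrite lee_fin ltW.
have Ki : (0 <= K.+1%:R^-1%:E :> \bar R)%E by rewrite lee_fin invr_ge0.
pose u k := (\int[P k]_x (f (x, y k))%:E)%E.
pose v k := (\int[P k]_x ((f (x, y' k))^-1)%:E)%E.
have uE k : (\int[distribution (P k) (pair_with (y k))]_x (f x)%:E = u k)%E.
  rewrite ge0_integral_distribution//; first exact/measurable_EFinP.
  by move=> x; rewrite lee_fin ltW.
have vE k : (\int[distribution (P k) (pair_with (y' k))]_x ((f x)^-1)%:E = v k)%E.
  rewrite ge0_integral_distribution//; first exact/measurable_EFinP.
  by move=> x; rewrite lee_fin invr_ge0 ltW.
under eq_bigr do rewrite uE.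
under [X in (_ + _ * X)%E]eq_bigr do rewrite vE.
have u0 k : (0 <= u k)%E by apply: integral_ge0 => x _; rewrite lee_fin ltW.
have v0 k : (0 <= v k)%E by apply: integral_ge0 => x _; rewrite lee_fin invr_ge0 ltW.
rewrite -ge0_muleDr ?sume_ge0//.
rewrite (_ : 2 * _ = K.+1%:R^-1 * (K%:R * (2 * a))); last by ring.
rewrite EFinM lee_wpmul2l//.
rewrite big_ord_recr/= [X in (_ <= _ + X)%E]big_ord_recl/=.
apply: (@le_trans _ _ (\sum_(k < K) u k + \sum_(k < K) v k.+1)%E); last first.
  by apply: leeD; [rewrite leeDl|rewrite leeDr].
rewrite -big_split/=.
have -> : ((K%:R * (2 * a))%:E = \sum_(k < K) (2 * a)%:E :> \bar R)%E.
  by rewrite sumEFin sumr_const card_ord mulr_natl.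
apply: lee_sum => k _.
have mfk : measurable_fun setT (fun x => f (x, y k)).
  by apply: (measurableT_comp mf); exact: measurable_fun_pair.
have := aff k (ltn_ord k) _ _ _ mfk m0 (fun x => fmM (x, y k)).
by rewrite /u /v yy'.
Qed.

(** Only the first of the two laws charges the last atom y K, hence they differ. *)
Lemma hellinger2_joint_law_gt0 {d1 d2} {T1 : measurableType d1}
    {T2 : measurableType d2} (P : nat -> probability T1 R)
    (y y' : nat -> T2) K :
  measurable [set y K] -> (forall k, (k < K)%N -> y k != y K) ->
  (forall k, (k <= K)%N -> y' k != y K) ->
  0 < hellinger2 (joint_law P y K) (joint_law P y' K).
Proof.
move=> mK yK y'K.
pose A : set (T1 * T2) := [set: T1] `*` [set y K].
have mA : measurable A by exact: measurableX.
have mi : measurable_fun setT (\1_A : T1 * T2 -> R) by exact: measurable_indic.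
have sq x : (\1_A x : R) ^+ 2 = \1_A x.
  by rewrite indicE; case: (x \in A); rewrite ?expr1n ?expr0n.
have comp (z : nat -> T2) k : distribution (P k) (pair_with (z k)) A =
    if z k == y K then 1%E else 0%E.
  rewrite /distribution /pushforward.
  have [zy|zy] := eqVneq (z k) (y K).
    rewrite (_ : _ @^-1` _ = setT) ?probability_setT//.
    by apply/seteqP; split => // x _; split.
  rewrite (_ : _ @^-1` _ = set0) ?measure0//.
  by apply/seteqP; split => // x [_ /= /eqP]; rewrite (negbTE zy).
have E1 : joint_law P y K A = K.+1%:R^-1%:E.
  rewrite joint_lawE.
  under eq_bigr do rewrite comp.
  rewrite big_ord_recr/= eqxx big1 ?add0e ?mule1// => k _.
  by rewrite (negbTE (yK _ (ltn_ord k))).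
have E2 : joint_law P y' K A = 0%E.
  rewrite joint_lawE.
  under eq_bigr do rewrite comp.
  rewrite big1 ?mule0// => k _.
  by rewrite (negbTE (y'K k _))// -ltnS.
have fin2 (Q : probability (T1 * T2)%type R) : (\int[Q]_x ((\1_A x : R) ^+ 2)%:E = Q A)%E.
  under eq_integral do rewrite sq.
  by rewrite integral_indic// setIT.
have lt2 (Q : probability (T1 * T2)%type R) : (\int[Q]_x ((\1_A x : R) ^+ 2)%:E < +oo)%E.
  by rewrite fin2 (le_lt_trans (probability_le1 _ _))// ltry.
have rI (Q : probability (T1 * T2)%type R) : \int[Q]_x (\1_A x : R) = fine (Q A).
  by rewrite /Rintegral integral_indic// setIT.
have rI2 (Q : probability (T1 * T2)%type R) : \int[Q]_x ((\1_A x : R) ^+ 2) = fine (Q A).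
  by rewrite /Rintegral fin2.
have h0 : 0 < 2^-1 :> R by rewrite invr_gt0.
have := hellinger_mean_gap mi h0 (lt2 (joint_law P y K)) (lt2 (joint_law P y' K)).
rewrite !rI !rI2 E1 E2/= mulfV ?pnatr_eq0// divr1 addr0 subr0.
have : 0 < K.+1%:R^-1 :> R by rewrite invr_gt0.
move: (K.+1%:R^-1) => q; lra.
Qed.

End discrete_laws.

Section chain_bounds.
Context {R : realType} {d : nat} {dX : measure_display} {X : measurableType dX}.
Variables (P : 'rV[R]_d -> probability X R) (psi : 'rV[R]_d -> R)
  (theta0 : 'rV[R]_d) (n : nat) (c : R) (phi : 'rV[R]_d -> 'rV[R]_d)
  (h : 'rV[R]_d) (K : nat).

Let y k : 'rV[R]_d := k.+1%:R *: h.
Let Pn k := tuple_probability (P (phi (y k))) n.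
Let Q : probability 'rV[R]_d R := average (fun k => \d_(y k)) K.
Let M u : probability (n.-tuple X * 'rV[R]_d)%type R :=
  joint_law Pn (fun k => y k - u) K.

Hypothesis diffphi : diffeomorphism (local_ball theta0 n c) phi.
Hypothesis mP : forall B, measurable B ->
  measurable_fun [set: 'rV[R]_d] (fun t => P (phi t) B).
Hypothesis mpsi : measurable_fun [set: 'rV[R]_d] (psi \o phi).

Let yS k : y k - h = k%:R *: h.
Proof. by rewrite /y mulrSr scalerDl scale1r addrK. Qed.

Lemma shifted_law_chain u : shifted_law P phi Q u (M u).
Proof.
move=> A mA k.
have mk : measurable_fun [set: 'rV[R]_d] k.
  apply: (measurable_joint_section (K := fun t => tuple_probability (P (phi t)) n)
      (s := fun t => t - u)) => //.
  - exact: measurable_tuple_probability.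
  - exact: measurable_translation.
split => //.
rewrite /M joint_lawE ge0_integral_average//.
congr (_ * _)%E; apply: eq_bigr => i _.
by rewrite integral_dirac// diracT mul1e.
Qed.

Variables (a d1 d2 : R).
Hypothesis h_neq0 : h != 0.
Hypothesis a0 : 0 <= a.
Hypothesis aff : forall k, (k < K)%N ->
  affinity_ge (P (phi (k.+1%:R *: h))) (P (phi (k.+2%:R *: h))) a.
Hypothesis d10 : 0 <= d1.
Hypothesis incr : forall k, (k <= K)%N ->
  d1 <= psi (phi (k.+1%:R *: h)) - psi (phi (k%:R *: h)) <= d2.

Let H := 2 - 2 * (K%:R / K.+1%:R * a ^+ n).

Lemma chain_hellinger2 : 0 < hellinger2 (M 0) (M h) <= H.
Proof.
apply/andP; split.
  have inj (k l : nat) : (k != l) -> k%:R *: h != l%:R *: h.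
    move=> kl; rewrite -subr_eq0 -scalerBl scaler_eq0 negb_or h_neq0 andbT.
    by rewrite subr_eq0 eqr_nat.
  apply: hellinger2_joint_law_gt0.
  - rewrite -[X in measurable X]setCK; apply: measurableC.
    apply: open_measurable_rV; apply: closed_openC.
    exact: (accessible_closed_set1 (hausdorff_accessible (@norm_hausdorff _ _))).
  - move=> k kK; rewrite !subr0; apply: inj.
    by rewrite eqSS neq_ltn kK.
  - move=> k kK; rewrite subr0.
    by rewrite yS; apply: inj; rewrite neq_ltn ltnS kK.
apply: affinity_ge_hellinger2; apply: affinity_ge_joint_law.
- by move=> k; rewrite subr0 yS.
- by move=> k kK; apply: affinity_ge_tuple => //; exact: aff.
Qed.

Let incrE k : increment psi phi h (y k) =
  psi (phi (k.+1%:R *: h)) - psi (phi (k%:R *: h)).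
Proof.
by rewrite /increment yS.
Qed.

Let mincr : measurable_fun [set: 'rV[R]_d] (increment psi phi h).
Proof.
apply: measurable_funB => //.
by apply: (measurableT_comp mpsi); exact: measurable_translation.
Qed.

Lemma chain_admissible : admissible psi (local_ball theta0 n c) phi Q h.
Proof.
split=> //.
- by have [] := average_dirac y K mincr.
- by have [] := average_dirac y K (measurable_funX 2 mincr).
Qed.

Lemma chain_bias_D : d1 ^+ 2 <= bias_D psi phi Q h.
Proof.
rewrite /bias_D; have [_ ->] := average_dirac y K mincr.
rewrite lerXn2r ?nnegrE//.
  rewrite mulr_ge0 ?invr_ge0// sumr_ge0// => k _; rewrite incrE.
  by case/andP : (incr (leq_ord k)) => + _; exact: le_trans.
rewrite ler_pdivlMl//.
rewrite (_ : K.+1%:R * d1 = \sum_(k < K.+1) d1); last first.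
  by rewrite sumr_const card_ord mulr_natl.
by apply: ler_sum => k _; rewrite incrE; case/andP : (incr (leq_ord k)).
Qed.

Lemma chain_bias_B : bias_B psi phi Q h <= d2 ^+ 2.
Proof.
rewrite /bias_B; have [_ ->] := average_dirac y K (measurable_funX 2 mincr).
rewrite ler_pdivrMl//.
rewrite (_ : K.+1%:R * d2 ^+ 2 = \sum_(k < K.+1) d2 ^+ 2); last first.
  by rewrite sumr_const card_ord mulr_natl.
apply: ler_sum => k _; rewrite incrE; case/andP : (incr (leq_ord k)) => u v.
by rewrite lerXn2r ?nnegrE// ?(le_trans _ v)// ?(le_trans _ u).
Qed.

Let value := (Num.max 0 (d1 / Num.sqrt (4 * H) - d2)) ^+ 2.

Let d20 : 0 <= d2.
Proof. by case/andP : (incr (leq0n K)) => u v; exact: le_trans (le_trans d10 u) v. Qed.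

Let sqrtB : Num.sqrt (bias_B psi phi Q h) <= d2.
Proof. by rewrite -(ger0_norm d20) -sqrtr_sqr ler_wsqrtr// chain_bias_B. Qed.

Let B0 : 0 <= bias_B psi phi Q h.
Proof. by apply: Rintegral_ge0 => x _; exact: sqr_ge0. Qed.

Let quotient z : 0 < z <= H -> d1 / Num.sqrt (4 * H) <= Num.sqrt (bias_D psi phi Q h / (4 * z)).
Proof.
move=> /andP[z0 zH].
have z4 : 0 < 4 * z by rewrite mulr_gt0.
have H4 : 0 < 4 * H by rewrite mulr_gt0// (lt_le_trans z0).
rewrite -(ger0_norm (_ : 0 <= d1 / Num.sqrt (4 * H))); last by rewrite divr_ge0 ?sqrtr_ge0.
rewrite -sqrtr_sqr ler_wsqrtr// exprMn exprVn sqr_sqrtr ?(ltW H4)//.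
apply: ler_pM; rewrite ?sqr_ge0 ?invr_ge0 ?(ltW H4)//; first exact: chain_bias_D.
by rewrite lef_pV2 ?posrE// ler_pM2l.
Qed.

Let max_sqr_le u v : u <= v -> (Num.max 0 u) ^+ 2 <= (Num.max 0 v) ^+ 2 :> R.
Proof.
have p x : 0 <= Num.max 0 x :> R by rewrite le_max lexx.
by move=> uv; rewrite lerXn2r ?nnegrE ?p// ge_max p/= le_max uv orbT.
Qed.

Lemma L3_ge_chain : (value%:E <= L3 P psi theta0 n c)%E.
Proof.
apply: (@le_trans _ _ ((Num.max 0
   (Num.sqrt (bias_D psi phi Q h / (4 * hellinger2 (M 0) (M h)))
           - Num.sqrt (bias_B psi phi Q h))) ^+ 2)%:E); last first.
  apply: ereal_sup_ubound; exists phi, Q, h, (M 0), (M h); split => //.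
  - exact: chain_admissible.
  - exact: shifted_law_chain.
  - exact: shifted_law_chain.
rewrite lee_fin; apply: max_sqr_le; apply: lerB => //.
exact/quotient/chain_hellinger2.
Qed.

Lemma L2_ge_chain : (value%:E <= L2 P psi theta0 n c)%E.
Proof.
have h1 : (0 : R) <= 2^-1 by lra.
have h2 : (2^-1 : R) <= 1 by lra.
pose l : {i01 R} := Itv01 h1 h2.
have [x [chiE x0 xH xz]] := @chi2_mixture_half _ _ _ (M 0) (M h) l erefl.
have /andP[H0 HH] := chain_hellinger2.
have x1 : 0 < x <= H.
  rewrite (le_trans xH HH) andbT lt_neqAle x0 andbT eq_sym.
  by apply/eqP => /xz H00; rewrite H00 ltxx in H0.
apply: (@le_trans _ _ ((Num.max 0
          ((1 - l%:num)
             * Num.sqrt (bias_D psi phi Q h / fine (chi2 (M h) (mixture l (M h) (M 0))))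
           - Num.sqrt (l%:num * bias_B psi phi Q h))) ^+ 2)%:E); last first.
  apply: ereal_sup_ubound; exists phi, Q, l, h, (M 0), (M h); split => //.
  - exact: chain_admissible.
  - exact: shifted_law_chain.
  - exact: shifted_law_chain.
rewrite lee_fin; apply: max_sqr_le; rewrite chiE /=.
apply: lerB.
  apply: (le_trans (quotient x1)).
  rewrite (_ : 1 - 2^-1 = 2^-1); last by lra.
  rewrite -[X in _ <= X * _]ger0_norm// -sqrtr_sqr -sqrtrM ?sqr_ge0//.
  rewrite ler_wsqrtr// le_eqVlt; apply/orP; left; apply/eqP.
  by field; case/andP : x1 => x1 _; rewrite gt_eqF.
apply: le_trans sqrtB; rewrite ler_wsqrtr//.
by rewrite ler_piMl//; lra.
Qed.

Lemma L3_ge0 : (0 <= L3 P psi theta0 n c)%E.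
Proof.
apply: (@le_trans _ _ ((Num.max 0
   (Num.sqrt (bias_D psi phi Q h / (4 * hellinger2 (M 0) (M h)))
           - Num.sqrt (bias_B psi phi Q h))) ^+ 2)%:E).
  by rewrite lee_fin sqr_ge0.
apply: ereal_sup_ubound; exists phi, Q, h, (M 0), (M h); split => //.
- exact: chain_admissible.
- exact: shifted_law_chain.
- exact: shifted_law_chain.
Qed.

Lemma L2_ge0 : (0 <= L2 P psi theta0 n c)%E.
Proof.
pose l : {i01 R} := Itv01 (lexx 0) ler01.
apply: (@le_trans _ _ ((Num.max 0
          ((1 - l%:num)
             * Num.sqrt (bias_D psi phi Q h / fine (chi2 (M h) (mixture l (M h) (M 0))))
           - Num.sqrt (l%:num * bias_B psi phi Q h))) ^+ 2)%:E).
  by rewrite lee_fin sqr_ge0.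
apply: ereal_sup_ubound; exists phi, Q, l, h, (M 0), (M h); split => //.
- exact: chain_admissible.
- exact: shifted_law_chain.
- exact: shifted_law_chain.
Qed.

End chain_bounds.
Section C1_calculus.
Context {R : realType} {d : nat}.
Implicit Types (f g : 'rV[R]_d -> R) (S : set 'rV[R]_d) (t : 'rV[R]_d).

Lemma continuous_rV {T : topologicalType} (F : T -> 'rV[R]_d) (t : T) :
  (forall i, {for t, continuous (fun s => F s 0 i)}) -> {for t, continuous F}.
Proof.
move=> cF; apply/cvgrPdist_lt => e e0.
have : \forall s \near t, forall i, `|F t 0 i - F s 0 i| < e.
  apply: filter_forall => i.
  by have /cvgrPdist_lt/(_ _ e0) := cF i.
apply: filterS => s hs.
rewrite /Num.norm/= mx_normrE; apply: bigmax_lt => // -[i j] _ /=.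
by rewrite ord1 !mxE.
Qed.

Definition C1_on S f := forall t, S t -> differentiable f t /\
  forall i, {for t, continuous (fun s => 'D_(delta_mx 0 i) f s)}.

Lemma C1_on_C1_at S f t : open S -> C1_on S f -> S t -> C1_at f t.
Proof.
move=> oS Cf St; split.
  by apply: filterS (oS _ St) => s Ss; case: (Cf s Ss).
apply: continuous_rV => i.
rewrite (_ : (fun s => _) = (fun s => 'D_(delta_mx 0 i) f s)).
  by case: (Cf t St) => _; exact.
by apply/funext => s; rewrite mxE.
Qed.

Lemma C1_on_cst S (a : R) : C1_on S (fun=> a).
Proof.
move=> t _; split; first exact: differentiable_cst.
move=> i; have -> : 'D_(delta_mx 0 i) (cst a : 'rV[R]_d -> R) = cst (0 : R); last exact: cst_continuous.
  by apply/funext => s; rewrite derive_cst.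
Qed.

Lemma C1_on_coord S i : C1_on S (fun t => t 0 i).
Proof.
move=> t _; split; first exact: differentiable_coord.
move=> j.
have -> : 'D_(delta_mx 0 j) (fun t : 'rV[R]_d => t 0 i) = cst ((delta_mx 0 j : 'rV[R]_d) 0 i : R); last exact: cst_continuous.
apply/funext => s; rewrite deriveE; last exact: differentiable_coord.
have lin : linear (fun t : 'rV[R]_d => t 0 i : R^o).
  by move=> a u v; rewrite !mxE.
pose L0 := GRing.isLinear.Build _ _ _ _ _ lin.
pose L : {linear 'rV[R]_d -> R^o} := HB.pack (fun t : 'rV[R]_d => t 0 i) L0.
rewrite -[X in 'd X _](_ : (L : 'rV[R]_d -> R^o) = _)//.
by rewrite diff_lin//; exact: coord_continuous.
Qed.

Let near_cont S (f g : 'rV[R]_d -> R) t : open S -> S t ->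
  (forall s, S s -> f s = g s) -> {for t, continuous g} -> {for t, continuous f}.
Proof.
move=> oS St fg cg; rewrite /prop_for /continuous_at (fg _ St).
have e : \forall s \near t, g s = f s by apply: filterS (oS _ St) => s /fg ->.
exact: cvg_trans (near_eq_cvg e) cg.
Qed.

Lemma C1_on_add S f g : open S -> C1_on S f -> C1_on S g ->
  C1_on S (fun t => f t + g t).
Proof.
move=> oS Cf Cg t St; have [df cf] := Cf _ St; have [dg cg] := Cg _ St.
split; first exact: differentiableD.
move=> i; apply: (near_cont oS St (g := fun s => 'D_(delta_mx 0 i) f s + 'D_(delta_mx 0 i) g s)).
  move=> s Ss; rewrite -[fun _ => _]/(f + g) deriveD//; apply: diff_derivable.
    by case: (Cf _ Ss).
  by case: (Cg _ Ss).
exact: continuousD (cf i) (cg i).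
Qed.

Lemma C1_on_mul S f g : open S -> C1_on S f -> C1_on S g ->
  C1_on S (fun t => f t * g t).
Proof.
move=> oS Cf Cg t St; have [df cf] := Cf _ St; have [dg cg] := Cg _ St.
split; first exact: differentiableM.
move=> i; apply: (near_cont oS St (g := fun s =>
   f s * 'D_(delta_mx 0 i) g s + g s * 'D_(delta_mx 0 i) f s)).
  move=> s Ss; rewrite -[fun _ => _]/(f * g) deriveM//; apply: diff_derivable.
    by case: (Cf _ Ss).
  by case: (Cg _ Ss).
have fc := differentiable_continuous df; have gc := differentiable_continuous dg.
by apply: continuousD; apply: continuousM.
Qed.

Lemma C1_on_sum S (n : nat) (F : 'I_n -> 'rV[R]_d -> R) : open S ->
  (forall i, C1_on S (F i)) -> C1_on S (fun t => \sum_i F i t).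
Proof.
move=> oS CF.
rewrite (_ : (fun t => _) = \sum_i F i); last by apply/funext => t; rewrite fct_sumE.
elim/big_ind : _ => //; first exact: C1_on_cst.
by move=> f g Cf Cg; exact: C1_on_add.
Qed.

Lemma C1_on_comp S f (u u' : R -> R) : open S -> C1_on S f ->
  (forall t, S t -> is_derive (f t) 1 u (u' (f t)) /\ {for f t, continuous u'}) ->
  C1_on S (fun t => u (f t)).
Proof.
move=> oS Cf Cu t St; have [df cf] := Cf _ St; have [du cu] := Cu _ St.
have dd s : S s -> differentiable u (f s).
  by move=> Ss; apply/derivable1_diffP; case: (Cu _ Ss) => -[].
split; first exact: (differentiable_comp df (dd _ St)).
move=> i; apply: (near_cont oS St (g := fun s => 'D_(delta_mx 0 i) f s * u' (f s))).
  move=> s Ss; have [dfs _] := Cf _ Ss.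
  rewrite -[fun _ => _]/(u \o f) deriveE; last exact: (differentiable_comp dfs (dd _ Ss)).
  rewrite diff_comp//; last exact: dd.
  rewrite /= diff1E; last exact: dd.
  rewrite -deriveE// derive1E /=.
  by case: (Cu _ Ss) => -[_ ->].
have fc := differentiable_continuous df.
apply: continuousM; first exact: cf.
exact: (continuous_comp fc cu).
Qed.

End C1_calculus.

Section ball_diffeomorphism.
Context {R : realType} {d : nat}.
Implicit Types (t h : 'rV[R]_d).

Lemma C1_on_coord_shift (S : set 'rV[R]_d) (t0 : 'rV[R]_d) i : open S ->
  C1_on S (fun t : 'rV[R]_d => (t - t0) 0 i).
Proof.
move=> oS; under eq_fun do rewrite !mxE.
by apply: C1_on_add => //; [exact: C1_on_coord|exact: C1_on_cst].
Qed.

Lemma C1_on_dist (S : set 'rV[R]_d) (t0 : 'rV[R]_d) : open S ->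
  C1_on S (fun t => dotp (t - t0) (t - t0)).
Proof.
move=> oS; apply: C1_on_sum => // i.
by apply: C1_on_mul => //; exact: C1_on_coord_shift.
Qed.

Lemma open_eball (t0 : 'rV[R]_d) (r : R) : open (eball t0 r).
Proof.
rewrite openE => t tr.
have c : {for t, continuous (fun s : 'rV[R]_d => enorm (s - t0))}.
  apply: (@continuous_comp _ _ _ (fun s : 'rV[R]_d => dotp (s - t0) (s - t0)) Num.sqrt); last first.
    exact: sqrt_continuous.
  have [+ _] := C1_on_dist t0 openT (I : setT t).
  exact: differentiable_continuous.
exact: (cvgr_lt _ c r tr).
Qed.

(* x |-> (1 + s x)^(-1/2) *)
Definition rsqrt (s x : R) : R := (Num.sqrt (1 + s * x))^-1.

Lemma is_derive_rsqrt (s x : R) : 0 < 1 + s * x ->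
  is_derive x 1 (rsqrt s) (- (s / 2) * rsqrt s x ^+ 3) /\
  {for x, continuous (fun x => - (s / 2) * rsqrt s x ^+ 3)}.
Proof.
move=> x0.
have q0 : Num.sqrt (1 + s * x) != 0 by rewrite gt_eqF// sqrtr_gt0.
have di : is_derive x 1 (fun x => 1 + s * x) s.
  apply: (is_derive_eq (is_deriveD (is_derive_cst (1 : R^o) x 1)
    (is_deriveM (is_derive_cst (s : R^o) x 1) (is_derive_id x 1)))).
  by rewrite /GRing.scale/= add0r mulr1 mulr0 addr0.
have ds : is_derive x 1 (Num.sqrt \o (fun x => 1 + s * x)) ((2 * Num.sqrt (1 + s * x))^-1 * s).
  by apply: is_derive1_comp; exact: is_derive1_sqrt.
have dr : is_derive x 1 (rsqrt s) (- (s / 2) * rsqrt s x ^+ 3).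
  apply: (is_derive_eq (is_deriveV (f := Num.sqrt \o (fun x => 1 + s * x)) q0 ds)).
  rewrite /GRing.scale/= /rsqrt.
  by field; rewrite q0.
split => //.
have cr : {for x, continuous (rsqrt s)}.
  apply: differentiable_continuous; apply/derivable1_diffP; by case: dr.
apply: continuousM; first exact: cst_continuous.
rewrite (_ : (fun x => rsqrt s x ^+ 3) = (fun x => rsqrt s x * (rsqrt s x * rsqrt s x))).
  exact: continuousM cr (continuousM cr cr).
by apply/funext => y; rewrite !exprS expr0 mulr1.
Qed.

(* t |-> a + b (t - t0) (1 + s |t - t0|^2)^(-1/2): both the radial chart of
   the ball and its inverse have this form. *)
Definition radial (a : 'rV[R]_d) (b s : R) (t0 t : 'rV[R]_d) : 'rV[R]_d :=
  a + (b * rsqrt s (dotp (t - t0) (t - t0))) *: (t - t0).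

Lemma C1_radial S a b s t0 j : open S ->
  (forall t, S t -> 0 < 1 + s * dotp (t - t0) (t - t0)) ->
  C1_on S (fun t => radial a b s t0 t 0 j).
Proof.
move=> oS pos.
have C1N := C1_on_dist t0 oS.
have -> : (fun t => radial a b s t0 t 0 j) = (fun t => a 0 j +
    (b * rsqrt s (dotp (t - t0) (t - t0))) * (t - t0) 0 j).
  by apply/funext => t; rewrite mxE mxE.
apply: C1_on_add => //; first exact: C1_on_cst.
apply: C1_on_mul => //; last exact: C1_on_coord_shift.
apply: C1_on_mul => //; first exact: C1_on_cst.
apply: (C1_on_comp oS C1N) => t St.
exact: is_derive_rsqrt (pos _ St).
Qed.

Lemma radial_sqr b s t0 t : 0 < 1 + s * dotp (t - t0) (t - t0) ->
  dotp (radial 0 b s t0 t) (radial 0 b s t0 t) =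
  b ^+ 2 * dotp (t - t0) (t - t0) / (1 + s * dotp (t - t0) (t - t0)).
Proof.
move=> pos; rewrite /radial add0r dotpZl dotpZr mulrA -expr2 exprMn /rsqrt.
rewrite exprVn sqr_sqrtr ?(ltW pos)//.
by rewrite mulrAC.
Qed.

Definition ball_chart theta0 (r : R) : 'rV[R]_d -> 'rV[R]_d := radial theta0 r 1 0.

Lemma ball_chart_diffeomorphism theta0 (r : R) : 0 < r ->
  diffeomorphism (eball theta0 r) (ball_chart theta0 r).
Proof.
move=> r0.
have rn0 : r != 0 by rewrite gt_eqF.
have p1 t : 0 < 1 + 1 * dotp (t - 0) (t - 0).
  by rewrite mul1r ltr_wpDr// dotp_ge0.
have r20 : 0 < r ^+ 2 by rewrite exprn_gt0.
have p2 s : eball theta0 r s -> 0 < 1 + (- r ^- 2) * dotp (s - theta0) (s - theta0).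
  rewrite /eball /= => h; rewrite mulNr subr_gt0 mulrC ltr_pdivrMr// mul1r.
  by rewrite -enorm_sqr ltrXn2r// ?enorm_ge0 // nnegrE ?enorm_ge0 ?(ltW r0).
have rs (s x : R) : 0 < 1 + s * x -> rsqrt s x ^+ 2 = (1 + s * x)^-1.
  by move=> h; rewrite /rsqrt exprVn sqr_sqrtr// ltW.
have rs0 (s x : R) : 0 <= rsqrt s x by rewrite /rsqrt invr_ge0 sqrtr_ge0.
have sqr1 (a b : R) : 0 <= a -> 0 <= b -> a ^+ 2 * b ^+ 2 = 1 -> a * b = 1.
  move=> a0 b0 h; apply: (@pexpIrn _ 2) => //; rewrite ?nnegrE ?mulr_ge0//.
  by rewrite exprMn h expr1n.
exists (radial 0 r^-1 (- r ^- 2) theta0); split.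
- move=> t; rewrite /eball /=.
  have -> : ball_chart theta0 r t - theta0 = radial 0 r 1 0 t.
    by rewrite /ball_chart /radial add0r addrC addKr.
  rewrite -[ltRHS](ger0_norm (ltW r0)) -[ltRHS]sqrtr_sqr ltr_sqrt// radial_sqr//.
  rewrite ltr_pdivrMr// ltr_pM2l// mul1r ltrDr//.
- move=> t; rewrite /radial add0r.
  have -> : ball_chart theta0 r t - theta0 = (r * rsqrt 1 (dotp t t)) *: t.
    by rewrite /ball_chart /radial addrC addKr !subr0.
  rewrite scalerA dotpZl dotpZr.
  set q := dotp t t; have q0 : 0 <= q by exact: dotp_ge0.
  set x := r * rsqrt 1 q * _.
  have pq : 0 < 1 + 1 * q by rewrite mul1r ltr_wpDr.
  have xE : x = r ^+ 2 * q / (1 + q).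
    rewrite /x mulrA -expr2 exprMn rs// mul1r; ring.
  have px : 1 + - r ^- 2 * x = (1 + q)^-1.
    rewrite xE; field; rewrite rn0 /=; rewrite mul1r in pq; by rewrite gt_eqF.
  rewrite [X in X *: _](_ : _ = 1) ?scale1r//.
  have -> : r^-1 * rsqrt (- r ^- 2) x * (r * rsqrt 1 q) = rsqrt (- r ^- 2) x * rsqrt 1 q.
    by field.
  apply: sqr1 => //; rewrite !rs// ?px ?invr_gt0//; rewrite mul1r in pq => //.
  by rewrite mul1r invrK mulfV// gt_eqF.
- move=> s Ss; have h := p2 _ Ss.
  rewrite /ball_chart {1}/radial !subr0 /radial !add0r.
  set u := s - theta0; set q := dotp u u.
  rewrite scalerA dotpZl dotpZr -/q.
  set x := r^-1 * rsqrt (- r ^- 2) q * _.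
  have q0 : 0 <= q by exact: dotp_ge0.
  move: h; rewrite -/u -/q => h.
  have xE : x = r ^- 2 * q / (1 + - r ^- 2 * q).
    by rewrite /x mulrA -expr2 exprMn rs// exprVn; ring.
  have hn : 1 + - r ^- 2 * q != 0 by rewrite gt_eqF.
  have hn' : r ^+ 2 - q != 0.
    apply: contra hn => /eqP e.
    have -> : q = r ^+ 2 by apply/eqP; rewrite eq_sym -subr_eq0 e.
    by rewrite mulNr mulVf ?subrr// gt_eqF.
  have px : 1 + 1 * x = (1 + - r ^- 2 * q)^-1.
    by rewrite xE mul1r; field; rewrite rn0 mulN1r.
  rewrite [X in X *: _](_ : _ = 1).
    by rewrite scale1r /u addrC subrK.
  have -> : r * rsqrt 1 x * (r^-1 * rsqrt (- r ^- 2) q) = rsqrt 1 x * rsqrt (- r ^- 2) q.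
    by field.
  apply: sqr1 => //; rewrite !rs// ?px ?invr_gt0//.
  by rewrite invrK mulfV.
- move=> t j; apply: (@C1_on_C1_at _ _ setT); [exact: openT| |by []].
  by apply: C1_radial => //; exact: openT.
- move=> t j St; apply: (@C1_on_C1_at _ _ (eball theta0 r)) => //; first exact: open_eball.
  by apply: C1_radial => //; exact: open_eball.
Qed.

Lemma ball_chart_continuous theta0 r : continuous (ball_chart theta0 r).
Proof.
move=> t; apply: continuous_rV => j.
have p1 (s : 'rV[R]_d) : setT s -> 0 < 1 + 1 * dotp (s - 0) (s - 0) :> R.
  by move=> _; rewrite mul1r ltr_wpDr// dotp_ge0.
have [+ _] := @C1_radial setT theta0 r 1 0 j openT p1 t Logic.I.
exact: differentiable_continuous.
Qed.

Lemma ball_chart_line theta0 r a t :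
  ball_chart theta0 r (a *: t) =
  theta0 + (r * a / Num.sqrt (1 + a ^+ 2 * dotp t t)) *: t.
Proof.
rewrite /ball_chart /radial !subr0 scalerA dotpZl dotpZr mulrA -expr2 /rsqrt mul1r.
by rewrite mulrAC.
Qed.

End ball_diffeomorphism.
Section model_regularity.
Context {R : realType} {d : nat} {dX : measure_display} {X : measurableType dX}.
Variable nu : {sigma_finite_measure set X -> \bar R}.

Lemma density_hellinger2 (P P' : probability X R) (p p' : X -> R) (h : R) :
  (forall x, 0 <= p x) -> measurable_fun [set: X] p ->
  (forall A, measurable A -> P A = (\int[nu]_(x in A) (p x)%:E)%E) ->
  (forall x, 0 <= p' x) -> measurable_fun [set: X] p' ->
  (forall A, measurable A -> P' A = (\int[nu]_(x in A) (p' x)%:E)%E) ->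
  (\int[nu]_x ((Num.sqrt (p x) - Num.sqrt (p' x)) ^+ 2)%:E <= h%:E)%E ->
  hellinger2 P P' <= h.
Proof.
move=> p0 mp Pp p'0 mp' P'p' hh.
have /affinity_ge_hellinger2 := affinity_ge_density p0 mp Pp p'0 mp' P'p' hh.
by lra.
Qed.

Lemma hellinger_set_gap (P P' : probability X R) (B : set X) (k : R) :
  measurable B -> 0 < k ->
  fine (P B) - fine (P' B) <= 2 * k + hellinger2 P P' / (2 * k).
Proof.
move=> mB k0.
have mi : measurable_fun setT (\1_B : X -> R) by exact: measurable_indic.
have fin2 (Q : probability X R) : (\int[Q]_x ((\1_B x : R) ^+ 2)%:E = Q B)%E.
  rewrite -[in RHS](setIT B) -integral_indic//; apply: eq_integral => x _.
  by rewrite indicE; case: (x \in B); rewrite ?expr1n ?expr0n.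
have lt2 (Q : probability X R) : (\int[Q]_x ((\1_B x : R) ^+ 2)%:E < +oo)%E.
  by rewrite fin2 (le_lt_trans (probability_le1 _ _))// ltry.
have rI (Q : probability X R) : \int[Q]_x (\1_B x : R) = fine (Q B).
  by rewrite /Rintegral integral_indic// setIT.
have rI2 (Q : probability X R) : \int[Q]_x ((\1_B x : R) ^+ 2) = fine (Q B).
  by rewrite /Rintegral fin2.
have le1 (Q : probability X R) : fine (Q B) <= 1.
  by rewrite -lee_fin fineK ?fin_num_measure// probability_le1.
have := hellinger_mean_gap mi k0 (lt2 P) (lt2 P').
rewrite !rI !rI2 => /le_trans; apply; rewrite lerD2r mulrC ler_wpM2r ?(ltW k0)//.
by have := le1 P; have := le1 P'; lra.
Qed.

Lemma hellinger_continuous (Theta : set 'rV[R]_d) (p : 'rV[R]_d -> X -> R)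
    (t : 'rV[R]_d) (xi : X -> 'rV[R]_d) (e : R) :
  (forall t, Theta t -> measurable_fun [set: X] (p t)) ->
  hellinger_differentiable nu Theta p t xi -> Theta t -> 0 < e ->
  \forall h \near (0 : 'rV[R]_d), Theta (t + h) ->
    (\int[nu]_x ((Num.sqrt (p (t + h) x) - Num.sqrt (p t x)) ^+ 2)%:E <= e%:E)%E.
Proof.
move=> mp [mxi ixi hd] Tt e0.
pose g (h : 'rV[R]_d) := 2 * dotp (h - 0) (h - 0) +
  2 * (\sum_j (\sum_i h 0 i * fisher_information nu xi i j) * h 0 j / 4).
have cg : {for (0 : 'rV[R]_d), continuous g}.
  have Cg : C1_on setT g.
    apply: C1_on_add; first exact: openT.
      apply: C1_on_mul; [exact: openT|exact: C1_on_cst|].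
      by apply: C1_on_dist; exact: openT.
    apply: C1_on_mul; [exact: openT|exact: C1_on_cst|].
    apply: C1_on_sum => [|j]; first exact: openT.
    apply: C1_on_mul; [exact: openT| |exact: C1_on_cst].
    apply: C1_on_mul; [exact: openT| |exact: C1_on_coord].
    apply: C1_on_sum => [|i]; first exact: openT.
    by apply: C1_on_mul; [exact: openT|exact: C1_on_coord|exact: C1_on_cst].
  have [+ _] := Cg 0 Logic.I; exact: differentiable_continuous.
have g0 : g 0 = 0.
  rewrite /g subr0 big1 ?mulr0 ?addr0.
    by rewrite /dotp big1 ?mulr0// => i _; rewrite mxE mulr0.
  by move=> j _; rewrite mxE mulr0 mul0r.
have ge : \forall h \near (0 : 'rV[R]_d), g h < e.
  by apply: (cvgr_lt _ cg); rewrite g0.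
apply: filterS2 (hd 1 ltr01) ge => h /[swap] he /[swap] Tth /(_ Tth) hrem.
have [intw fq] := fisher_quadratic h mxi ixi.
pose rem x := Num.sqrt (p (t + h) x) - Num.sqrt (p t x) - dotp h (xi x).
have mdot u : measurable_fun setT (fun x => dotp u (xi x)).
  by apply: measurable_sum => i; exact: measurable_funM.
have mrem : measurable_fun setT rem.
  by apply: measurable_funB => //; apply: measurable_funB;
    apply: measurable_fun_sqrt; exact: mp.
apply: (@le_trans _ _ (2%:E * \int[nu]_x (rem x ^+ 2)%:E + 2%:E * \int[nu]_x (dotp h (xi x) ^+ 2)%:E)%E).
  rewrite -!ge0_integralZl//; last 4 first.
  - by apply/measurable_EFinP/measurable_funX.
  - by move=> x _; rewrite lee_fin sqr_ge0.
  - by apply/measurable_EFinP/measurable_funX.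
  - by move=> x _; rewrite lee_fin sqr_ge0.
  rewrite -ge0_integralD//; last 4 first.
  - by move=> x _; rewrite -EFinM lee_fin mulr_ge0// sqr_ge0.
  - by apply/measurable_EFinP/measurable_funM => //; exact: measurable_funX.
  - by move=> x _; rewrite -EFinM lee_fin mulr_ge0// sqr_ge0.
  - by apply/measurable_EFinP/measurable_funM => //; exact: measurable_funX.
  apply: ge0_le_integralT.
  - by move=> x; rewrite lee_fin sqr_ge0.
  - by apply/measurable_EFinP; apply: measurable_funX; apply: measurable_funB;
      apply: measurable_fun_sqrt; exact: mp.
  - apply/measurable_EFinP; apply: measurable_funD; apply: measurable_funM => //;
      exact: measurable_funX.
  move=> x; rewrite -!EFinM -EFinD lee_fin.
  have -> : Num.sqrt (p (t + h) x) - Num.sqrt (p t x) = rem x + dotp h (xi x).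
    by rewrite /rem subrK.
  move: (rem x) (dotp h (xi x)) => a b.
  by have := sqr_ge0 (a - b); rewrite sqrrB sqrrD; lra.
have -> : (\int[nu]_x (dotp h (xi x) ^+ 2)%:E = ((h *m fisher_information nu xi *m h^T) 0 0 / 4)%:E)%E.
  rewrite -fq mulrAC mulfV ?mul1r ?pnatr_eq0// /Rintegral fineK//.
  exact: integrable_fin_num.
have t2 : (0 <= 2%:E :> \bar R)%E by rewrite lee_fin.
apply: (le_trans (leeD2r _ (lee_wpmul2l t2 hrem))).
rewrite mul1r -!EFinM -EFinD lee_fin (le_trans _ (ltW he))//.
rewrite /g subr0 enorm_sqr lerD2l ler_wpM2l//.
rewrite mxE mulr_suml le_eqVlt; apply/orP; left; apply/eqP; apply: eq_bigr => j _.
by rewrite !mxE.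
Qed.

(** Hellinger differentiability at every parameter makes the model a
    measurable kernel: Hellinger continuity gives continuity in total variation. *)
Lemma measurable_model (Theta : set 'rV[R]_d) (P : 'rV[R]_d -> probability X R)
    (p : 'rV[R]_d -> X -> R) (xi : 'rV[R]_d -> X -> 'rV[R]_d)
    (phi : 'rV[R]_d -> 'rV[R]_d) (S : set 'rV[R]_d) :
  has_density nu P Theta p ->
  (forall t, Theta t -> hellinger_differentiable nu Theta p t (xi t)) ->
  open S -> S `<=` Theta -> (forall t, S (phi t)) -> continuous phi ->
  forall B, measurable B ->
  measurable_fun [set: 'rV[R]_d] (fun t => P (phi t) B).
Proof.
move=> dens hd oS ST Sphi cphi B mB.
have mp t : Theta t -> measurable_fun [set: X] (p t) by move=> /dens[].
have cP t : S t -> {for t, continuous (fun s : 'rV[R]_d => fine (P s B))}.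
  move=> St; apply/(@cvgrPdist_lt _ _ _ (nbhs t) (nbhs_filter t)) => e e0.
  have Tt := ST _ St.
  have e8 : 0 < e ^+ 2 / 8 by rewrite divr_gt0// exprn_gt0.
  have h1 := hellinger_continuous mp (hd _ Tt) Tt e8.
  have h2 : \forall s \near t, Theta (t + (s - t)) ->
    (\int[nu]_x ((Num.sqrt (p (t + (s - t)) x) - Num.sqrt (p t x)) ^+ 2)%:E <= (e ^+ 2 / 8)%:E)%E.
    move/nbhs_normP : h1 => [r /= r0 hr]; apply/nbhs_normP; exists r => //= s st.
    by apply: hr; rewrite /= sub0r opprB.
  apply: filterS2 (oS _ St) h2 => s Ss; rewrite addrC subrK => /(_ (ST _ Ss)) hs.
  have [p0 _ Pp] := dens _ Tt; have [p'0 _ Pp'] := dens _ (ST _ Ss).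
  have hs' : (\int[nu]_x ((Num.sqrt (p t x) - Num.sqrt (p s x)) ^+ 2)%:E <= (e ^+ 2 / 8)%:E)%E.
    by apply: le_trans hs; under eq_integral do rewrite -sqrrN opprB.
  have H1 := density_hellinger2 p'0 (mp _ (ST _ Ss)) Pp' p0 (mp _ Tt) Pp hs.
  have H2 := density_hellinger2 p0 (mp _ Tt) Pp p'0 (mp _ (ST _ Ss)) Pp' hs'.
  have k0 : 0 < e / 4 by rewrite divr_gt0.
  have G1 := hellinger_set_gap (P s) (P t) mB k0.
  have G2 := hellinger_set_gap (P t) (P s) mB k0.
  have E x : x <= e ^+ 2 / 8 -> x / (2 * (e / 4)) <= e / 4.
    move=> xe; rewrite ler_pdivrMr ?mulr_gt0//; apply: (le_trans xe).
    by rewrite le_eqVlt; apply/orP; left; apply/eqP; field.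
  have := E _ H1; have := E _ H2; rewrite ltr_norml => *; apply/andP; split; lra.
have -> : (fun t => P (phi t) B) = (fun t => (fine (P (phi t) B))%:E).
  by apply/funext => t; rewrite fineK// fin_num_measure.
apply/measurable_EFinP; apply: continuous_measurable_rV; first exact: openT.
move=> t _.
exact: (@continuous_comp _ _ _ phi (fun s => fine (P s B)) t (cphi t) (cP _ (Sphi t))).
Qed.

End model_regularity.

Section liminf.
Context {R : realType}.

Lemma limf_einf_ge {T : choiceType} {X : filteredType T} (F : set_system X) (f : X -> \bar R) (a : \bar R) :
  (\forall x \near F, (a <= f x)%E) -> (a <= limf_einf f F)%E.
Proof.
move=> Fa; rewrite limf_einfE.
apply: (@le_trans _ _ (ereal_inf (f @` [set x | (a <= f x)%E]))).
  by apply: le_ereal_inf_tmp => _ [x /= ax <-].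
by apply: ereal_sup_ubound; exists [set x | (a <= f x)%E].
Qed.

Lemma liminf_scaled_ge (L : nat -> R -> \bar R) (V : R) :
  (forall e : R, 0 < e -> exists c0 : R, forall c, c0 <= c ->
     exists N, forall n, (N <= n)%N -> ((V - e)%:E <= n%:R%:E * L n c)%E) ->
  (V%:E <= liminf_scaled L)%E.
Proof.
move=> h; apply/lee_addgt0Pr => e e0; rewrite -leeBlDr// -EFinB.
have [c0 hc] := h _ e0.
apply: limf_einf_ge; exists c0; split; first exact: num_real.
move=> c /ltW /hc[N hN]; apply: limf_einf_ge.
by exists N => // n /= /hN.
Qed.

(** The local scale s = n^(-1/2) is eventually as small as one wants. *)
Lemma local_scale (r : R) : 0 < r -> exists N, forall n, (N <= n)%N ->
  [/\ (0 < n)%N, 0 < (Num.sqrt (n%:R : R))^-1 < r &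
      ((Num.sqrt (n%:R : R))^-1) ^+ 2 = n%:R^-1].
Proof.
move=> r0.
exists (Num.truncn (r ^- 2)).+1 => n hn.
have n0 : (0 < n)%N by exact: leq_trans hn.
have nr : 0 < n%:R :> R by rewrite ltr0n.
split => //; last by rewrite exprVn sqr_sqrtr// ltW.
rewrite invr_gt0 sqrtr_gt0 nr/= -[ltRHS]invrK ltf_pV2 ?posrE ?invr_gt0 ?sqrtr_gt0//.
rewrite -(ger0_norm (_ : 0 <= r^-1)) ?invr_ge0 ?(ltW r0)// -sqrtr_sqr ltr_sqrt//.
rewrite exprVn; apply: lt_le_trans (truncnS_gt _) _.
by rewrite ler_nat.
Qed.

End liminf.
Lemma bernoulli_ineq {R : realType} (u : R) n : 0 <= u <= 1 ->
  1 - n%:R * u <= (1 - u) ^+ n.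
Proof.
move=> /andP[u0 u1]; elim: n => [|n IH]; first by rewrite mul0r subr0 expr0.
rewrite exprS; apply: (@le_trans _ _ ((1 - u) * (1 - n%:R * u))).
  rewrite -subr_ge0 mulrSr.
  have -> : (1 - u) * (1 - n%:R * u) - (1 - (n%:R + 1) * u) = n%:R * (u * u) by ring.
  by rewrite !mulr_ge0.
by apply: ler_wpM2l => //; rewrite subr_ge0.
Qed.

Section local_asymptotics.
Context {R : realType} {d : nat} {dX : measure_display} {X : measurableType dX}.
Variables (nu : {sigma_finite_measure set X -> \bar R})
    (Theta : set 'rV[R]_d) (P : 'rV[R]_d -> probability X R)
    (p : 'rV[R]_d -> X -> R) (xi : 'rV[R]_d -> X -> 'rV[R]_d)
    (psi : 'rV[R]_d -> R) (theta0 : 'rV[R]_d).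
Hypothesis d_gt0 : (0 < d)%N.
Hypothesis P_density : has_density nu P Theta p.
Hypothesis P_hellinger : forall t, Theta t ->
       hellinger_differentiable nu Theta p t (xi t).
Hypothesis theta0_interior : (interior Theta) theta0.
Hypothesis I_invertible : fisher_information nu (xi theta0) \in unitmx.
Hypothesis psi_C1 : C1_at psi theta0.

Let I0 := fisher_information nu (xi theta0).
Let v := gradient psi theta0.
Let V := qform_inv v I0.
(* the least favourable direction *)
Let w := v *m invmx I0.

Let Theta0 : Theta theta0. Proof. exact: (interior_subset theta0_interior). Qed.

Lemma dotp_least_favourable : dotp v w = V.
Proof.
rewrite dotp_mx /V /qform_inv /w trmx_mul mulmxA.
have -> : v *m (invmx I0)^T *m v^T = (v *m invmx I0 *m v^T)^T.
  by rewrite !trmx_mul !trmxK mulmxA.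
by rewrite mxE.
Qed.

Lemma fisher_least_favourable : (w *m I0 *m w^T) 0 0 = V.
Proof.
rewrite -dotp_least_favourable dotp_mx /w -(mulmxA v) mulVmx ?mulmx1//.
Qed.

Lemma V_ge0 : 0 <= V.
Proof.
have [mxi ixi _] := P_hellinger Theta0.
have [_ h] := fisher_quadratic w mxi ixi.
rewrite -fisher_least_favourable /I0 -h mulr_ge0// Rintegral_ge0// => x _.
exact: sqr_ge0.
Qed.

Lemma w_neq0 : 0 < V -> w != 0.
Proof.
move=> V0; apply/eqP => w0; move: V0.
by rewrite -dotp_least_favourable w0 /dotp big1 ?ltxx// => i _; rewrite [X in _ * X]mxE mulr0.
Qed.

Let mp t : Theta t -> measurable_fun [set: X] (p t).
Proof. by move=> /P_density[]. Qed.

Lemma local_expansion (Z e : R) : 0 < Z -> 0 < e ->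
  exists2 r : R, 0 < r & forall s, 0 < s < r ->
  (forall z z', `|z| <= Z -> `|z'| <= Z ->
    affinity_ge (P (theta0 + (s * z) *: w)) (P (theta0 + (s * z') *: w))
      (1 - ((z - z') ^+ 2 * V / 4 + e) * s ^+ 2 / 2)) /\
  (forall z, `|z| <= Z ->
    `|psi (theta0 + (s * z) *: w) - psi theta0 - s * z * V| <= e * s).
Proof.
move=> Z0 e0.
have [r1 r10 h1] := hellinger_expansion w mp (P_hellinger Theta0) theta0_interior Z0 e0.
have [near_diff _] := psi_C1.
have dpsi : differentiable psi theta0 by exact: nbhs_singleton near_diff.
have nw : 0 < Z * (`|w| + 1) by rewrite mulr_gt0// ltr_wpDl.
have e1 : 0 < e / (Z * (`|w| + 1)) by rewrite divr_gt0.
have [r2 r20 h2] := differentiable_expansion dpsi e1.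
exists (Num.min r1 (r2 / (Z * (`|w| + 1)))).
  by rewrite lt_min r10 divr_gt0.
move=> s /andP[s0]; rewrite lt_min => /andP[sr1 sr2]; split.
  move=> z z' zZ z'Z.
  have s01 : 0 < s < r1 by rewrite s0.
  have [T1 T2 hh] := h1 s s01 z z' zZ z'Z.
  move: hh; rewrite fisher_least_favourable => hh.
  have [p1 m1 P1] := P_density T1; have [p2 m2 P2] := P_density T2.
  exact: (affinity_ge_density p1 m1 P1 p2 m2 P2 hh).
move=> z zZ.
have nz : `|(s * z) *: w| <= s * (Z * (`|w| + 1)).
  rewrite normrZ normrM (gtr0_norm s0) -mulrA ler_wpM2l ?(ltW s0)//.
  by rewrite ler_pM// lerDl.
have := h2 ((s * z) *: w); rewrite -/v dotpZr dotp_least_favourable => h.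
apply: (le_trans (h _)).
  by apply: le_lt_trans nz _; rewrite -ltr_pdivlMr.
apply: (le_trans (ler_wpM2l (ltW e1) nz)).
rewrite le_eqVlt; apply/orP; left; apply/eqP.
by field; apply/andP; split; rewrite gt_eqF// ltr_wpDl.
Qed.

Lemma regular_ball : exists2 r : R, 0 < r & forall t, eball theta0 r t ->
  Theta t /\ differentiable psi t.
Proof.
have [near_diff _] := psi_C1.
have : \forall t \near theta0, Theta t /\ differentiable psi t.
  by apply: filterS2 theta0_interior near_diff.
move=> /nbhs_normP[r /= r0 hr]; exists r => // t tr.
apply: hr => /=; rewrite distrC; exact: le_lt_trans (norm_le_enorm _) tr.
Qed.

Section chain_in_the_ball.
Variables (n : nat) (c r : R).
Hypothesis c0 : 0 < c.
Hypothesis n0 : (0 < n)%N.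
Hypothesis hr : forall t, eball theta0 r t -> Theta t /\ differentiable psi t.
Hypothesis cr : c / Num.sqrt n%:R <= r.
Let phi := ball_chart theta0 (c / Num.sqrt n%:R).

Let r0 : 0 < c / Num.sqrt n%:R.
Proof. by rewrite divr_gt0// sqrtr_gt0 ltr0n. Qed.

Let ballS t : local_ball theta0 n c t -> eball theta0 r t.
Proof. by move=> h; exact: lt_le_trans h cr. Qed.

Lemma chart_diffeomorphism : diffeomorphism (local_ball theta0 n c) phi.
Proof. exact: ball_chart_diffeomorphism. Qed.

Let phiS t : local_ball theta0 n c (phi t).
Proof. by have [g []] := chart_diffeomorphism. Qed.

Lemma chart_measurable_model B : measurable B ->
  measurable_fun [set: 'rV[R]_d] (fun t => P (phi t) B).
Proof.
apply: (measurable_model P_density P_hellinger (S := local_ball theta0 n c)).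
- exact: open_eball.
- by move=> t /ballS/hr[].
- exact: phiS.
- exact: ball_chart_continuous.
Qed.

Lemma chart_measurable_psi : measurable_fun [set: 'rV[R]_d] (psi \o phi).
Proof.
apply: continuous_measurable_rV; first exact: openT.
move=> t _; apply: (@continuous_comp _ _ _ phi psi).
  exact: ball_chart_continuous.
by apply: differentiable_continuous; have [] := hr (ballS (phiS t)).
Qed.

Lemma L2_L3_ge0 : (0 <= L2 P psi theta0 n c)%E /\ (0 <= L3 P psi theta0 n c)%E.
Proof.
split.
  exact: (L2_ge0 0 0 chart_diffeomorphism chart_measurable_model chart_measurable_psi).
exact: (L3_ge0 0 0 chart_diffeomorphism chart_measurable_model chart_measurable_psi).
Qed.

End chain_in_the_ball.

End local_asymptotics.
Lemma affinity_geW {d} {T : measurableType d} {R : realType}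
    (P P' : probability T R) (a b : R) :
  a <= b -> affinity_ge P P' b -> affinity_ge P P' a.
Proof.
move=> ab aff f m M mf m0 fmM; apply: le_trans (aff f m M mf m0 fmM).
by rewrite lee_fin ler_pM2l.
Qed.

Lemma near0_gt0 {R : realType} (Q : R -> Prop) :
  (\forall x \near (0 : R), Q x) -> exists x, [/\ 0 < x, x <= 1 & Q x].
Proof.
move=> /nbhs_normP[r /= r0 hr]; exists (Num.min 1 (r / 2)); split.
- by rewrite lt_min ltr01 divr_gt0.
- by rewrite ge_min lexx.
- apply: hr; rewrite /= sub0r normrN ger0_norm.
    by rewrite gt_min; apply/orP; right; rewrite ltr_pdivrMr// ltr_pMr// ltr1n.
  by rewrite le_min ler01 divr_ge0// ltW.
Qed.

Section chain_limit.
Context {R : realType}.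

Lemma chain_step_exists (V e : R) : 0 < V -> 0 < e -> exists x : R,
  [/\ 0 < x, x <= 1, 0 <= V - 2 * x * V - 2 * x ^+ 2 &
    V - e <= (Num.max 0 ((V - 2 * x * V - 2 * x ^+ 2) /
        Num.sqrt ((1 + 2 * x) ^+ 2 * V + 12 * x) -
        (x * V + 2 * x ^+ 2 * V + 2 * x ^+ 3))) ^+ 2].
Proof.
move=> V0 e0.
pose A (x : R) := V - 2 * x * V - 2 * x ^+ 2.
pose B (x : R) := (1 + 2 * x) ^+ 2 * V + 12 * x.
pose D (x : R) := x * V + 2 * x ^+ 2 * V + 2 * x ^+ 3.
have pc (q : {poly R}) : {for (0 : R), continuous (fun x => q.[x])}.
  exact: continuous_horner.
have cA : {for (0 : R), continuous A}.
  have -> : A = (fun x => (V%:P - (2 * V)%:P * 'X - 2%:P * 'X^2).[x]).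
    by apply/funext => x; rewrite !hornerE /A /=; ring.
  exact: pc.
have cB : {for (0 : R), continuous B}.
  have -> : B = (fun x => (V%:P + (4 * V + 12)%:P * 'X + (4 * V)%:P * 'X^2).[x]).
    by apply/funext => x; rewrite !hornerE /B /=; ring.
  exact: pc.
have cD : {for (0 : R), continuous D}.
  have -> : D = (fun x => (V%:P * 'X + (2 * V)%:P * 'X^2 + 2%:P * 'X^3).[x]).
    by apply/funext => x; rewrite !hornerE /D /=; ring.
  exact: pc.
have A0 : A 0 = V by rewrite /A; ring.
have B0 : B 0 = V by rewrite /B; ring.
have D0 : D 0 = 0 by rewrite /D; ring.
have csB : {for (0 : R), continuous (fun x => Num.sqrt (B x))}.
  by apply: (continuous_comp cB); exact: sqrt_continuous.
pose F x := A x / Num.sqrt (B x) - D x.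
have cF : {for (0 : R), continuous F}.
  apply: continuousB => //; apply: continuousM => //.
  apply: (continuousV _ csB).
  by rewrite B0 gt_eqF// sqrtr_gt0.
have F0 : F 0 = Num.sqrt V.
  rewrite /F A0 D0 B0 subr0.
  by rewrite -{1}(sqr_sqrtr (ltW V0)) expr2 mulfK// gt_eqF// sqrtr_gt0.
have cG : {for (0 : R), continuous (fun x => F x * F x)} by exact: continuousM.
have nF : \forall x \near (0 : R), 0 < F x.
  by apply: (cvgr_gt _ cF); rewrite F0 sqrtr_gt0.
have nA : \forall x \near (0 : R), 0 < A x.
  by apply: (cvgr_gt _ cA); rewrite A0.
have nG : \forall x \near (0 : R), V - e < F x * F x.
  apply: (cvgr_gt _ cG); rewrite F0 -expr2 sqr_sqrtr ?(ltW V0)//.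
  by rewrite gtrBl.
have [x [x0 x1 [Fx Ax Gx]]] : exists x, [/\ 0 < x, x <= 1 & [/\ 0 < F x, 0 < A x & V - e < F x * F x]].
  by apply: near0_gt0; apply: filterS3 nF nA nG.
exists x; split => //; first exact: ltW.
by rewrite -/(A x) -/(B x) -/(D x) -/(F x) (max_idPr (ltW Fx)) expr2 ltW.
Qed.

(* radial contraction of the k-th point of the chain *)
Lemma chart_coordinate (x q b : R) : 0 <= x -> 0 <= q -> x * q <= b ->
  x - b <= x / Num.sqrt (1 + q) <= x.
Proof.
move=> x0 q0 xqb.
have q1 : 0 < 1 + q by rewrite ltr_wpDr.
have s1 : 1 <= Num.sqrt (1 + q) by rewrite -[leLHS]sqrtr1 ler_wsqrtr// lerDl.
have s0 : 0 < Num.sqrt (1 + q) by exact: lt_le_trans s1.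
have s2 : Num.sqrt (1 + q) <= 1 + q.
  rewrite -[leRHS](sqr_sqrtr (ltW q1)) expr2 ler_peMl// ltW//.
apply/andP; split; last by rewrite ler_pdivrMr// ler_peMr.
apply: (@le_trans _ _ (x * (1 - q))); first by lra.
rewrite ler_wpM2l//.
rewrite -[leRHS]mul1r ler_pdivlMr//.
have [q1'|q1'] := leP q 1.
  apply: (@le_trans _ _ ((1 - q) * (1 + q))).
    by rewrite ler_wpM2l// subr_ge0.
  by have := sqr_ge0 q; rewrite expr2; lra.
apply: (@le_trans _ _ 0) => //; apply: mulr_le0_ge0; last exact: ltW.
by rewrite subr_le0 ltW.
Qed.

End chain_limit.

Lemma L2_L3_asymptotics {R : realType} {d : nat} {dX : measure_display}
    {X : measurableType dX} (nu : {sigma_finite_measure set X -> \bar R})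
    (Theta : set 'rV[R]_d) (P : 'rV[R]_d -> probability X R)
    (p : 'rV[R]_d -> X -> R) (xi : 'rV[R]_d -> X -> 'rV[R]_d)
    (psi : 'rV[R]_d -> R) (theta0 : 'rV[R]_d) (e0 : R) :
  has_density nu P Theta p ->
  (forall t, Theta t -> hellinger_differentiable nu Theta p t (xi t)) ->
  (interior Theta) theta0 ->
  fisher_information nu (xi theta0) \in unitmx ->
  C1_at psi theta0 ->
  let V := qform_inv (gradient psi theta0) (fisher_information nu (xi theta0)) in
  0 < e0 -> exists c0 : R, forall c, c0 <= c ->
  exists N, forall n, (N <= n)%N ->
  ((V - e0)%:E <= n%:R%:E * L2 P psi theta0 n c)%E /\
  ((V - e0)%:E <= n%:R%:E * L3 P psi theta0 n c)%E.
Proof.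
move=> P_density P_hellinger theta0_interior I_invertible psi_C1 V.
pose w := gradient psi theta0 *m invmx (fisher_information nu (xi theta0)).
move=> e00.
have [r' r'0 hr'] := regular_ball theta0_interior psi_C1.
have V0 : 0 <= V by exact: (V_ge0 psi P_hellinger theta0_interior I_invertible).
have inball N c n : 0 < c -> (N <= n)%N ->
   (forall m, (N <= m)%N -> [/\ (0 < m)%N, 0 < (Num.sqrt (m%:R : R))^-1 < r' / c &
      ((Num.sqrt (m%:R : R))^-1) ^+ 2 = m%:R^-1]) -> c / Num.sqrt n%:R <= r'.
  move=> c0 /[swap]/[apply] -[_ /andP[_ h] _].
  by rewrite -ler_pdivlMl// mulrC ltW.
move: V0; rewrite le_eqVlt => /orP[/eqP V0|V0].
  exists 1 => c c1.
  have c0 : 0 < c by exact: lt_le_trans c1.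
  have [N hN] := local_scale (divr_gt0 r'0 c0).
  exists N => n nN; have [n0 _ _] := hN n nN.
  have [h2 h3] := L2_L3_ge0 P_density P_hellinger c0 n0 hr' (inball N c n c0 nN hN).
  rewrite -V0 sub0r; split.
    apply: (@le_trans _ _ 0%E); first by rewrite lee_fin oppr_le0 ltW.
    by rewrite mule_ge0.
  apply: (@le_trans _ _ 0%E); first by rewrite lee_fin oppr_le0 ltW.
  by rewrite mule_ge0.
have [x [x0 x1 Ax Fx]] := chain_step_exists V0 e00.
pose K := Num.truncn (x ^- 3).
have Kx : K.+1%:R^-1 <= x ^+ 3.
  rewrite -[leRHS]invrK lef_pV2 ?posrE ?invr_gt0 ?exprn_gt0//.
  by rewrite ltW// truncnS_gt.
pose W := dotp w w.
have W0 : 0 <= W by exact: dotp_ge0.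
pose Z := K.+2%:R * x.
have Z0 : 0 < Z by rewrite mulr_gt0.
have x30 : 0 < x ^+ 3 by rewrite exprn_gt0.
have [r r0 hr] := local_expansion P_density P_hellinger theta0_interior I_invertible psi_C1 Z0 x30.
exists (1 + Z ^+ 3 * W / x ^+ 2) => c hc.
have c1 : 1 <= c.
  by apply: le_trans hc; rewrite lerDl divr_ge0 ?mulr_ge0 ?exprn_ge0// ltW.
have c0 : 0 < c by exact: lt_le_trans c1.
have cW : Z ^+ 3 * W / c ^+ 2 <= x ^+ 2.
  rewrite ler_pdivrMr ?exprn_gt0// [leRHS]mulrC -ler_pdivrMr ?exprn_gt0//.
  apply: (@le_trans _ _ c); last by rewrite expr2 ler_peMl// ltW.
  by apply: le_trans hc; rewrite lerDr.
pose y := (x + 2 * x ^+ 2) ^+ 2 * V / 4 + x ^+ 3.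
have y0 : 0 <= y.
  by rewrite addr_ge0 ?exprn_ge0 ?(ltW x0)// divr_ge0// mulr_ge0 ?sqr_ge0// ltW.
have y1 : 0 < 1 / (y + 1) by rewrite divr_gt0// ltr_wpDl.
have m0 : 0 < Num.min r (Num.min (r' / c) (1 / (y + 1))).
  by rewrite !lt_min r0 y1 divr_gt0.
have [N hN] := local_scale m0.
exists N => n nN; have [n0 /andP[s0]] := hN n nN.
rewrite !lt_min => /and3P[sr sr' sy] s2.
pose s := (Num.sqrt (n%:R : R))^-1.
rewrite -/s in s0 sr sr' sy s2.
have ssr : 0 < s < r by rewrite s0.
have [haff hpsi] := hr s ssr.
have cr : c / Num.sqrt n%:R <= r' by rewrite -ler_pdivlMl// mulrC ltW.
have ys : y * s ^+ 2 <= 1.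
  have s1 : s <= 1.
    apply: (le_trans (ltW sy)); rewrite ler_pdivrMr ?ltr_wpDl// mul1r lerDr//.
  apply: (@le_trans _ _ (y * s)).
    by rewrite ler_wpM2l// expr2 ler_piMl// ltW.
  apply: (@le_trans _ _ ((y + 1) * s)); first by rewrite ler_wpM2r ?lerDl// ltW.
  by rewrite mulrC -ler_pdivlMr ?ltr_wpDl// ltW.
pose phi := ball_chart theta0 (c / Num.sqrt n%:R).
pose h := (x / c) *: w.
pose z (k : nat) := k%:R * x / Num.sqrt (1 + (k%:R * x / c) ^+ 2 * W).
have phiE k : phi (k%:R *: h) = theta0 + (s * z k) *: w.
  rewrite /phi /h scalerA ball_chart_line; congr (_ + _ *: _).
  rewrite /z /s -/W -(mulrA k%:R x c^-1); field.
  by rewrite !gt_eqF ?sqrtr_gt0 ?ltr0n// ltr_wpDr// mulr_ge0// sqr_ge0.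
have zb k : (k <= K.+2)%N -> k%:R * x - x ^+ 2 <= z k <= k%:R * x.
  move=> kK; apply: chart_coordinate.
  - by rewrite mulr_ge0// ltW.
  - by rewrite mulr_ge0// sqr_ge0.
  - apply: le_trans cW.
    rewrite exprMn exprVn (_ : _ * _ = (k%:R * x) ^+ 3 * W / c ^+ 2); last by ring.
    rewrite ler_wpM2r ?invr_ge0 ?sqr_ge0// ler_wpM2r//.
    rewrite lerXn2r ?nnegrE ?mulr_ge0 ?(ltW x0) ?(ltW Z0)//.
    by rewrite ler_wpM2r ?ler_nat// ltW.
have z0 k : 0 <= z k by rewrite divr_ge0 ?sqrtr_ge0// mulr_ge0// ltW.
have zZ k : (k <= K.+2)%N -> `|z k| <= Z.
  move=> kK; rewrite ger0_norm//; have /andP[_ h2] := zb k kK.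
  by apply: (le_trans h2); rewrite ler_wpM2r ?ler_nat// ltW.
have zd k : (k <= K.+1)%N -> x - x ^+ 2 <= z k.+1 - z k <= x + x ^+ 2.
  move=> kK; have /andP[a1 a2] := zb k (leqW kK); have /andP[b1 b2] := zb k.+1 kK.
  by rewrite mulrSr in b1 b2; apply/andP; split; clear - a1 a2 b1 b2; lra.
pose a := 1 - y * s ^+ 2 / 2.
have a0 : 0 <= a by rewrite /a; clear - ys; lra.
have ysge : 0 <= y * s ^+ 2 by rewrite mulr_ge0 ?sqr_ge0.
have aff k : (k < K)%N ->
    affinity_ge (P (phi (k.+1%:R *: h))) (P (phi (k.+2%:R *: h))) a.
  move=> kK; rewrite !phiE.
  have k1 : (k.+1 <= K.+2)%N by rewrite ltnS leqW// ltnW.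
  have k2 : (k.+2 <= K.+2)%N by rewrite !ltnS ltnW.
  apply: affinity_geW (haff _ _ (zZ _ k1) (zZ _ k2)).
  rewrite /a lerD2l lerN2 ler_pM2r// ler_wpM2r ?sqr_ge0// lerD2r.
  rewrite ler_pM2r// ler_wpM2r ?(ltW V0)//.
  rewrite -sqrrN opprB; have /andP[b1 b2] := zd k.+1 (ltnW kK).
  have x20 : 0 <= x ^+ 2 by exact: sqr_ge0.
  have xx : x ^+ 2 <= x by rewrite expr2 ler_piMl// ltW.
  by rewrite lerXn2r ?nnegrE//; clear - b1 b2 x20 xx x0; lra.
pose d1 := s * (x * V - 2 * x ^+ 2 * V - 2 * x ^+ 3).
pose d2 := s * (x * V + 2 * x ^+ 2 * V + 2 * x ^+ 3).
have d10 : 0 <= d1.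
  rewrite mulr_ge0 ?(ltW s0)// (_ : _ - _ = x * (V - 2 * x * V - 2 * x ^+ 2)); last by ring.
  by rewrite mulr_ge0// ltW.
have incr k : (k <= K)%N ->
  d1 <= psi (phi (k.+1%:R *: h)) - psi (phi (k%:R *: h)) <= d2.
  move=> kK; rewrite !phiE.
  have k1 : (k <= K.+2)%N by rewrite leqW// leqW.
  have k2 : (k.+1 <= K.+2)%N by rewrite ltnS leqW.
  have := hpsi _ (zZ _ k1); have := hpsi _ (zZ _ k2); rewrite !ler_norml -/V.
  move: (psi (_ + (s * z k) *: _)) (psi (_ + (s * z k.+1) *: _)) => A B /andP[B1 B2] /andP[A1 A2].
  have /andP[b1 b2] := zd k (leqW kK).
  have x20 : 0 <= x ^+ 2 by exact: sqr_ge0.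
  have t1 : s * (x - 2 * x ^+ 2) * V <= s * (z k.+1 - z k) * V.
    by rewrite ler_pM2r// ler_pM2l//; clear - b1 b2 x20; lra.
  have t2 : s * (z k.+1 - z k) * V <= s * (x + 2 * x ^+ 2) * V.
    by rewrite ler_pM2r// ler_pM2l//; clear - b1 b2 x20; lra.
  by rewrite /d1 /d2; apply/andP; split; clear - A1 A2 B1 B2 t1 t2; lra.
have hn0 : h != 0.
  by rewrite scaler_eq0 mulf_eq0 invr_eq0 !gt_eqF//=; exact: w_neq0.
have df := chart_diffeomorphism theta0 c0 n0.
have mP := chart_measurable_model P_density P_hellinger c0 n0 hr' cr.
have mpsi := chart_measurable_psi c0 n0 hr' cr.
have HH := chain_hellinger2 n hn0 a0 aff.
have B2 := L2_ge_chain df mP mpsi hn0 a0 aff d10 incr.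
have B3 := L3_ge_chain df mP mpsi hn0 a0 aff d10 incr.
have /andP[h0 hH] := HH; have H0 := lt_le_trans h0 hH.
move: B2 B3 H0; set H := 2 - 2 * _ => B2 B3 H0.
have Hb : 4 * H <= x ^+ 2 * ((1 + 2 * x) ^+ 2 * V + 12 * x).
  have aN : 0 <= a <= 1 by rewrite a0 /a; clear - ysge; lra.
  have u01 : 0 <= y * s ^+ 2 / 2 <= 1 by rewrite divr_ge0//=; clear - ys; lra.
  have bern := bernoulli_ineq n u01.
  have nn : n%:R * (y * s ^+ 2 / 2) = y / 2.
    rewrite s2; field; by rewrite pnatr_eq0 -lt0n.
  rewrite nn -/a in bern.
  have an1 : a ^+ n <= 1 by rewrite exprn_ile1//; case/andP : aN.
  have an0 : 0 <= a ^+ n by rewrite exprn_ge0.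
  have KK : K%:R / K.+1%:R = 1 - K.+1%:R^-1 :> R.
    by rewrite mulrSr; field; rewrite -mulrSr pnatr_eq0.
  have : a ^+ n * K.+1%:R^-1 <= x ^+ 3.
    by apply: (le_trans _ Kx); rewrite ler_piMl.
  rewrite /H KK mulrBl mul1r -(mulrC (a ^+ n)) => h4.
  rewrite (_ : x ^+ 2 * _ = 4 * y + 8 * x ^+ 3); last by rewrite /y; field.
  by move: bern h4; move: (a ^+ n) (K.+1%:R^-1) => A B bern h4; clear - bern h4; lra.
have fin : V - e0 <= n%:R * (Num.max 0 (d1 / Num.sqrt (4 * H) - d2)) ^+ 2.
  apply: (le_trans Fx).
  have nE : n%:R = s^-1 ^+ 2 by rewrite exprVn s2 invrK.
  rewrite nE -exprMn.
  have si0 : 0 <= s^-1 by rewrite invr_ge0 ltW.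
  rewrite maxr_pMr// mulr0.
  have pm u : 0 <= Num.max 0 u :> R by rewrite le_max lexx.
  rewrite lerXn2r ?nnegrE ?pm// ge_max pm/= le_max; apply/orP; right.
  have sn0 : s != 0 by rewrite gt_eqF.
  have sH0 : 0 < Num.sqrt (4 * H) by rewrite sqrtr_gt0 mulr_gt0.
  pose G := V - 2 * x * V - 2 * x ^+ 2.
  pose T := (1 + 2 * x) ^+ 2 * V + 12 * x.
  have -> : s^-1 * (d1 / Num.sqrt (4 * H) - d2) =
      x * G / Num.sqrt (4 * H) - (x * V + 2 * x ^+ 2 * V + 2 * x ^+ 3).
    by rewrite /d1 /d2 /G; field; rewrite sn0 gt_eqF.
  apply: lerB => //; rewrite -/G -/T.
  have T0 : 0 < T.
    apply: addr_gt0; last by rewrite mulr_gt0.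
    by apply: mulr_gt0 => //; apply: exprn_gt0; rewrite addr_gt0// mulr_gt0.
  have sH : Num.sqrt (4 * H) <= x * Num.sqrt T.
    rewrite -{1}(ger0_norm (ltW x0)) -sqrtr_sqr -sqrtrM ?sqr_ge0//.
    by rewrite ler_wsqrtr.
  rewrite ler_pdivrMr ?sqrtr_gt0// mulrAC ler_pdivlMr//.
  rewrite (_ : x * G * _ = G * (x * Num.sqrt T)); last by ring.
  exact: ler_wpM2l.
by split; [apply: (le_trans _ (lee_wpmul2l _ B2))|apply: (le_trans _ (lee_wpmul2l _ B3))];
  rewrite ?lee_fin// -EFinM lee_fin.
Qed.
Lemma exp_le_power {R : realType} (y e s : R) n : (0 < n)%N ->
  s ^+ 2 = n%:R^-1 -> 0 <= y -> 0 < e -> s ^+ 2 * y * (y + e) <= e ->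
  0 <= 1 - y * s ^+ 2 /\ expR (- (y + e)) <= (1 - y * s ^+ 2) ^+ n.
Proof.
move=> n0 s2 y0 e0 small.
set q := s ^+ 2; have q0 : 0 <= q by rewrite /q sqr_ge0.
have ye : 0 < y + e by rewrite ltr_wpDl.
have pos : 0 < 1 + (y + e) * q by rewrite ltr_wpDr// mulr_ge0// ltW.
have key : 1 <= (1 - y * q) * (1 + (y + e) * q).
  rewrite -subr_ge0 (_ : _ - 1 = q * (e - q * y * (y + e))); last by ring.
  by rewrite mulr_ge0// subr_ge0.
have p1 : 0 < 1 - y * q.
  by rewrite -(pmulr_lgt0 _ pos); exact: lt_le_trans key.
have lb : expR (- ((y + e) * q)) <= 1 - y * q.
  rewrite expRN -[leRHS]invrK lef_pV2 ?posrE ?expR_gt0 ?invr_gt0//.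
  apply: le_trans (expR_ge1Dx _).
  by rewrite -div1r ler_pdivrMr// mulrC.
have a0 : 0 <= 1 - y * q by apply: le_trans lb; rewrite expR_ge0.
split => //.
have -> : expR (- (y + e)) = expR (- ((y + e) * q)) ^+ n.
  rewrite -expRM_natl; congr expR; rewrite /q s2; field.
  by rewrite pnatr_eq0 -lt0n.
by rewrite lerXn2r ?nnegrE ?expR_ge0.
Qed.

Lemma L4_ge0 {R : realType} {d : nat} {dX : measure_display}
    {X : measurableType dX} (P : 'rV[R]_d -> probability X R)
    (psi : 'rV[R]_d -> R) (theta0 : 'rV[R]_d) (n : nat) (c : R) :
  (0 < n)%N -> 0 < c -> (0 <= L4 P psi theta0 n c)%E.
Proof.
move=> n0 c0.
have S0 : local_ball theta0 n c theta0.
  rewrite /local_ball /eball /= subrr -(scale0r 0) enormZ normr0 mul0r.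
  by rewrite divr_gt0// sqrtr_gt0 ltr0n.
set L := L4 _ _ _ _ _.
pose z := Num.max 0
   ((1 - hellinger2 (tuple_probability (P theta0) n) (tuple_probability (P theta0) n)) / 4)
  * `|psi theta0 - psi theta0| ^+ 2.
apply: (@le_trans _ _ z%:E).
  by rewrite lee_fin mulr_ge0 ?sqr_ge0// le_max lexx.
by apply: ereal_sup_ubound; exists theta0, theta0.
Qed.

Lemma L4_asymptotics {R : realType} {d : nat} {dX : measure_display}
    {X : measurableType dX} (nu : {sigma_finite_measure set X -> \bar R})
    (Theta : set 'rV[R]_d) (P : 'rV[R]_d -> probability X R)
    (p : 'rV[R]_d -> X -> R) (xi : 'rV[R]_d -> X -> 'rV[R]_d)
    (psi : 'rV[R]_d -> R) (theta0 : 'rV[R]_d) (u e0 : R) :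
  has_density nu P Theta p ->
  (forall t, Theta t -> hellinger_differentiable nu Theta p t (xi t)) ->
  (interior Theta) theta0 ->
  fisher_information nu (xi theta0) \in unitmx ->
  C1_at psi theta0 ->
  let V := qform_inv (gradient psi theta0) (fisher_information nu (xi theta0)) in
  0 <= u -> 0 < e0 -> exists c0 : R, forall c, c0 <= c ->
  exists N, forall n, (N <= n)%N ->
  ((V * (u ^+ 2 * (expR (- (u ^+ 2 / 8)) / 2 - 1 / 4)) - e0)%:E <=
     n%:R%:E * L4 P psi theta0 n c)%E.
Proof.
move=> P_density P_hellinger theta0_interior I_invertible psi_C1 V.
move=> u0 e00.
set f := u ^+ 2 * _.
have V0 : 0 <= V by exact: (V_ge0 psi P_hellinger theta0_interior I_invertible).
have [triv|pos] := leP (V * f - e0) 0.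
  exists 1 => c c1; exists 1%N => n n1.
  apply: (@le_trans _ _ 0%E); first by rewrite lee_fin.
  by rewrite mule_ge0// L4_ge0// (lt_le_trans _ c1).
have V1 : 0 < V.
  rewrite lt_neqAle V0 andbT; apply/eqP => V00.
  by move: pos; rewrite -V00 mul0r sub0r oppr_gt0 => /lt_trans/(_ e00); rewrite ltxx.
have u1 : 0 < u.
  rewrite lt_neqAle u0 andbT; apply/eqP => u00.
  move: pos; rewrite /f -u00 expr0n/= mul0r mulr0 sub0r oppr_gt0 => /lt_trans/(_ e00).
  by rewrite ltxx.
pose z := u / Num.sqrt V.
have sV : 0 < Num.sqrt V by rewrite sqrtr_gt0.
have z0 : 0 < z by rewrite divr_gt0.
have zV : z ^+ 2 * V = u ^+ 2.
  by rewrite /z exprMn exprVn sqr_sqrtr// divfK// gt_eqF.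
pose E (e : R) := expR (- (u ^+ 2 / 8 + 3 / 2 * e)) / 2 - 1 / 4.
pose g (e : R) := E e * ((z * V - e) * (z * V - e)).
have ca : {for (0 : R), continuous (fun e : R => z * V - e)}.
  by apply: continuousB; [exact: cvg_cst|exact: cvg_id].
have cE : {for (0 : R), continuous E}.
  apply: continuousB; last exact: cvg_cst.
  apply: continuousM; last exact: cvg_cst.
  apply: (@continuous_comp _ _ _ (fun e : R => - (u ^+ 2 / 8 + 3 / 2 * e)) expR).
    apply: continuousN; apply: continuousD; first exact: cvg_cst.
    by apply: continuousM; [exact: cvg_cst|exact: cvg_id].
  exact: continuous_expR.
have cg : {for (0 : R), continuous g}.
  by apply: continuousM => //; exact: continuousM.
have g0 : g 0 = V * f.
  rewrite /g /E /f mulr0 addr0 subr0 -zV; ring.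
have ng : \forall e \near (0 : R), V * f - e0 < g e.
  by apply: (cvgr_gt _ cg); rewrite g0 gtrBl.
have nz : \forall e \near (0 : R), 0 < z * V - e.
  by apply: (cvgr_gt _ ca); rewrite subr0 mulr_gt0.
have [e [e1 _ [ge ze]]] : exists e, [/\ 0 < e, e <= 1 & V * f - e0 < g e /\ 0 < z * V - e].
  by apply: near0_gt0; apply: filterS2 ng nz.
have E0 : 0 < E e.
  have : 0 < g e by exact: lt_trans ge.
  by rewrite /g pmulr_lgt0// mulr_gt0.
have [r r0 hr] := local_expansion P_density P_hellinger theta0_interior I_invertible psi_C1 z0 e1.
pose w := gradient psi theta0 *m invmx (fisher_information nu (xi theta0)).
exists (z * enorm w + 1) => c hc.
have zw : z * enorm w < c by apply: lt_le_trans hc; rewrite ltrDl.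
have c0 : 0 < c by apply: le_lt_trans zw; rewrite mulr_ge0 ?enorm_ge0// ltW.
pose y := (u ^+ 2 / 4 + e) / 2.
have y0 : 0 <= y by rewrite divr_ge0// addr_ge0 ?divr_ge0 ?sqr_ge0// ltW.
pose b := e / (y * (y + e) + 1).
have yye : 0 <= y * (y + e) by rewrite mulr_ge0// addr_ge0// ltW.
have b0 : 0 < b by rewrite divr_gt0// ltr_wpDl.
have m0 : 0 < Num.min r (Num.min 1 b) by rewrite !lt_min r0 b0 ltr01.
have [N hN] := local_scale m0.
exists N => n nN; have [n0 /andP[s0]] := hN n nN.
rewrite !lt_min => /and3P[sr s1 sb] s2.
pose s := (Num.sqrt (n%:R : R))^-1.
rewrite -/s in s0 sr s1 sb s2.
have ssr : 0 < s < r by rewrite s0.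
have [haff hpsi] := hr s ssr.
have n00 : (n%:R : R) != 0 by rewrite pnatr_eq0 -lt0n.
have z00 : `|0 : R| <= z by rewrite normr0 ltW.
have zz : `|z| <= z by rewrite ger0_norm// ltW.
have := haff z 0 zz z00; have := hpsi z zz; have := hpsi 0 z00.
rewrite mulr0 scale0r addr0 subrr mul0r subr0 normr0 subr0 -/V => _ hp.
rewrite zV (_ : 1 - _ = 1 - y * s ^+ 2); last by rewrite /y; ring.
move=> aff.
have small : s ^+ 2 * y * (y + e) <= e.
  rewrite -mulrA; apply: (@le_trans _ _ (s * (y * (y + e) + 1))).
    rewrite expr2 -mulrA ler_wpM2l ?(ltW s0)//.
    apply: (@le_trans _ _ (y * (y + e))); last by rewrite lerDl.
    by rewrite ler_piMl// ltW.
  by rewrite -ler_pdivlMr ?ltr_wpDl// ltW.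
have [a0 an] := exp_le_power n0 s2 y0 e1 small.
have hell := affinity_ge_hellinger2 (affinity_ge_tuple (n := n) aff a0).
set t1 := theta0 + (s * z) *: w in hp hell *.
have t1S : local_ball theta0 n c t1.
  rewrite /local_ball /eball /= /t1 addrC addKr enormZ normrM !gtr0_norm//.
  by rewrite -mulrA mulrC ltr_pM2r.
have t0S : local_ball theta0 n c theta0.
  rewrite /local_ball /eball /= subrr -(scale0r 0) enormZ normr0 mul0r.
  by rewrite mulr_gt0.
pose H := hellinger2 (tuple_probability (P t1) n) (tuple_probability (P theta0) n).
pose val := Num.max 0 ((1 - H) / 4) * `|psi t1 - psi theta0| ^+ 2.
have : (val%:E <= L4 P psi theta0 n c)%E.
  by apply: ereal_sup_ubound; exists t1, theta0.
have nn : (0 <= n%:R%:E :> \bar R)%E by rewrite lee_fin.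
move=> /(lee_wpmul2l nn); apply: le_trans.
rewrite -EFinM lee_fin (le_trans (ltW ge))//.
have HE : E e <= Num.max 0 ((1 - H) / 4).
  rewrite le_max; apply/orP; right.
  have -> : E e = expR (- (y + e)) / 2 - 1 / 4.
    by rewrite /E /y; do 3 f_equal; field.
  move: hell an; rewrite -/H; move: (expR _) (_ ^+ n) (H); clear; move=> A B C; lra.
have dpsi : (z * V - e) * (z * V - e) <= n%:R * `|psi t1 - psi theta0| ^+ 2.
  have -> : (z * V - e) * (z * V - e) = n%:R * (s * (z * V - e)) ^+ 2.
    by rewrite exprMn s2; field.
  rewrite ler_wpM2l// real_normK ?num_real//.
  have sp : 0 <= s * (z * V - e) by rewrite mulr_ge0 ?ltW.
  have le1 : s * (z * V - e) <= psi t1 - psi theta0.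
    move: hp; rewrite ler_norml => /andP[h _]; move: h; clear; lra.
  by rewrite lerXn2r ?nnegrE// (le_trans sp).
rewrite /g /val [leRHS]mulrCA; apply: ler_pM => //; first exact: ltW.
by rewrite mulr_ge0 ?ltW.
Qed.
Lemma minimax_step_exists {R : realType} (V e : R) : 0 < V -> 0 < e ->
  exists x : R, [/\ 0 < x, x <= 1 &
    (V - e) * (2^-1 + 5 / 4 * x) <=
    V / 2 - 3 * x - 2 * x ^+ 4 - x * (x + 1) * (V + 2 * x ^+ 2) ^+ 2 / 4].
Proof.
move=> V0 e0.
pose q : {poly R} := (V / 2)%:P - 3%:P * 'X - 2%:P * 'X^4
   - 'X * ('X + 1) * (V%:P + 2%:P * 'X^2) ^+ 2 * (4^-1)%:P
   - (V - e)%:P * (2^-1%:P + (5 / 4)%:P * 'X).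
have qE x : q.[x] = V / 2 - 3 * x - 2 * x ^+ 4 - x * (x + 1) * (V + 2 * x ^+ 2) ^+ 2 / 4
   - (V - e) * (2^-1 + 5 / 4 * x).
  by rewrite /q !hornerE /=.
have q0 : 0 < q.[0].
  rewrite qE (_ : _ - _ = e / 2); first by rewrite divr_gt0.
  by field.
have nq : \forall x \near (0 : R), 0 < q.[x].
  exact: (cvgr_gt _ (@continuous_horner _ q 0)).
have [x [x0 x1 qx]] := near0_gt0 nq.
by exists x; split => //; rewrite -subr_ge0 -qE ltW.
Qed.

Lemma minimax_risk_ge0 {R : realType} {d : nat} {dX : measure_display}
    {X : measurableType dX} (P : 'rV[R]_d -> probability X R)
    (psi : 'rV[R]_d -> R) (theta0 : 'rV[R]_d) (n : nat) (c : R) :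
  (0 < n)%N -> 0 < c -> (0 <= minimax_risk P psi theta0 n c)%E.
Proof.
move=> n0 c0.
have S0 : local_ball theta0 n c theta0.
  rewrite /local_ball /eball /= subrr -(scale0r 0) enormZ normr0 mul0r.
  by rewrite divr_gt0// sqrtr_gt0 ltr0n.
apply: le_ereal_inf_tmp => _ [T _ <-].
apply: (@le_trans _ _ (\int[tuple_probability (P theta0) n]_x (`|T x - psi theta0| ^+ 2)%:E)%E).
  by apply: integral_ge0 => x _; rewrite lee_fin sqr_ge0.
by apply: ereal_sup_ubound; exists theta0.
Qed.

(** One step of the chain: comparing the means of T - psi_k under two
    neighbouring laws. *)
Lemma chain_step_gap {R : realType} {dT : measure_display}
    {T : measurableType dT} (P P' : probability T R) (t : T -> R)
    (a a' r x k : R) :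
  measurable_fun [set: T] t -> 0 < k -> 0 < x -> 0 <= r ->
  (\int[P]_y ((t y - a) ^+ 2)%:E <= r%:E)%E ->
  (\int[P']_y ((t y - a') ^+ 2)%:E <= r%:E)%E ->
  (\int[P']_y (t y - a') - \int[P]_y (t y - a)) + (a' - a) <=
  k * ((2 + x) * r + (1 + x^-1) * (a' - a) ^+ 2) + hellinger2 P' P / (2 * k).
Proof.
move=> mt k0 x0 r0 h h'.
have xi0 : 0 < x^-1 by rewrite invr_gt0.
have mf b : measurable_fun setT (fun y => t y - b) by exact: measurable_funB.
have lt1 : (\int[P]_y ((t y - a) ^+ 2)%:E < +oo)%E by exact: le_lt_trans h (ltry _).
have lt2 : (\int[P']_y ((t y - a') ^+ 2)%:E < +oo)%E by exact: le_lt_trans h' (ltry _).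
have [i1 j1] := square_integrable (mf a) lt1.
have [i2 j2] := square_integrable (mf a') lt2.
have cross : (\int[P']_y ((t y - a) ^+ 2)%:E <=
    ((1 + x) * r + (1 + x^-1) * (a' - a) ^+ 2)%:E)%E.
  apply: (@le_trans _ _ (\int[P']_y ((1 + x) * (t y - a') ^+ 2 + (1 + x^-1) * (a' - a) ^+ 2)%:E)%E).
    apply: ge0_le_integralT.
    - by move=> y; rewrite lee_fin sqr_ge0.
    - by apply/measurable_EFinP/measurable_funX.
    - apply/measurable_EFinP; apply: measurable_funD => //.
      by apply: measurable_funM => //; exact: measurable_funX.
    move=> y; rewrite lee_fin.
    rewrite (_ : t y - a = (t y - a') + (a' - a)); last by rewrite addrA subrK.
    move: (t y - a') (a' - a) => A B; rewrite -subr_ge0.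
    have xn0 : x != 0 by rewrite gt_eqF.
    rewrite (_ : _ - _ = x * (A - B / x) ^+ 2); last by field.
    by rewrite mulr_ge0 ?sqr_ge0// ltW.
  under eq_integral do rewrite EFinD EFinM.
  rewrite ge0_integralD//; last 3 first.
  - by move=> y _; rewrite -EFinM lee_fin mulr_ge0 ?sqr_ge0// addr_ge0// ltW.
  - by apply/measurable_EFinP; apply: measurable_funM => //; exact: measurable_funX.
  - by move=> y _; rewrite lee_fin mulr_ge0 ?sqr_ge0// addr_ge0// ltW.
  rewrite integral_cst// [X in (_ * X)%E]probability_setT mule1.
  rewrite ge0_integralZl//; last 3 first.
  - by apply/measurable_EFinP; exact: measurable_funX.
  - by move=> y _; rewrite lee_fin sqr_ge0.
  - by rewrite lee_fin addr_ge0// ltW.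
  rewrite [in leRHS]EFinD leeD2r// EFinM.
  by apply: lee_wpmul2l => //; rewrite lee_fin addr_ge0// ltW.
have lt3 : (\int[P']_y ((t y - a) ^+ 2)%:E < +oo)%E by exact: le_lt_trans cross (ltry _).
have [i3 j3] := square_integrable (mf a) lt3.
have rle (Q : probability T R) b u : Q.-integrable [set: T] (fun y => ((t y - b) ^+ 2)%:E) ->
    (\int[Q]_y ((t y - b) ^+ 2)%:E <= u%:E)%E -> \int[Q]_y ((t y - b) ^+ 2) <= u.
  by move=> i le; rewrite -lee_fin /Rintegral fineK//; exact: integrable_fin_num.
have gap := hellinger_mean_gap (mf a) k0 lt3 lt1.
have mean : \int[P']_y (t y - a) = \int[P']_y (t y - a') + (a' - a).
  transitivity (\int[P']_y ((t y - a') + (a' - a))).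
    by apply: eq_Rintegral => y _; rewrite addrA subrK.
  rewrite RintegralD//; last exact: finite_measure_integrable_cst.
  by rewrite Rintegral_cst// [X in fine X]probability_setT mulr1.
rewrite mean in gap.
rewrite addrAC; apply: (le_trans gap); rewrite lerD2r ler_wpM2l ?(ltW k0)//.
have := rle _ _ _ i3 cross; have := rle _ _ _ i1 h; clear; lra.
Qed.

Lemma mean_le_risk {R : realType} {dT : measure_display}
    {T : measurableType dT} (P : probability T R) (t : T -> R) (r s : R) :
  measurable_fun [set: T] t -> 0 < s -> (\int[P]_y (t y ^+ 2)%:E <= r%:E)%E ->
  `|\int[P]_y t y| <= (r / s + s) / 2.
Proof.
move=> mt s0 h.
have [i2 i1] := square_integrable mt (le_lt_trans h (ltry _)).
apply: (le_trans (le_normr_Rintegral measurableT i1)).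
have si : s^-1 != 0 by rewrite invr_eq0 gt_eqF.
have i3 : P.-integrable [set: T] (fun y => ((2 * s)^-1 * t y ^+ 2)%:E).
  exact: integrable_realZ.
have i4 : P.-integrable [set: T] (fun=> (s / 2)%:E) by exact: finite_measure_integrable_cst.
apply: (@le_trans _ _ (\int[P]_y ((2 * s)^-1 * t y ^+ 2 + s / 2))).
  apply: le_Rintegral => //.
  - exact: integrable_norm.
  - exact: integrable_realD.
  move=> y _; rewrite -(real_normK (num_real (t y))); move: (`|t y|) => A.
  rewrite -subr_ge0.
  rewrite (_ : _ - A = (2 * s)^-1 * (A - s) ^+ 2); last by field; rewrite gt_eqF.
  by rewrite mulr_ge0 ?sqr_ge0// invr_ge0 mulr_ge0// ltW.
rewrite RintegralD// [X in X + _]RintegralZl//.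
rewrite [X in _ + X](Rintegral_cst _ measurableT) [X in fine X]probability_setT mulr1.
have le : \int[P]_y (t y ^+ 2) <= r.
  by rewrite -lee_fin /Rintegral fineK//; exact: integrable_fin_num.
rewrite [leRHS]mulrDl lerD2r.
rewrite (_ : r / s / 2 = (2 * s)^-1 * r); last by field; rewrite gt_eqF.
by rewrite ler_pM2l// invr_gt0 mulr_gt0.
Qed.

Lemma minimax_asymptotics {R : realType} {d : nat} {dX : measure_display}
    {X : measurableType dX} (nu : {sigma_finite_measure set X -> \bar R})
    (Theta : set 'rV[R]_d) (P : 'rV[R]_d -> probability X R)
    (p : 'rV[R]_d -> X -> R) (xi : 'rV[R]_d -> X -> 'rV[R]_d)
    (psi : 'rV[R]_d -> R) (theta0 : 'rV[R]_d) (e0 : R) :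
  has_density nu P Theta p ->
  (forall t, Theta t -> hellinger_differentiable nu Theta p t (xi t)) ->
  (interior Theta) theta0 ->
  fisher_information nu (xi theta0) \in unitmx ->
  C1_at psi theta0 ->
  let V := qform_inv (gradient psi theta0) (fisher_information nu (xi theta0)) in
  0 < e0 -> exists c0 : R, forall c, c0 <= c ->
  exists N, forall n, (N <= n)%N ->
  ((V - e0)%:E <= n%:R%:E * minimax_risk P psi theta0 n c)%E.
Proof.
move=> P_density P_hellinger theta0_interior I_invertible psi_C1 V e00.
have V0 : 0 <= V by exact: (V_ge0 psi P_hellinger theta0_interior I_invertible).
move: V0; rewrite le_eqVlt => /orP[/eqP V0|V0].
  exists 1 => c c1; exists 1%N => n n1.
  apply: (@le_trans _ _ 0%E); first by rewrite -V0 lee_fin sub0r oppr_le0 ltW.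
  by rewrite mule_ge0// minimax_risk_ge0// (lt_le_trans _ c1).
have [x [x0 x1 hx]] := minimax_step_exists V0 e00.
pose K := (Num.truncn (x ^- 2)).+1.
have K0 : 0 < K%:R :> R by rewrite ltr0n.
have Kx : (K%:R * x)^-1 <= x.
  rewrite -[leRHS]invrK lef_pV2 ?posrE ?invr_gt0 ?mulr_gt0//.
  rewrite -ler_pdivrMr// -invfM -expr2 ltW//; exact: truncnS_gt.
pose Z := K%:R * x.
have Z0 : 0 < Z by rewrite mulr_gt0.
have x30 : 0 < x ^+ 3 by rewrite exprn_gt0.
have [r r0 hr] := local_expansion P_density P_hellinger theta0_interior I_invertible psi_C1 Z0 x30.
pose w := gradient psi theta0 *m invmx (fisher_information nu (xi theta0)).
exists (Z * enorm w + 1) => c hc.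
have zw : Z * enorm w < c by apply: lt_le_trans hc; rewrite ltrDl.
have c0 : 0 < c by apply: le_lt_trans zw; rewrite mulr_ge0 ?enorm_ge0// ltW.
pose y := x ^+ 2 * V / 4 + x ^+ 3.
have y0 : 0 < y by rewrite addr_gt0// divr_gt0// mulr_gt0// exprn_gt0.
have y1 : 0 < 1 / (y + 1) by rewrite divr_gt0// addr_gt0.
have m0 : 0 < Num.min r (1 / (y + 1)) by rewrite lt_min r0.
have [N hN] := local_scale m0.
exists N => n nN; have [n0 /andP[s0]] := hN n nN.
rewrite lt_min => /andP[sr sy] s2.
pose s := (Num.sqrt (n%:R : R))^-1.
rewrite -/s in s0 sr sy s2.
have ssr : 0 < s < r by rewrite s0.
have [haff hpsi] := hr s ssr.
have nR0 : 0 < n%:R :> R by rewrite ltr0n.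
have ns2 : n%:R * s ^+ 2 = 1 by rewrite s2 mulfV// gt_eqF.
have ys : y * s ^+ 2 <= 1.
  have s1 : s <= 1.
    apply: (le_trans (ltW sy)); rewrite ler_pdivrMr; last by rewrite addr_gt0.
    by rewrite mul1r lerDr ltW.
  apply: (@le_trans _ _ (y * s)).
    by rewrite ler_wpM2l ?(ltW y0)// expr2 ler_piMl// ltW.
  apply: (@le_trans _ _ ((y + 1) * s)); first by rewrite ler_wpM2r ?lerDl// ltW.
  by rewrite mulrC -ler_pdivlMr; [rewrite ltW|rewrite addr_gt0].
pose a := 1 - y * s ^+ 2 / 2.
have ysge : 0 <= y * s ^+ 2 by rewrite mulr_ge0 ?sqr_ge0// ltW.
have a0 : 0 <= a by rewrite /a; move: ys; clear; move: (y * _) => A; lra.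
have an : 1 - y / 2 <= a ^+ n.
  have u01 : 0 <= y * s ^+ 2 / 2 <= 1.
    by move: ys ysge; clear; move: (y * _) => A h1 h2; apply/andP; split; lra.
  have := bernoulli_ineq n u01.
  have -> : n%:R * (y * s ^+ 2 / 2) = (n%:R * s ^+ 2) * (y / 2) by ring.
  by rewrite ns2 mul1r.
pose th (k : nat) := theta0 + (s * (k%:R * x)) *: w.
pose Pk (k : nat) := tuple_probability (P (th k)) n.
have kZ k : (k <= K)%N -> `|k%:R * x| <= Z.
  move=> kK; rewrite ger0_norm ?mulr_ge0 ?(ltW x0)//.
  by rewrite ler_wpM2r ?ler_nat// ltW.
have hell k : (k < K)%N -> hellinger2 (Pk k.+1) (Pk k) <= y.
  move=> kK.
  have := haff _ _ (kZ _ kK) (kZ _ (ltnW kK)).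
  rewrite -/V -/w -/(th _) -/(th k).
  rewrite (_ : k.+1%:R * x - k%:R * x = x); last by rewrite mulrSr; ring.
  rewrite -/y -/a => aff.
  have := affinity_ge_hellinger2 (affinity_ge_tuple (n := n) aff a0).
  by move: an; rewrite -/(Pk _) -/(Pk k); move: (a ^+ n) (hellinger2 _ _) => A B; clear; lra.
have thS k : (k <= K)%N -> local_ball theta0 n c (th k).
  move=> kK.
  rewrite /local_ball /eball /= /th addrC addKr enormZ normrM gtr0_norm//.
  rewrite -mulrA mulrC ltr_pM2r//; apply: le_lt_trans zw.
  by rewrite ler_wpM2r ?enorm_ge0// kZ.
have nn : (0 <= n%:R%:E :> \bar R)%E by rewrite lee_fin.
pose target := (V - e0) * s ^+ 2.
suff : (target%:E <= minimax_risk P psi theta0 n c)%E.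
  move=> /(lee_wpmul2l nn); apply: le_trans.
  by rewrite -EFinM lee_fin /target mulrCA ns2 mulr1.
apply: le_ereal_inf_tmp => _ [t /= mt <-].
set risk := ereal_sup _.
have riskP k : (k <= K)%N -> (\int[Pk k]_z ((t z - psi (th k)) ^+ 2)%:E <= risk)%E.
  move=> kK; apply: ereal_sup_ubound; exists (th k); first exact: thS.
  by apply: eq_integral => z _; rewrite real_normK ?num_real.
have : (0 <= risk)%E.
  apply: le_trans (riskP 0%N isT); apply: integral_ge0 => z _.
  by rewrite lee_fin sqr_ge0.
move: riskP; case: risk => [rho|_ _|//]; last exact: leey.
rewrite !lee_fin => riskP rho0.
pose m k := \int[Pk k]_z (t z - psi (th k)).
pose k0 := x / (4 * s).
have k00 : 0 < k0 by rewrite divr_gt0// mulr_gt0.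
pose B := k0 * ((2 + x) * rho + (1 + x^-1) * (s ^+ 2 * (x * V + 2 * x ^+ 3) ^+ 2)) + y / (2 * k0).
have psi_step k : (k < K)%N -> (psi (th k.+1) - psi (th k)) ^+ 2 <= s ^+ 2 * (x * V + 2 * x ^+ 3) ^+ 2.
  move=> kK; have := hpsi _ (kZ _ kK); have := hpsi _ (kZ _ (ltnW kK)).
  rewrite -/V -/w -/(th _) -/(th k.+1) -exprMn !ler_norml mulrSr.
  have D0 : 0 <= s * (x * V + 2 * x ^+ 3).
    by rewrite mulr_ge0 ?(ltW s0)// addr_ge0// mulr_ge0// ltW.
  have xVs : 0 <= s * (x * V) by rewrite !mulr_ge0// ltW.
  move=> /andP[h1 h2] /andP[h3 h4].
  rewrite -(real_normK (num_real (psi _ - _))) lerXn2r ?nnegrE//.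
  rewrite ler_norml; move: h1 h2 h3 h4 D0 xVs.
  move: (psi (th k.+1)) (psi (th k)) (k%:R) (x ^+ 3); clear.
  by move=> A C k e *; apply/andP; split; lra.
have step k : (k < K)%N -> (m k.+1 - m k) + (psi (th k.+1) - psi (th k)) <= B.
  move=> kK.
  have := chain_step_gap mt k00 x0 rho0 (riskP _ (ltnW kK)) (riskP _ kK).
  rewrite -/(m k) -/(m k.+1) => /le_trans; apply.
  rewrite /B lerD//.
    rewrite ler_wpM2l ?(ltW k00)// lerD2l ler_wpM2l ?psi_step//.
    by rewrite addr_ge0// invr_ge0 ltW.
  by rewrite ler_wpM2r ?hell// invr_ge0 mulr_ge0// ltW.
have sum : (m K - m 0%N) + (psi (th K) - psi (th 0%N)) <= K%:R * B.
  have -> : (m K - m 0%N) + (psi (th K) - psi (th 0%N)) =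
      \sum_(0 <= k < K) ((m k.+1 + psi (th k.+1)) - (m k + psi (th k))).
    by rewrite telescope_sumr//; ring.
  rewrite big_mkord (_ : K%:R * B = \sum_(k < K) B); last by rewrite sumr_const card_ord mulr_natl.
  apply: ler_sum => k _; apply: le_trans (step _ (ltn_ord k)).
  by rewrite le_eqVlt; apply/orP; left; apply/eqP; ring.
have mb k : (k <= K)%N -> `|m k| <= (rho / s + s) / 2.
  move=> kK; apply: mean_le_risk => //; last exact: riskP.
  exact: measurable_funB.
have psiK : s * (K%:R * x * V - 2 * x ^+ 3) <= psi (th K) - psi (th 0%N).
  have := hpsi _ (kZ _ (leqnn K)); have := hpsi _ (kZ _ (leq0n K)).
  rewrite -/V -/w -/(th _) -/(th K) !ler_norml => /andP[h1 h2] /andP[h3 h4].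
  rewrite !(mul0r, mulr0) in h1 h2.
  move: h1 h2 h3 h4; move: (psi (th K)) (psi (th 0%N)) (x ^+ 3); clear => A C D; lra.
have key : s * (K%:R * x * V - 2 * x ^+ 3) - (rho / s + s) <= K%:R * B.
  have := mb _ (leqnn K); have := mb _ (leq0n K); rewrite !ler_norml.
  move: sum psiK => h1 h2 /andP[h3 h4] /andP[h5 h6].
  move: h1 h2 h3 h4 h5 h6.
  move: (m K) (m 0%N) (psi (th K)) (psi (th 0%N)) (K%:R * B) (rho / s) (s * (_ - _)).
  by clear => *; lra.
rewrite /target -ler_pdivlMr ?exprn_gt0//.
pose q := rho / s ^+ 2; rewrite -/q.
have q0 : 0 <= q by rewrite divr_ge0// sqr_ge0.
have rhoE : rho = q * s ^+ 2 by rewrite /q divfK// gt_eqF// exprn_gt0.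
have sn0 : s != 0 by rewrite gt_eqF.
have xn0 : x != 0 by rewrite gt_eqF.
have BE : B = s * (x / 4 * ((2 + x) * q + (1 + x^-1) * (x * V + 2 * x ^+ 3) ^+ 2) + 2 * y / x).
  by rewrite /B /k0 rhoE; field; rewrite sn0 xn0.
have key2 : K%:R * x * V - 2 * x ^+ 3 - (q + 1) <=
    K%:R * (x / 4 * ((2 + x) * q + (1 + x^-1) * (x * V + 2 * x ^+ 3) ^+ 2) + 2 * y / x).
  rewrite -(ler_pM2l s0) [leRHS]mulrCA -BE; apply: le_trans key.
  by rewrite rhoE le_eqVlt; apply/orP; left; apply/eqP; field.
have Kx0 : 0 < K%:R * x by exact: Z0.
have key3 : V - (2 * x ^+ 3 + (q + 1)) * (K%:R * x)^-1 <=
    (2 + x) / 4 * q + x * (x + 1) * (V + 2 * x ^+ 2) ^+ 2 / 4 + V / 2 + 2 * x.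
  rewrite -(ler_pM2l Kx0); apply: (@le_trans _ _ (K%:R * x * V - 2 * x ^+ 3 - (q + 1))).
    by rewrite le_eqVlt; apply/orP; left; apply/eqP; field; rewrite xn0 gt_eqF.
  apply: (le_trans key2).
  by rewrite /y le_eqVlt; apply/orP; left; apply/eqP; field.
have key4 : (2 * x ^+ 3 + (q + 1)) * (K%:R * x)^-1 <= (2 * x ^+ 3 + (q + 1)) * x.
  by rewrite ler_wpM2l// addr_ge0 ?addr_ge0// mulr_ge0// ltW.
have key5 : (V - e0) * (2^-1 + 5 / 4 * x) <= q * (2^-1 + 5 / 4 * x).
  apply: (le_trans hx); move: key3 key4.
  rewrite (_ : (2 * x ^+ 3 + (q + 1)) * x = 2 * x ^+ 4 + x * q + x); last by ring.
  move: (_ * (K%:R * x)^-1) (x ^+ 4) (x * (x + 1) * _ ^+ 2 / 4) => A1 B1 C1; clear => *; lra.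
by rewrite ler_pM2r in key5 => //; rewrite addr_gt0// mulr_gt0.
Qed.
Section product_integrals.
Context {R : realType}.
Let lam : {sigma_finite_measure set (measurableTypeR R) -> \bar R} :=
  @lebesgue_measure R.

Lemma sigma_finite_tuple_lebesgue n : sigma_finite setT (tuple_measure lam n).
Proof.
pose I (k : nat) : set (measurableTypeR R) := `]- k%:R, k%:R[%classic.
pose G n k : set (n.-tuple (measurableTypeR R)) :=
  [set t | forall i, I k (tnth t i)].
have mI k : measurable (I k) by exact: measurable_itv.
have mG m k : measurable (G m k).
  rewrite (_ : G m k = \bigcap_(i in [set: 'I_m]) ((fun t : m.-tuple (measurableTypeR R) => tnth t i) @^-1` I k)).
    apply: fin_bigcap_measurable => // i _.
    by rewrite -[X in measurable X]setTI; exact: measurable_tnth.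
  by apply/seteqP; split=> [t h i _|t h i]; [exact: h|exact: (h i Logic.I)].
exists (G n).
  apply/seteqP; split => // t _.
  pose b := \sum_i `|tnth t i|.
  exists (Num.truncn b).+1 => // i /=; rewrite /I /= in_itv/= -ltr_norml.
  apply: le_lt_trans (truncnS_gt b); rewrite /b (bigD1 i)//= lerDl.
  by apply: sumr_ge0 => j _; exact: normr_ge0.
move=> k; split; first exact: mG.
elim: n => [|n IH] /=; first by rewrite /= diracE ltry.
rewrite /image_measure /pushforward /=.
rewrite (_ : _ @^-1` _ = I k `*` G n k); last first.
  apply/seteqP; split=> [[x xs] /= h|[x xs] /= [h1 h2]].
    split; first by have := h ord0; rewrite (tnth_nth x).
    move=> i; have := h (lift ord0 i).
    by rewrite !(tnth_nth x)/= add0n.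
  move=> i; case: (unliftP ord0 i) => [j|] ->; last by rewrite (tnth_nth x).
  by have := h2 j; rewrite !(tnth_nth x)/= add0n.
rewrite product_measure2E//; last exact: mG.
have Ifin : (lam (I k) < +oo)%E.
  by rewrite /= lebesgue_measure_itv/=; case: ifP => // _; rewrite -EFinB ltry.
rewrite lte_mul_pinfty//.
by rewrite ge0_fin_numE.
Qed.

(* tuple_measure lam n with its sigma-finite structure, as Fubini requires *)
Definition tuple_lebesgue n : set (n.-tuple (measurableTypeR R)) -> \bar R :=
  tuple_measure lam n.
Arguments tuple_lebesgue : clear implicits.

HB.instance Definition _ n := Measure.on (tuple_lebesgue n).

HB.instance Definition _ n := Measure_isSigmaFinite.Build _ _ _
  (tuple_lebesgue n) (sigma_finite_tuple_lebesgue n).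

Lemma tuple_lebesgue_prod n (f : nat -> R -> R) :
  (forall i, (@lebesgue_measure R).-integrable [set: R] (fun x => (f i x)%:E)) ->
  let F := fun t : n.-tuple (measurableTypeR R) => \prod_(i < n) f i (tnth t i) in
  (tuple_measure lam n).-integrable setT (fun t => (F t)%:E) /\
  (\int[tuple_measure lam n]_t (F t)%:E =
    (\prod_(i < n) \int[@lebesgue_measure R]_x f i x)%:E)%E.
Proof.
elim: n f => [|n IH] f fi F.
  have mF : measurable_fun setT F.
    rewrite (_ : F = cst 1); first exact: measurable_cst.
    by apply/funext => t; rewrite /F big_ord0.
  split.
    apply: (@bounded_integrable _ _ _ (dirac _) _ 1) => // t.
    by rewrite /F big_ord0 normr1.
  rewrite /= integral_dirac//; last exact/measurable_EFinP.
  by rewrite diracT mul1e /F !big_ord0.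
pose g (t : n.-tuple (measurableTypeR R)) := \prod_(i < n) f i.+1 (tnth t i).
have [gi gE] : (tuple_measure lam n).-integrable setT (fun t => (g t)%:E) /\
    (\int[tuple_measure lam n]_t (g t)%:E =
    (\prod_(i < n) \int[@lebesgue_measure R]_x f i.+1 x)%:E)%E.
  exact: IH (fun i => f i.+1) (fun i => fi i.+1).
have mf0 : measurable_fun [set: measurableTypeR R] (f 0%N).
  by apply/measurable_EFinP; exact: measurable_int (fi 0%N).
have /integrableP[gm _] := gi.
have mg : measurable_fun [set: n.-tuple (measurableTypeR R)] g.
  by move/measurable_EFinP : gm.
pose h (z : measurableTypeR R * n.-tuple (measurableTypeR R)) := f 0%N z.1 * g z.2.
have mh : measurable_fun setT h.
  apply: measurable_funM; first exact: (measurableT_comp mf0 measurable_fst).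
  exact: (measurableT_comp mg measurable_snd).
have Fh z : F (consT z) = h z.
  rewrite /F /h big_ord_recl /g; congr (_ * _).
  by apply: eq_bigr => i _; rewrite !(tnth_nth 0)/= add0n.
have hi1 : (lam \x tuple_lebesgue n)%E.-integrable setT (fun z => (h z)%:E).
  apply/integrable12ltyP; first exact/measurable_EFinP.
  have c1 : (\int[tuple_lebesgue n]_y (`|g y|)%:E < +oo)%E.
    by have /integrableP[_] := gi.
  have c0 : (0 <= \int[tuple_lebesgue n]_y (`|g y|)%:E)%E.
    by apply: integral_ge0 => y _; rewrite lee_fin.
  have E x : (\int[tuple_lebesgue n]_y `|(h (x, y))%:E| =
      `|f 0%N x|%:E * \int[tuple_lebesgue n]_y (`|g y|)%:E)%E.
    rewrite -ge0_integralZl_EFin//; last first.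
      by apply/measurable_EFinP; exact: measurableT_comp.
    by apply: eq_integral => y _; rewrite /h /= normrM EFinM.
  under eq_integral => x _ do rewrite E.
  rewrite ge0_integralZr//; last first.
    by apply/measurable_EFinP; exact: measurableT_comp.
  have f0 : (0 <= \int[lam]_x (`|f 0%N x|)%:E)%E.
    by apply: integral_ge0 => x _; rewrite lee_fin.
  apply: lte_mul_pinfty => //.
  by rewrite ge0_fin_numE//; have /integrableP[_] := fi 0%N.
have same A : measurable A -> (lam \x tuple_lebesgue n)%E A = (lam \x^ tuple_measure lam n)%E A.
  move=> mA; apply: product_measure_unique => // B C mB mC.
  exact: product_measure2E.
have int1 : (\int[lam \x^ tuple_measure lam n]_z (h z)%:E =
    \int[lam \x tuple_lebesgue n]_z (h z)%:E)%E.
  by apply: eq_measure_integral => A mA _; exact/esym/same.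
have hi2 : (lam \x^ tuple_measure lam n)%E.-integrable setT (fun z => (h z)%:E).
  apply/integrableP; split; first exact/measurable_EFinP.
  rewrite (eq_measure_integral (lam \x tuple_lebesgue n)%E); first by have /integrableP[] := hi1.
  by move=> A mA _; exact/esym/same.
have mc := @measurable_consT _ (measurableTypeR R) n.
have mF : measurable_fun setT F.
  rewrite /F; apply: measurable_prod => i _.
  have /integrableP[/measurable_EFinP mfi _] := fi i.
  by apply: (measurableT_comp mfi); exact: measurable_tnth.
have hic : (lam \x^ tuple_measure lam n)%E.-integrable (@consT _ (measurableTypeR R) n @^-1` setT)
    ((fun t => (F t)%:E) \o @consT _ (measurableTypeR R) n).
  by rewrite preimage_setT; apply: eq_integrable hi2 => // z _ /=; rewrite Fh.
have mFE : measurable_fun setT (fun t => (F t)%:E) by exact/measurable_EFinP.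
split.
  exact: (integrable_pushforward mc mFE hic measurableT).
transitivity (\int[lam \x^ tuple_measure lam n]_z (h z)%:E)%E.
  rewrite [LHS](integral_pushforward mc mFE hic measurableT) preimage_setT.
  by apply: eq_integral => z _ /=; rewrite Fh.
rewrite int1 -integral12_prod_meas1// /fubini_F.
rewrite big_ord_recl EFinM -gE.
have gfin : (\int[tuple_lebesgue n]_y (g y)%:E)%E \is a fin_num.
  exact: integrable_fin_num gi.
have E x : (\int[tuple_lebesgue n]_y (h (x, y))%:E =
    (f 0%N x)%:E * \int[tuple_lebesgue n]_y (g y)%:E)%E.
  by rewrite -integralZl//; apply: eq_integral => y _; rewrite /h /= EFinM.
under eq_integral => x _ do rewrite E.
rewrite -(fineK gfin) integralZr//.
have f0fin : (\int[@lebesgue_measure R]_x (f 0%N x)%:E)%E \is a fin_num.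
  exact: (integrable_fin_num measurableT (fi 0%N)).
by rewrite /Rintegral (fineK f0fin).
Qed.

Lemma lebesgue_rV_prod d (f : 'I_d -> R -> R) :
  (forall i, (@lebesgue_measure R).-integrable [set: R] (fun x => (f i x)%:E)) ->
  (lebesgue_rV R d).-integrable setT (fun t => (\prod_i f i (t 0 i))%:E) /\
  (\int[lebesgue_rV R d]_t (\prod_i f i (t 0 i))%:E =
    (\prod_i \int[@lebesgue_measure R]_x f i x)%:E)%E.
Proof.
move=> fi.
pose f' (k : nat) := if insub k is Some i then f i else cst 0.
have f'E (i : 'I_d) : f' i = f i.
  by rewrite /f' insubT//= => h; congr f; exact: val_inj.
have f'i k : (@lebesgue_measure R).-integrable [set: R] (fun x => (f' k x)%:E).
  by rewrite /f'; case: insubP => [i _ _|_]; [exact: fi|exact: integrable0].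
have [gi gE] := @tuple_lebesgue_prod d f' f'i.
have mr := @measurable_row_of_tuple R d.
have mF : measurable_fun [set: 'rV[R]_d] (fun t : 'rV[R]_d => (\prod_i f i (t 0 i))%:E).
  apply/measurable_EFinP; apply: measurable_prod => i _.
  have /integrableP[/measurable_EFinP mfi _] := fi i.
  by apply: (measurableT_comp mfi); exact: measurable_coord.
have E t : \prod_i f i (row_of_tuple t 0 i) = \prod_(i < d) f' i (tnth t i) :> R.
  by apply: eq_bigr => i _; rewrite f'E mxE.
have hic : (tuple_measure lam d).-integrable (@row_of_tuple R d @^-1` setT)
    ((fun t : 'rV[R]_d => (\prod_i f i (t 0 i))%:E) \o @row_of_tuple R d).
  by rewrite preimage_setT; apply: eq_integrable gi => // z _ /=; rewrite E.
split; first exact: (integrable_pushforward mr mF hic measurableT).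
rewrite [LHS](integral_pushforward mr mF hic measurableT) preimage_setT.
under eq_integral do rewrite /= E.
by rewrite gE; congr _%:E; apply: eq_bigr => i _; rewrite f'E.
Qed.

End product_integrals.
Section polynomial_pieces.
Context {R : realType}.

Lemma horner_continuous (p : {poly R}) : continuous (horner p : R -> R).
Proof.
move=> x; have h := is_derive_poly p x.
by apply: differentiable_continuous; apply/derivable1_diffP; exact: ex_derive.
Qed.

Lemma integral_derivative_poly (p : {poly R}) (a b : R) : a < b ->
  (\int[lebesgue_measure]_(x in `[a, b]) (p^`().[x])%:E = (p.[b] - p.[a])%:E)%E.
Proof.
move=> ab; rewrite EFinB.
apply: (@continuous_FTC2 R (horner p^`()) (horner p) a b ab).
- by apply: continuous_subspaceT; exact: horner_continuous.
- split.
  + by move=> x _; have h := is_derive_poly p x; exact: ex_derive.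
  + by apply: cvg_at_right_filter; exact: horner_continuous.
  + by apply: cvg_at_left_filter; exact: horner_continuous.
- move=> x _; rewrite derive1E.
  by have h := is_derive_poly p x; rewrite derive_val.
Qed.

(** The test functions below are polynomial on an interval and vanish outside
    of it, so that all their integrals reduce to the fundamental theorem. *)
Lemma integral_piece (p : {poly R}) (f : R -> R) (m a : R) : 0 < a ->
  (forall s, `|s| < a -> f s = p^`().[s]) ->
  (forall s, a <= `|s| -> f s = 0) ->
  (@lebesgue_measure R).-integrable [set: R] (fun s => (f (s - m))%:E) /\
  \int[@lebesgue_measure R]_s f (s - m) = p.[a] - p.[- a].
Proof.
move=> a0 f1 f0.
pose P := p \Po ('X - m%:P).
have PE s : P.[s] = p.[s - m] by rewrite /P horner_comp !hornerE.
have P'E s : P^`().[s] = p^`().[s - m].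
  by rewrite /P deriv_comp hornerM horner_comp derivXsubC hornerC mulr1 hornerXsubC.
pose J : set (measurableTypeR R) := `]m - a, m + a[%classic.
have JE s : J s = (`|s - m| < a) :> Prop.
  rewrite /J /= in_itv/= ltr_norml; apply/propext.
  by split=> /andP[h1 h2]; apply/andP; split; lra.
have fE : (fun s => (f (s - m))%:E) = (fun s => (P^`().[s])%:E) \_ J.
  apply/funext => s; rewrite patchE; case: ifPn => [|].
    by rewrite inE JE => h; rewrite P'E f1.
  by rewrite notin_setE JE => /negP; rewrite -leNgt => h; rewrite f0.
have mJ : measurable J by exact: measurable_itv.
have ab : m - a < m + a by rewrite ltrD2l gtrN.
have icl : (@lebesgue_measure R).-integrable `[m - a, m + a] (fun s => (P^`().[s])%:E).
  apply: (@continuous_compact_integrable R (horner P^`())); first exact: segment_compact.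
  by apply: continuous_subspaceT; exact: horner_continuous.
have ij : (@lebesgue_measure R).-integrable J (fun s => (P^`().[s])%:E).
  apply: integrableS icl => //.
  by move=> x /=; rewrite !in_itv/= => /andP[h1 h2]; rewrite !ltW.
split; first by rewrite fE; exact: (iffLR (integrable_mkcond _ mJ) ij).
rewrite /Rintegral fE -integral_mkcond /J.
have mP : measurable_fun `]m - a, m + a[ (fun s => (P^`().[s])%:E).
  by have /integrableP[mP _] := ij; exact: mP.
have /= <- := @integral_itv_bndoo R _ _ _ true false mP.
by rewrite integral_derivative_poly//= !PE; congr (p.[_] - p.[_]); ring.
Qed.

End polynomial_pieces.

Section bump.
Context {R : realType}.
Implicit Types (a s : R).

Definition bump a s : R :=
  15 / (16 * a ^+ 5) * Num.max 0 (a ^+ 2 - s ^+ 2) ^+ 2.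

Definition dbump a s : R :=
  - (15 / (4 * a ^+ 5)) * (s * Num.max 0 (a ^+ 2 - s ^+ 2)).

Definition bump_information a s : R :=
  if 0 < bump a s then dbump a s ^+ 2 / bump a s else 0.

Lemma max0_inside a s : `|s| < a -> Num.max 0 (a ^+ 2 - s ^+ 2) = a ^+ 2 - s ^+ 2.
Proof.
move=> sa; apply/max_idPr; rewrite subr_ge0 -real_normK ?num_real//.
by rewrite ler_sqr ?nnegrE ?(ltW sa)// (le_trans _ (ltW sa)).
Qed.

Lemma max0_outside a s : 0 < a -> a <= `|s| -> Num.max 0 (a ^+ 2 - s ^+ 2) = 0.
Proof.
move=> a0 sa; apply/max_idPl; rewrite subr_le0 -[leRHS]real_normK ?num_real//.
by rewrite ler_sqr ?nnegrE// ltW.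
Qed.

Lemma bump_outside a s : 0 < a -> a <= `|s| -> bump a s = 0.
Proof. by move=> a0 sa; rewrite /bump max0_outside// expr0n mulr0. Qed.

Lemma dbump_outside a s : 0 < a -> a <= `|s| -> dbump a s = 0.
Proof. by move=> a0 sa; rewrite /dbump max0_outside// !mulr0. Qed.

Lemma bump_inside a s : `|s| < a ->
  bump a s = 15 / (16 * a ^+ 5) * (a ^+ 2 - s ^+ 2) ^+ 2.
Proof. by move=> sa; rewrite /bump max0_inside. Qed.

Lemma dbump_inside a s : `|s| < a ->
  dbump a s = - (15 / (4 * a ^+ 5)) * (s * (a ^+ 2 - s ^+ 2)).
Proof. by move=> sa; rewrite /dbump max0_inside. Qed.

Lemma bump_ge0 a s : 0 < a -> 0 <= bump a s.
Proof.
move=> a0; rewrite /bump mulr_ge0 ?sqr_ge0// divr_ge0//.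
by rewrite mulr_ge0// exprn_ge0// ltW.
Qed.

Lemma sqr_gap_inside a s : `|s| < a -> 0 < a ^+ 2 - s ^+ 2.
Proof.
move=> sa; rewrite subr_gt0 -real_normK ?num_real//.
by rewrite ltr_sqr ?nnegrE ?(le_trans _ (ltW sa)).
Qed.

Lemma bump_gt0 a s : 0 < a -> (0 < bump a s) = (`|s| < a).
Proof.
move=> a0; case: (ltP `|s| a) => sa.
  rewrite bump_inside// mulr_gt0 ?exprn_gt0 ?sqr_gap_inside// divr_gt0//.
  by rewrite mulr_gt0// exprn_gt0.
by rewrite bump_outside// ltxx.
Qed.

Lemma bump_information_inside a s : 0 < a -> `|s| < a ->
  bump_information a s = 15 / a ^+ 5 * s ^+ 2.
Proof.
move=> a0 sa; rewrite /bump_information bump_gt0// sa bump_inside// dbump_inside//.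
have g := lt0r_neq0 (sqr_gap_inside sa).
by move: (_ - _) g => g g0; field; rewrite ?g0 ?(lt0r_neq0 a0)// ?expf_neq0 ?(lt0r_neq0 a0).
Qed.

Lemma bump_information_outside a s : 0 < a -> a <= `|s| -> bump_information a s = 0.
Proof. by move=> a0 sa; rewrite /bump_information bump_outside// ltxx. Qed.

Lemma bump_integral m a : 0 < a ->
  (@lebesgue_measure R).-integrable [set: R] (fun s => (bump a (s - m))%:E) /\
  \int[@lebesgue_measure R]_s bump a (s - m) = 1.
Proof.
move=> a0; pose p : {poly R} := (15 / (16 * a ^+ 5)) *:
  (a ^+ 4 *: 'X - (2 / 3 * a ^+ 2) *: 'X^3 + 5^-1 *: 'X^5).
have [|s|i ->] := @integral_piece _ p (bump a) m a a0.
- move=> s sa; rewrite bump_inside// /p !poly.derivE !hornerE/=; field.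
  by rewrite (lt0r_neq0 a0).
- exact: bump_outside.
by split=> //; rewrite /p !hornerE/=; field; rewrite (lt0r_neq0 a0).
Qed.

Lemma dbump_integral m a : 0 < a ->
  (@lebesgue_measure R).-integrable [set: R] (fun s => (dbump a (s - m))%:E) /\
  \int[@lebesgue_measure R]_s dbump a (s - m) = 0.
Proof.
move=> a0; pose p : {poly R} := (15 / (16 * a ^+ 5)) *:
  ((a ^+ 2)%:P - 'X^2) ^+ 2.
have [|s|i ->] := @integral_piece _ p (dbump a) m a a0.
- move=> s sa; rewrite dbump_inside// /p !poly.derivE !hornerE/=; field.
  by rewrite (lt0r_neq0 a0).
- exact: dbump_outside.
by split=> //; rewrite /p !hornerE/=; field; rewrite (lt0r_neq0 a0).
Qed.

Lemma bump_information_integral m a : 0 < a ->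
  (@lebesgue_measure R).-integrable [set: R] (fun s => (bump_information a (s - m))%:E) /\
  \int[@lebesgue_measure R]_s bump_information a (s - m) = 10 / a ^+ 2.
Proof.
move=> a0; pose p : {poly R} := (5 / a ^+ 5) *: 'X^3.
have [|s|i ->] := @integral_piece _ p (bump_information a) m a a0.
- move=> s sa; rewrite bump_information_inside// /p !poly.derivE !hornerE/=; field.
  by rewrite (lt0r_neq0 a0).
- exact: bump_information_outside.
by split=> //; rewrite /p !hornerE/=; field; rewrite (lt0r_neq0 a0).
Qed.

Lemma is_derive_quadratic (f : R -> R) (x l : R) :
  (forall y, `|f y - f x - l * (y - x)| <= (y - x) ^+ 2) -> is_derive x (1 : R) f l.
Proof.
move=> h.
have c : (fun z : R => z^-1 *: (f (z *: (1 : R) + x) - f x)) @ 0^' --> l.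
  apply/cvgrPdist_le => e e0; near=> z.
  have z0 : z != 0 by near: z; exact: nbhs_dnbhs_neq.
  have := h (z + x); rewrite addrK => hz.
  rewrite /= [z *: (1 : R)]mulr1 distrC.
  have -> : z^-1 *: (f (z + x) - f x) - l = z^-1 * (f (z + x) - f x - l * z).
    by rewrite [z^-1 *: _]/(z^-1 * _) [in RHS]mulrBr [X in _ = _ - X]mulrCA mulVf// mulr1.
  rewrite normrM normfV ler_pdivrMl ?normr_gt0//.
  apply: (le_trans hz); rewrite -real_normK ?num_real// expr2 ler_wpM2l//.
  near: z; apply: dnbhs0_le => //.
apply: DeriveDef; first by apply/cvg_ex; exists l.
by rewrite /derive; apply: cvg_lim.
Unshelve. all: by end_near. Qed.

Lemma is_derive_max0_sqr (x : R) :
  is_derive x (1 : R) (fun y => Num.max 0 y ^+ 2) (2 * Num.max 0 x).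
Proof.
apply: is_derive_quadratic => y.
have [x0|x0] := leP 0 x; have [y0|y0] := leP 0 y.
- have -> : y ^+ 2 - x ^+ 2 - 2 * x * (y - x) = (y - x) ^+ 2 by ring.
  by rewrite ger0_norm// sqr_ge0.
- have xy : x * y <= 0 by exact: mulr_ge0_le0 x0 (ltW y0).
  have x2 := sqr_ge0 x; have y2 := sqr_ge0 y.
  have -> : 0 ^+ 2 - x ^+ 2 - 2 * x * (y - x) = x ^+ 2 - 2 * (x * y) by ring.
  have -> : (y - x) ^+ 2 = y ^+ 2 - 2 * (x * y) + x ^+ 2 by ring.
  by rewrite ger0_norm; lra.
- have xy : x * y <= 0 by exact: mulr_le0_ge0 (ltW x0) y0.
  have x2 := sqr_ge0 x; have y2 := sqr_ge0 y.
  have -> : y ^+ 2 - 0 ^+ 2 - 2 * 0 * (y - x) = y ^+ 2 by ring.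
  have -> : (y - x) ^+ 2 = y ^+ 2 - 2 * (x * y) + x ^+ 2 by ring.
  by rewrite ger0_norm; lra.
- have -> : 0 ^+ 2 - 0 ^+ 2 - 2 * 0 * (y - x) = 0 by ring.
  by rewrite normr0 sqr_ge0.
Qed.

Lemma is_derive_bump a s : is_derive s (1 : R) (bump a) (dbump a s).
Proof.
pose g (s : R) : R := a ^+ 2 - s ^+ 2.
have dg : is_derive s (1 : R) g (- (2 * s)).
  have -> : g = horner ((a ^+ 2)%:P - 'X^2) by apply/funext => y; rewrite !hornerE.
  have h := is_derive_poly ((a ^+ 2)%:P - 'X^2) s.
  by apply: (is_derive_eq h); rewrite !poly.derivE !hornerE/=; ring.
have dc := is_derive1_comp (is_derive_max0_sqr (g s)) dg.
have := is_deriveZ (15 / (16 * a ^+ 5)) dc.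
have -> : (15 / (16 * a ^+ 5)) \*: ((fun y : R => Num.max 0 y ^+ 2) \o g) = bump a by [].
move=> h; apply: is_derive_eq h _.
rewrite /GRing.scale /= /dbump -/(g s); move: (Num.max 0 (g s)) => M.
have [->|a0] := eqVneq a 0; first by rewrite expr0n/= !mulr0 !invr0 !mulr0 oppr0 !mul0r.
by field; rewrite ?a0.
Qed.

End bump.
Section density_probability.
Context {d} {T : measurableType d} {R : realType}.
Variable mu : {measure set T -> \bar R}.

(* the proofs are arguments so that they can be recovered from the function *)
Definition with_density (f : T -> R) (f0 : forall x, 0 <= f x)
    (mf : measurable_fun [set: T] f) (f1 : (\int[mu]_x (f x)%:E = 1)%E)
    (A : set T) : \bar R := (\int[mu]_(x in A) (f x)%:E)%E.

Variables (f : T -> R) (f0 : forall x, 0 <= f x)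
  (mf : measurable_fun [set: T] f) (f1 : (\int[mu]_x (f x)%:E = 1)%E).
Let D := with_density f0 mf f1.

Let D0 : D set0 = 0%E.
Proof. exact: integral_set0. Qed.

Let D_ge0 A : (0 <= D A)%E.
Proof. by apply: integral_ge0 => x _; rewrite lee_fin. Qed.

Let D_sigma_additive : semi_sigma_additive D.
Proof.
move=> F mF tF mUF; rewrite /D /with_density ge0_integral_bigcup//.
- by apply: is_cvg_ereal_nneg_natsum => n _; apply: D_ge0.
- by apply/measurable_EFinP; exact: measurable_funTS.
- by move=> x _; rewrite lee_fin.
Qed.

HB.instance Definition _ := isMeasure.Build _ _ _ (with_density f0 mf f1)
  D0 D_ge0 D_sigma_additive.

Let D1 : D [set: T] = 1%E.
Proof. exact: f1. Qed.

HB.instance Definition _ := Measure_isProbability.Build _ _ _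
  (with_density f0 mf f1) D1.

End density_probability.

Lemma probability_of_density {d} {T : measurableType d} {R : realType}
    (mu : {measure set T -> \bar R}) (f : T -> R) :
  (forall x, 0 <= f x) -> measurable_fun [set: T] f ->
  (\int[mu]_x (f x)%:E = 1)%E ->
  exists Q : probability T R,
    forall A, measurable A -> Q A = (\int[mu]_(x in A) (f x)%:E)%E.
Proof. by move=> f0 mf f1; exists (with_density f0 mf f1). Qed.

(** Bounded Lipschitz functions, unlike Lipschitz functions, are stable under
    products. *)
Section bounded_lipschitz.
Context {R : realType}.

Definition bounded_lipschitz (f : R -> R) : Prop :=
  exists2 M : R, 0 <= M & forall x y, `|f x| <= M /\ `|f x - f y| <= M * `|x - y|.

Lemma bounded_lipschitz_cst c : bounded_lipschitz (cst c).
Proof. by exists `|c| => // x y; rewrite subrr normr0 mulr_ge0. Qed.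

Lemma bounded_lipschitz_add f g : bounded_lipschitz f -> bounded_lipschitz g ->
  bounded_lipschitz (fun x => f x + g x).
Proof.
move=> [M M0 hf] [N N0 hg]; exists (M + N) => [|x y]; first exact: addr_ge0.
have [f1 f2] := hf x y; have [g1 g2] := hg x y; split.
  by rewrite (le_trans (ler_normD _ _))// lerD.
have -> : f x + g x - (f y + g y) = (f x - f y) + (g x - g y) by ring.
by rewrite (le_trans (ler_normD _ _))// mulrDl lerD.
Qed.

Lemma bounded_lipschitz_mul f g : bounded_lipschitz f -> bounded_lipschitz g ->
  bounded_lipschitz (fun x => f x * g x).
Proof.
move=> [M M0 hf] [N N0 hg]; exists (2 * (M * N) + M * N) => [|x y].
  by rewrite addr_ge0 ?mulr_ge0.
have [f1 f2] := hf x y; have [g1 g2] := hg x y; have [f3 _] := hf y x.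
have MN : 0 <= M * N by rewrite mulr_ge0.
split.
  rewrite normrM (@le_trans _ _ (M * N)) ?ler_pM//.
  by rewrite lerDr mulr_ge0.
have -> : f x * g x - f y * g y = (f x - f y) * g x + f y * (g x - g y) by ring.
rewrite (le_trans (ler_normD _ _))// !normrM.
apply: (@le_trans _ _ (M * `|x - y| * N + M * (N * `|x - y|))).
  by apply: lerD; apply: ler_pM.
have -> : M * `|x - y| * N + M * (N * `|x - y|) = 2 * (M * N) * `|x - y| by ring.
by rewrite ler_wpM2r// lerDl.
Qed.

Lemma bounded_lipschitz_prod (I : finType) (f : I -> R -> R) :
  (forall i, bounded_lipschitz (f i)) -> bounded_lipschitz (fun x => \prod_i f i x).
Proof.
move=> hf; suff H (s : seq I) : bounded_lipschitz (fun x => \prod_(i <- s) f i x) by exact: H.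
elim: s => [|i s IH].
  rewrite (_ : (fun x => _) = cst 1); first exact: bounded_lipschitz_cst.
  by apply/funext => x; rewrite big_nil.
rewrite (_ : (fun x => _) = fun x => f i x * \prod_(j <- s) f j x).
  exact: bounded_lipschitz_mul.
by apply/funext => x; rewrite big_cons.
Qed.

Lemma bounded_lipschitz_affine f (u v : R) : bounded_lipschitz f ->
  bounded_lipschitz (fun x => f (u + x * v)).
Proof.
move=> [M M0 hf]; exists (M + M * `|v|) => [|x y]; first by rewrite addr_ge0 ?mulr_ge0.
have [f1 f2] := hf (u + x * v) (u + y * v); split.
  by rewrite (le_trans f1)// lerDl mulr_ge0.
rewrite (le_trans f2)//.
have -> : u + x * v - (u + y * v) = (x - y) * v by ring.
rewrite normrM mulrDl [`|x - y| * _]mulrC mulrA lerDr mulr_ge0//.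
Qed.

Lemma bounded_lipschitz_bump (a : R) : 0 < a -> bounded_lipschitz (bump a).
Proof.
move=> a0.
pose clip s : R := Num.max (- a) (Num.min a s).
have hc : bounded_lipschitz clip.
  exists (a + 1) => [|x y]; first by rewrite addr_ge0// ltW.
  have cases s : [\/ s <= - a /\ clip s = - a, - a <= s <= a /\ clip s = s |
      a <= s /\ clip s = a].
    rewrite /clip; have [h1|/ltW h1] := leP a s.
      by apply: Or33; split => //; rewrite (max_idPr _)//; lra.
    have [h2|/ltW h2] := leP (- a) s; last by apply: Or31.
    by apply: Or32; split=> //; apply/andP; split.
  have key : `|clip x| <= a /\ `|clip x - clip y| <= `|x - y|.
    have n1 : x - y <= `|x - y| by exact: ler_norm.
    have n2 : y - x <= `|x - y| by rewrite distrC; exact: ler_norm.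
    rewrite !ler_norml.
    have [[h1 ->]|[/andP[h1 h1'] ->]|[h1 ->]] := cases x;
    have [[h2 ->]|[/andP[h2 h2'] ->]|[h2 ->]] := cases y;
    split; apply/andP; split; lra.
  have [k1 k2] := key; split; first by rewrite (le_trans k1)// lerDl.
  by rewrite (le_trans k2)// mulrDl mul1r lerDr mulr_ge0// ltW.
have -> : bump a = fun s => 15 / (16 * a ^+ 5) *
    ((a ^+ 2 + (-1) * (clip s * clip s)) * (a ^+ 2 + (-1) * (clip s * clip s))).
  apply/funext => s; rewrite /bump expr2.
  suff -> : Num.max 0 (a ^+ 2 - s ^+ 2) = a ^+ 2 + (-1) * (clip s * clip s) by [].
  rewrite mulN1r -expr2 /clip.
  have [h|h] := ltP `|s| a.
    rewrite max0_inside//; move: h; rewrite ltr_norml => /andP[h1 h2].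
    by rewrite (min_idPr (ltW h2)) (max_idPr (ltW h1)).
  rewrite max0_outside//; have [h1|h1] := leP a s.
    by rewrite (max_idPr _) ?subrr//; lra.
  have [h2|h2] := leP (- a) s; last by rewrite sqrrN subrr.
  suff -> : s = - a by rewrite sqrrN subrr.
  move: h; rewrite ler_normr => /orP[]; lra.
have h := bounded_lipschitz_add (bounded_lipschitz_cst (a ^+ 2))
  (bounded_lipschitz_mul (bounded_lipschitz_cst (-1)) (bounded_lipschitz_mul hc hc)).
exact: (bounded_lipschitz_mul (bounded_lipschitz_cst _) (bounded_lipschitz_mul h h)).
Qed.

End bounded_lipschitz.
Section product_prior.
Context {R : realType} {d : nat}.
Variables (a : R) (m : 'rV[R]_d).
Hypothesis a0 : 0 < a.
Let lam := lebesgue_rV R d.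

Definition bump_prior (t : 'rV[R]_d) : R := \prod_i bump a (t 0 i - m 0 i).

Lemma bump_prior_ge0 t : 0 <= bump_prior t.
Proof. by apply: prodr_ge0 => i _; exact: bump_ge0. Qed.

Lemma bump_prior_gt0 t : (0 < bump_prior t) = [forall i, `|t 0 i - m 0 i| < a].
Proof.
apply/idP/forallP => [q0 i|h].
  rewrite -bump_gt0// lt_neqAle bump_ge0// andbT eq_sym; apply: contraTneq q0 => b0.
  by rewrite /bump_prior (bigD1 i)//= b0 mul0r ltxx.
by apply: prodr_gt0 => i _; rewrite bump_gt0.
Qed.

Lemma bump_prior_outside (t : 'rV[R]_d) i : a <= `|t 0 i - m 0 i| -> bump_prior t = 0.
Proof. by move=> h; rewrite /bump_prior (bigD1 i)//= bump_outside// mul0r. Qed.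

Lemma bump_prior_gradient (t : 'rV[R]_d) i : gradient bump_prior t 0 i =
  dbump a (t 0 i - m 0 i) * \prod_(k | k != i) bump a (t 0 k - m 0 k).
Proof.
rewrite mxE /derive; apply: cvg_lim => //=.
set rest := \prod_(k | _) _; set x := t 0 i - m 0 i.
have E (h : R) : h^-1 *: (bump_prior (h *: delta_mx 0 i + t) - bump_prior t) =
    h^-1 *: (bump a (h *: (1 : R) + x) - bump a x) * rest.
  rewrite /bump_prior (bigD1 i)//= [X in _ *: (_ - X)](bigD1 i)//= -/rest -/x.
  rewrite !mxE !eqxx/= mulr1 -addrA -/x [h *: (1 : R)]mulr1.
  rewrite (eq_bigr (fun k => bump a (t 0 k - m 0 k))); last first.
    by move=> k ki; rewrite !mxE/= (negbTE ki) mulr0 add0r.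
  by rewrite -/rest -mulrBl scalerAl.
under eq_fun do rewrite E.
apply: cvgM; last exact: cvg_cst.
have [hd he] := is_derive_bump a x.
rewrite -he; exact: hd.
Qed.

Lemma bump_prior_integral :
  lam.-integrable setT (fun t => (bump_prior t)%:E) /\
  (\int[lam]_t (bump_prior t)%:E = 1)%E.
Proof.
have h (i : 'I_d) : (@lebesgue_measure R).-integrable setT
    (fun x => (bump a (x - m 0 i))%:E) by have [] := bump_integral (m 0 i) a0.
have [h1 h2] := lebesgue_rV_prod h; split=> //.
rewrite h2 big1// => i _; by have [] := bump_integral (m 0 i) a0.
Qed.

Let information_factor (i j k : 'I_d) (s : R) : R :=
  if i == j then (if k == i then bump_information a s else bump a s)
  else if (k == i) || (k == j) then dbump a s else bump a s.

Let prior_information_prod i j (t : 'rV[R]_d) : prior_information_entry bump_prior i j t =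
  \prod_k information_factor i j k (t 0 k - m 0 k).
Proof.
rewrite /prior_information_entry !bump_prior_gradient bump_prior_gt0.
case: ifPn => [/forallP h|]; last first.
  rewrite negb_forall => /existsP[k]; rewrite -leNgt => hk.
  rewrite (bigD1 k)//= /information_factor.
  by case: ifP => _; case: ifP => _;
    rewrite ?bump_information_outside ?dbump_outside ?bump_outside// mul0r.
have b0 k : bump a (t 0 k - m 0 k) != 0 by rewrite gt_eqF// bump_gt0.
have [<-|ij] := eqVneq i j.
  have -> : bump_prior t = bump a (t 0 i - m 0 i) *
      \prod_(k | k != i) bump a (t 0 k - m 0 k) by rewrite /bump_prior (bigD1 i).
  have -> : \prod_k information_factor i i k (t 0 k - m 0 k) =
      bump_information a (t 0 i - m 0 i) *
      \prod_(k | k != i) bump a (t 0 k - m 0 k).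
    rewrite (bigD1 i)//= /information_factor !eqxx; congr (_ * _).
    by apply: eq_bigr => k ki; rewrite (negbTE ki).
  have r0 : \prod_(k | k != i) bump a (t 0 k - m 0 k) != 0.
    by apply/prodf_neq0 => k _.
  rewrite /bump_information bump_gt0// h.
  move: (\prod_(k | _) _) (bump _ _) (dbump _ _) r0 (b0 i) => x y z x0 y0.
  by field; rewrite x0 y0.
have ji : j != i by rewrite eq_sym.
have -> : \prod_(k | k != i) bump a (t 0 k - m 0 k) = bump a (t 0 j - m 0 j) *
    \prod_(k | (k != i) && (k != j)) bump a (t 0 k - m 0 k).
  by rewrite (bigD1 j).
have -> : \prod_(k | k != j) bump a (t 0 k - m 0 k) = bump a (t 0 i - m 0 i) *
    \prod_(k | (k != i) && (k != j)) bump a (t 0 k - m 0 k).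
  by rewrite (bigD1 i)//=; congr (_ * _); apply: eq_bigl => k; rewrite andbC.
have -> : bump_prior t = bump a (t 0 i - m 0 i) * (bump a (t 0 j - m 0 j) *
    \prod_(k | (k != i) && (k != j)) bump a (t 0 k - m 0 k)).
  by rewrite /bump_prior (bigD1 i)//= (bigD1 j).
have -> : \prod_k information_factor i j k (t 0 k - m 0 k) =
    dbump a (t 0 i - m 0 i) * (dbump a (t 0 j - m 0 j) *
    \prod_(k | (k != i) && (k != j)) bump a (t 0 k - m 0 k)).
  rewrite (bigD1 i)//= (bigD1 j)//= /information_factor (negbTE ij) !eqxx orbT.
  congr (_ * (_ * _)); apply: eq_bigr => k /andP[ki kj].
  by rewrite (negbTE ki) (negbTE kj).
have r0 : \prod_(k | (k != i) && (k != j)) bump a (t 0 k - m 0 k) != 0.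
  by apply/prodf_neq0 => k _.
move: (\prod_(k | _) _) (bump a (t 0 i - _)) (bump a (t 0 j - _)) (dbump _ _)
  (dbump _ _) r0 (b0 i) (b0 j) => x y z y' z' x0 y0 z0.
by field; rewrite x0 y0 z0.
Qed.

Lemma bump_prior_information i j :
  lam.-integrable setT (fun t => (prior_information_entry bump_prior i j t)%:E) /\
  (\int[lam]_t (prior_information_entry bump_prior i j t)%:E =
    ((10 / a ^+ 2) *+ (i == j))%:E)%E.
Proof.
have h (k : 'I_d) : (@lebesgue_measure R).-integrable setT
      (fun x => (information_factor i j k (x - m 0 k))%:E) /\
    \int[@lebesgue_measure R]_x information_factor i j k (x - m 0 k) =
      if i == j then (if k == i then 10 / a ^+ 2 else 1)
      else if (k == i) || (k == j) then 0 else 1.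
  rewrite /information_factor; case: ifP => _; case: ifP => _.
  - exact: bump_information_integral.
  - exact: bump_integral.
  - exact: dbump_integral.
  - exact: bump_integral.
have [h1 h2] := lebesgue_rV_prod (fun k => (h k).1).
have E : (fun t => (prior_information_entry bump_prior i j t)%:E) =
    (fun t : 'rV[R]_d => (\prod_k information_factor i j k (t 0 k - m 0 k))%:E).
  by apply/funext => t; rewrite prior_information_prod.
rewrite E; split => //; rewrite h2; congr (_%:E).
rewrite (eq_bigr _ (fun k _ => (h k).2)) (bigD1 i)//= eqxx/=.
case: ifP => ij; last by rewrite mul0r.
by rewrite big1 ?mulr1// => k /negbTE ->.
Qed.

Lemma bump_prior_measurable : measurable_fun [set: 'rV[R]_d] bump_prior.
Proof.
by have [/integrableP[/measurable_EFinP]] := bump_prior_integral.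
Qed.

Lemma bump_prior_ray (t u : 'rV[R]_d) :
  bounded_lipschitz (fun s => bump_prior (t + s *: u)).
Proof.
have -> : (fun s => bump_prior (t + s *: u)) =
    fun s => \prod_i bump a ((t 0 i - m 0 i) + s * u 0 i).
  by apply/funext => s; apply: eq_bigr => i _; rewrite !mxE addrAC.
apply: bounded_lipschitz_prod => i.
by apply: bounded_lipschitz_affine; exact: bounded_lipschitz_bump.
Qed.

End product_prior.

Lemma lipschitz_abs_continuous {R : realType} (f : R -> R) (M x y : R) :
  0 <= M -> (forall s t, `|f s - f t| <= M * `|s - t|) -> abs_continuous x y f.
Proof.
move=> M0 hM e e0; exists (e / (M + 1)).
  by rewrite divr_gt0// ltr_wpDl.
move=> n u v huv _ small.
apply: (@le_lt_trans _ _ (\sum_i (M * (v i - u i)))).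
  apply: ler_sum => i _; have h := hM (v i) (u i).
  have [_ uv _] := huv i.
  by rewrite (le_trans h)// ger0_norm ?subr_ge0.
rewrite -mulr_sumr; have S0 : 0 <= \sum_i (v i - u i).
  by apply: sumr_ge0 => i _; have [_ uv _] := huv i; rewrite subr_ge0.
apply: (@le_lt_trans _ _ ((M + 1) * \sum_i (v i - u i))).
  by rewrite mulrDl mul1r lerDl.
by rewrite mulrC -ltr_pdivlMr// ltr_wpDl.
Qed.

Lemma bounded_lipschitz_cvg0 {R : realType} (f : R -> R) :
  bounded_lipschitz f -> f s @[s --> (0 : R)^'+] --> f 0.
Proof.
move=> [M M0 hM]; apply: cvg_at_right_filter.
apply/cvgrPdist_le => e e0.
have e1 : 0 < e / (M + 1) by rewrite divr_gt0// ltr_wpDl.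
near=> s.
have [_ h] := hM 0 s; rewrite (le_trans h)// sub0r normrN.
apply: (@le_trans _ _ ((M + 1) * `|s|)).
  by rewrite mulrDl mul1r lerDl.
rewrite mulrC -ler_pdivlMr ?ltr_wpDl//.
Unshelve. all: by end_near. Qed.
Section concentrated.
Context {d} {T : measurableType d} {R : realType}.
Variables (Q : probability T R) (S : set T).
Hypothesis mS : measurable S.
Hypothesis Q1 : Q S = 1%E.

Lemma concentrated_integrable (f : T -> R) (c e : R) : measurable_fun S f ->
  (forall t, S t -> `|f t - c| <= e) -> Q.-integrable S (fun t => (f t)%:E).
Proof.
move=> mf fe; apply: measurable_bounded_integrable => //.
  exact: le_lt_trans (probability_le1 Q mS) (ltry 1).
exists (`|c| + e); split; first exact: num_real.
move=> y My t St /=; apply: le_trans (ltW My).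
have -> : f t = c + (f t - c) by ring.
by rewrite (le_trans (ler_normD _ _))// lerD2l fe.
Qed.

Lemma concentrated_cst (c : R) : \int[Q]_(t in S) c = c.
Proof.
rewrite Rintegral_cst//; have := congr1 fine Q1.
by move: (fine _) => q ->; rewrite mulr1.
Qed.

Lemma concentrated_mean (f : T -> R) (c e : R) : measurable_fun S f ->
  (forall t, S t -> `|f t - c| <= e) -> `|\int[Q]_(t in S) f t - c| <= e.
Proof.
move=> mf fe; have fi := concentrated_integrable mf fe.
have ci k : Q.-integrable S (EFin \o (cst k : T -> R)).
  apply: (@concentrated_integrable (cst k) k 0); first exact: measurable_cst.
  by move=> t _; rewrite subrr normr0.
have h1 : \int[Q]_(t in S) (c - e) <= \int[Q]_(t in S) f t.
  apply: le_Rintegral (ci (c - e)) fi _ => // t St.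
  by have := fe t St; rewrite ler_distl => /andP[].
have h2 : \int[Q]_(t in S) f t <= \int[Q]_(t in S) (c + e).
  apply: le_Rintegral fi (ci (c + e)) _ => // t St.
  by have := fe t St; rewrite ler_distl => /andP[].
move: h1 h2; rewrite !concentrated_cst => h1 h2.
by rewrite ler_distl h1 h2.
Qed.

End concentrated.
Arguments concentrated_integrable {d T R Q S} mS {f c e}.
Arguments concentrated_cst {d T R Q S} mS Q1.
Arguments concentrated_mean {d T R Q S} mS Q1 {f c e}.

Section quadratic_forms.
Context {R : realType} {d : nat}.
Implicit Types (A M N : 'M[R]_d) (v w y : 'rV[R]_d).

Lemma qformE A y : (y *m A *m y^T) 0 0 = \sum_j \sum_i y 0 i * A i j * y 0 j.
Proof.
rewrite mxE; apply: eq_bigr => j _.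
by rewrite !mxE mulr_suml.
Qed.

Lemma qform_close M N y (e : R) : (forall i j, `|M i j - N i j| <= e) ->
  `|(y *m M *m y^T) 0 0 - (y *m N *m y^T) 0 0| <= e * (d%:R * enorm y) ^+ 2.
Proof.
move=> h; rewrite !qformE -sumrB.
have -> : e * (d%:R * enorm y) ^+ 2 = \sum_(j < d) \sum_(i < d) e * enorm y ^+ 2.
  by rewrite !sumr_const card_ord -mulrnA -[RHS]mulr_natl natrM; ring.
rewrite (le_trans (ler_norm_sum _ _ _))//; apply: ler_sum => j _.
rewrite -sumrB (le_trans (ler_norm_sum _ _ _))//; apply: ler_sum => i _.
have -> : y 0 i * M i j * y 0 j - y 0 i * N i j * y 0 j =
  (M i j - N i j) * (y 0 i * y 0 j) by ring.
rewrite normrM; apply: ler_pM => //.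
by rewrite normrM expr2; apply: ler_pM => //; exact: coord_le_enorm.
Qed.

Lemma posdef_unitmx A : posdef A -> A \in unitmx.
Proof.
move=> [_ pos]; rewrite -row_free_unit -kermx_eq0; apply/eqP/row_matrixP => i.
rewrite row0; apply/eqP; apply: contraTT isT => y0.
have := pos _ y0; rewrite -row_mul mulmx_ker row0 mul0mx mxE ltxx //.
Qed.

(** The inverse quadratic form as a maximum over test directions. *)
Lemma qform_inv_ge A v w : posdef A ->
  2 * dotp v w - (w *m A *m w^T) 0 0 <= qform_inv v A.
Proof.
move=> pA; have uA := posdef_unitmx pA; have [sA pos] := pA.
pose y := v *m invmx A - w.
have y0 : 0 <= (y *m A *m y^T) 0 0.
  have [->|] := eqVneq y 0; first by rewrite !mul0mx mxE.
  by move=> /pos/ltW.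
rewrite -subr_ge0; move: y0; congr (0 <= _).
have tA : A *m (invmx A)^T = 1%:M.
  by rewrite -[X in X *m _]sA -trmx_mul mulVmx// trmx1.
have E : y *m A *m y^T = v *m invmx A *m v^T - v *m w^T - w *m v^T + w *m A *m w^T.
  have -> : y *m A = v - w *m A by rewrite /y mulmxBl -mulmxA mulVmx ?mulmx1.
  rewrite /y linearB/= trmx_mul.
  have wA : w *m A *m ((invmx A)^T *m v^T) = w *m v^T.
    by rewrite -mulmxA (mulmxA A) tA mul1mx.
  rewrite mulmxBr !mulmxBl wA.
  have -> : v *m ((invmx A)^T *m v^T) = v *m invmx A *m v^T.
    have sI : (invmx A)^T = invmx A.
      by rewrite -[LHS]mul1mx -(mulVmx uA) -mulmxA tA mulmx1.
    by rewrite sI mulmxA.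
  move: (v *m invmx A *m v^T) (w *m v^T) (v *m w^T) (w *m A *m w^T) => a b c e.
  by apply/matrixP => i j; rewrite !mxE; ring.
rewrite E /qform_inv [in RHS]mulr_natl mulr2n {2}dotpC !dotp_mx !mxE.
ring.
Qed.

End quadratic_forms.

Section affine_functions.
Context {R : realType} {d : nat}.
Variables (v m : 'rV[R]_d) (k : R).

Definition affine (t : 'rV[R]_d) : R := k + dotp v (t - m).

Lemma affine_ray t u s : affine (t + s *: u) = affine t + s * dotp v u.
Proof.
have -> : affine (t + s *: u) = k + dotp v ((t - m) + s *: u) by rewrite addrAC.
by rewrite dotpDr dotpZr addrA.
Qed.

Lemma gradient_affine t : gradient affine t = v.
Proof.
apply/rowP => i; rewrite mxE /derive.
have -> : v 0 i = dotp v (delta_mx 0 i).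
  rewrite /dotp (bigD1 i)//= mxE !eqxx mulr1 big1 ?addr0// => j ji.
  by rewrite mxE (negbTE ji) mulr0.
apply: cvg_lim => //=; apply: cvg_near_cst; near=> h.
have h0 : h != 0 by near: h; exact: nbhs_dnbhs_neq.
rewrite /= [h *: _ + t]addrC affine_ray [X in _ *: X]addrAC subrr add0r.
by rewrite /GRing.scale/= mulrA mulVf// mul1r.
Unshelve. all: by end_near. Qed.

Lemma abs_continuous_affine S : abs_continuous_on S affine.
Proof.
move=> t r r0 _ u _; apply: (@lipschitz_abs_continuous _ _ `|dotp v u|) => // x y.
rewrite !affine_ray [leRHS]mulrC -normrM.
by have -> : affine t + x * dotp v u - (affine t + y * dotp v u) =
  (x - y) * dotp v u by ring.
Qed.

Lemma continuous_affine : continuous affine.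
Proof.
move=> t.
suff h (s : seq 'I_d) : {for t, continuous (fun x : 'rV[R]_d =>
    k + \sum_(i <- s) v 0 i * (x 0 i - m 0 i))}.
  rewrite (_ : affine = fun x : 'rV[R]_d =>
    k + \sum_(i <- index_enum 'I_d) v 0 i * (x 0 i - m 0 i)); first exact: h.
  by apply/funext => x; rewrite /affine /dotp; congr (_ + _); apply: eq_bigr => i _; rewrite [(x - m) 0 i]mxE [(- m) 0 i]mxE.
elim: s => [|i s IH].
  rewrite (_ : (fun x : 'rV[R]_d => k + \sum_(i <- [::]) v 0 i * (x 0 i - m 0 i)) = cst k); first exact: cst_continuous.
  by apply/funext => x; rewrite big_nil addr0.
rewrite (_ : (fun x : 'rV[R]_d => k + \sum_(i <- i :: s) v 0 i * (x 0 i - m 0 i)) =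
    fun x : 'rV[R]_d => v 0 i * (x 0 i - m 0 i) +
    (k + \sum_(i <- s) v 0 i * (x 0 i - m 0 i))); last first.
  by apply/funext => x; rewrite big_cons addrCA.
apply: (@continuousD _ _ _ (fun x : 'rV[R]_d => v 0 i * (x 0 i - m 0 i))) => //.
apply: (@continuousM _ _ (cst (v 0 i)) (fun x : 'rV[R]_d => x 0 i - m 0 i)).
  exact: cst_continuous.
apply: (@continuousB _ _ _ (fun x : 'rV[R]_d => x 0 i) (cst (m 0 i))).
  exact: coord_continuous.
exact: cst_continuous.
Qed.

Lemma affine_bounded t : `|affine t - k| <= \sum_i `|v 0 i| * enorm (t - m).
Proof.
rewrite /affine addrC addKr /dotp (le_trans (ler_norm_sum _ _ _))//.
by apply: ler_sum => i _; rewrite normrM ler_wpM2l// coord_le_enorm.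
Qed.

End affine_functions.
Section van_trees_bound.
Context {R : realType} {d : nat}.
Variables (I : 'rV[R]_d -> 'M[R]_d) (psi : 'rV[R]_d -> R) (theta0 : 'rV[R]_d).
Variables (n : nat) (c e eta : R).
Hypothesis d_gt0 : (0 < d)%N.
Hypothesis n0 : (0 < n)%N.
Hypothesis c0 : 0 < c.
Hypothesis e0 : 0 <= e.
Let v := gradient psi theta0.
Let S := local_ball theta0 n c.
Let r := c / Num.sqrt n%:R.
Let a := r / (2 * d%:R).
Hypothesis I_sym : forall t, (I t)^T = I t.
Hypothesis I0_ge0 : forall y : 'rV[R]_d, 0 <= (y *m I theta0 *m y^T) 0 0.
Hypothesis psi_near : forall t, S t -> {for t, continuous psi} /\
  `|psi t - psi theta0 - dotp v (t - theta0)| <= e * enorm (t - theta0).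
Hypothesis I_near : forall t, S t -> forall i j,
  {for t, continuous (fun t => I t i j)} /\ `|I t i j - I theta0 i j| <= eta.
Hypothesis eta_small : eta * c ^+ 2 < 40.

Let r0 : 0 < r. Proof. by rewrite divr_gt0// sqrtr_gt0 ltr0n. Qed.
Let dR0 : 0 < d%:R :> R. Proof. by rewrite ltr0n. Qed.
Let a0 : 0 < a. Proof. by rewrite divr_gt0// mulr_gt0. Qed.
Let nR0 : 0 < n%:R :> R. Proof. by rewrite ltr0n. Qed.
Let lam := lebesgue_rV R d.
Let q := bump_prior a theta0.
Let phi := affine v theta0 (psi theta0).

Let nr2 : n%:R * r ^+ 2 = c ^+ 2.
Proof.
by rewrite /r exprMn exprVn sqr_sqrtr ?ler0n// mulrCA mulfV ?mulr1// gt_eqF//.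
Qed.

Let oS : open S. Proof. by rewrite /S; exact: open_eball. Qed.
Let mS : measurable S. Proof. by apply: open_measurable_rV; exact: oS. Qed.

Let q_support t : 0 < q t -> S t.
Proof.
rewrite bump_prior_gt0// => /forallP h.
have hle i : `|(t - theta0) 0 i| <= a by rewrite !mxE ltW.
apply: le_lt_trans (enorm_lt a0 hle d_gt0) _; rewrite -/r.
have -> : d%:R * a = r / 2.
  by rewrite /a; field; rewrite gt_eqF.
by rewrite ltr_pdivrMr// ltr_pMr// ltr1n.
Qed.

Let q_out t : ~ S t -> q t = 0.
Proof.
move=> St; apply/eqP; rewrite eq_le bump_prior_ge0// andbT leNgt.
by apply/negP => /q_support.
Qed.

Let information_out i j t : ~ S t -> prior_information_entry q i j t = 0.
Proof.
by move=> St; rewrite /prior_information_entry ifN// -leNgt q_out.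
Qed.

Let restrict_S (f : 'rV[R]_d -> R) : (forall t, ~ S t -> f t = 0) ->
  forall A, (\int[lam]_(t in A `&` S) (f t)%:E = \int[lam]_(t in A) (f t)%:E)%E.
Proof.
move=> f0 A; rewrite integral_mkcondr; apply: eq_integral => t _.
by rewrite patchE; case: ifPn => //; rewrite notin_setE => /f0 ->.
Qed.

Let Q_exists : exists Q : probability 'rV[R]_d R, forall A, measurable A ->
  Q A = (\int[lam]_(t in A `&` S) (q t)%:E)%E.
Proof.
have [_ q1] := bump_prior_integral theta0 a0.
have [Q hQ] := probability_of_density (bump_prior_ge0 theta0 a0)
  (bump_prior_measurable theta0 a0) q1.
by exists Q => A mA; rewrite hQ// restrict_S//; exact: q_out.
Qed.

Let prior_informationE : prior_information S q = (10 / a ^+ 2)%:M.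
Proof.
apply/matrixP => i j; rewrite !mxE /Rintegral -[X in integral _ X _]setTI.
have [_ h] := bump_prior_information theta0 a0 i j.
by rewrite restrict_S ?h//; exact: information_out.
Qed.

Let S_bound t : S t -> enorm (t - theta0) <= r.
Proof. by move=> /ltW. Qed.

Section with_prior.
Variable Q : probability 'rV[R]_d R.
Hypothesis hQ : forall A, measurable A ->
  Q A = (\int[lam]_(t in A `&` S) (q t)%:E)%E.

Let Q1 : Q S = 1%E.
Proof.
have [_ q1] := bump_prior_integral theta0 a0.
rewrite hQ// setIid -[X in integral _ X _]setTI restrict_S//; exact: q_out.
Qed.

Let mI i j : measurable_fun S (fun t => I t i j).
Proof.
by apply: continuous_measurable_rV => // t St; have [] := I_near St i j.
Qed.

Let mpsi : measurable_fun S psi.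
Proof.
by apply: continuous_measurable_rV => // t St; have [] := psi_near St.
Qed.

Let mphi : measurable_fun S phi.
Proof.
by apply: continuous_measurable_rV => // t St; exact: continuous_affine.
Qed.

Let gap_bound t : S t -> `|(psi t - phi t) ^+ 2 - 0| <= (e * r) ^+ 2.
Proof.
move=> St; have [_ h] := psi_near St; rewrite subr0 normrX.
have er : 0 <= e * r by rewrite mulr_ge0// ltW.
rewrite lerXn2r ?nnegrE//.
rewrite /phi /affine opprD addrA (le_trans h)// ler_wpM2l// S_bound//.
Qed.

Let mgap : measurable_fun S (fun t => (psi t - phi t) ^+ 2).
Proof. by apply: measurable_funX; exact: measurable_funB. Qed.

Lemma bump_prior_nice : nice_prior I S phi Q q.
Proof.
have [qi _] := bump_prior_integral theta0 a0.
have cst_int k : Q.-integrable S (fun t : 'rV[R]_d => k%:E).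
  apply: (concentrated_integrable mS (f := cst k) (c := k) (e := 0)); first exact: measurable_cst.
  by move=> t _; rewrite subrr normr0.
split.
- by move=> t _; exact: bump_prior_ge0.
- by apply: measurable_funTS; exact: bump_prior_measurable.
- exact: hQ.
- move=> t s s0 _ u _.
  have [M M0 hM] := bump_prior_ray theta0 a0 t u.
  by apply: (@lipschitz_abs_continuous _ _ M) => // x y; exact: (hM x y).2.
- move=> i j; have [h _] := bump_prior_information theta0 a0 i j.
  exact: integrableS h.
- rewrite prior_informationE; split; first exact: tr_scalar_mx.
  move=> y y0; rewrite mul_mx_scalar -scalemxAl mxE -dotp_mx.
  rewrite mulr_gt0 ?divr_gt0 ?exprn_gt0//.
  rewrite lt_neqAle dotp_ge0 andbT eq_sym; apply: contra_neq y0 => yy.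
  apply/rowP => i; rewrite mxE; apply/eqP; rewrite -normr_le0.
  by rewrite (le_trans (coord_le_enorm _ _))// /enorm yy sqrtr0.
- apply: (concentrated_integrable mS (f := phi) (c := psi theta0) (e := \sum_i `|v 0 i| * r)) => //.
  move=> t St; rewrite (le_trans (affine_bounded _ _ _ _))//.
  by apply: ler_sum => i _; rewrite ler_wpM2l// S_bound.
- move=> i; rewrite (_ : (fun t => _) = cst (v 0 i)); first exact: measurable_cst.
  by apply/funext => t; rewrite gradient_affine.
- rewrite (_ : (fun t => _) = fun=> (enorm v)%:E); first exact: cst_int.
  by apply/funext => t; rewrite gradient_affine.
- exact: mI.
- have h : Q.-integrable S (fun t => (\tr (I t))%:E).
    apply: (concentrated_integrable mS (f := fun t => \tr (I t)) (c := \tr (I theta0)) (e := \sum_(i < d) eta)).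
      apply: measurable_sum => i; exact: mI.
    move=> t St; rewrite /mxtrace -sumrB (le_trans (ler_norm_sum _ _ _))//.
    by apply: ler_sum => i _; have [] := I_near St i i.
  have := integrable_fin_num mS h; rewrite fin_numElt => /andP[_]; exact.
- move=> t [_ St] i b ray _.
  have nS : ~ S t by move=> h; apply: St; rewrite /interior; exact: oS.
  have h := bounded_lipschitz_cvg0
    (bump_prior_ray theta0 a0 t ((-1) ^+ b *: delta_mx 0 i)).
  have qt : bump_prior a theta0 t = 0 by exact: q_out nS.
  rewrite scale0r addr0 qt in h.
  have -> : (fun s => q (ray s)) = (fun s => q (t + s *: ((-1) ^+ b *: delta_mx 0 i))).
    by apply/funext => s; rewrite /ray scalerA.
  exact: h.
Qed.

Lemma van_trees_information_ge (w : 'rV[R]_d) :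
  2 * dotp v w - (w *m I theta0 *m w^T) 0 0
    - (eta + 40 / c ^+ 2) * (d%:R * enorm w) ^+ 2 <=
  n%:R * van_trees_information I S phi Q q n.
Proof.
pose M := \matrix_(i, j) \int[Q]_(t in S) I t i j.
have M_near i j : `|M i j - I theta0 i j| <= eta.
  rewrite mxE; apply: concentrated_mean => // t St; by have [] := I_near St i j.
have jE : 10 / a ^+ 2 = n%:R * (40 / c ^+ 2 * d%:R ^+ 2).
  rewrite -nr2 /a; field; rewrite !gt_eqF//.
have Msym : M^T = M.
  apply/matrixP => i j; rewrite !mxE; apply: eq_Rintegral => t _.
  by rewrite -[in LHS]I_sym mxE.
rewrite /van_trees_information prior_informationE -/M.
rewrite (_ : \row_i _ = v); last first.
  apply/rowP => i; rewrite mxE; under eq_Rintegral do rewrite gradient_affine.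
  exact: concentrated_cst.
set A := (X in qform_inv _ X).
have AE (y : 'rV[R]_d) : (y *m A *m y^T) 0 0 =
    n%:R * (40 / c ^+ 2 * (d%:R * enorm y) ^+ 2 + (y *m M *m y^T) 0 0).
  rewrite /A mulmxDr mulmxDl mxE mul_mx_scalar -scalemxAr -!scalemxAl.
  rewrite [X in X + _]mxE [X in _ + X]mxE -dotp_mx -enorm_sqr jE; ring.
have c2 : 0 < c ^+ 2 by rewrite exprn_gt0.
have M_ge (y : 'rV[R]_d) : (y *m I theta0 *m y^T) 0 0 - eta * (d%:R * enorm y) ^+ 2 <= (y *m M *m y^T) 0 0.
  by have := qform_close y M_near; rewrite ler_distl => /andP[].
have M_le (y : 'rV[R]_d) : (y *m M *m y^T) 0 0 <= (y *m I theta0 *m y^T) 0 0 + eta * (d%:R * enorm y) ^+ 2.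
  by have := qform_close y M_near; rewrite ler_distl => /andP[].
have pA : posdef A.
  split.
    by rewrite /A linearD/= linearZ/= Msym tr_scalar_mx.
  move=> y y0; rewrite AE pmulr_rgt0//.
  have ny : 0 < (d%:R * enorm y) ^+ 2.
    rewrite exprn_gt0// mulr_gt0// lt_neqAle enorm_ge0 andbT eq_sym.
    apply: contra_neq y0 => y0; apply/rowP => i; rewrite mxE; apply/eqP.
    by rewrite -normr_le0 -y0 coord_le_enorm.
  have small : eta < 40 / c ^+ 2 by rewrite ltr_pdivlMr.
  have h1 := M_ge y; have h2 := I0_ge0 y.
  apply: (@lt_le_trans _ _ ((40 / c ^+ 2 - eta) * (d%:R * enorm y) ^+ 2)).
    by rewrite mulr_gt0// subr_gt0.
  rewrite mulrBl lerD2l; apply: le_trans h1; by rewrite lerDr.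
have h := qform_inv_ge v (n%:R^-1 *: w) pA.
apply: le_trans (ler_wpM2l (ltW nR0) h).
have -> : (n%:R^-1 *: w *m A *m (n%:R^-1 *: w)^T) 0 0 =
    n%:R^-1 * (40 / c ^+ 2 * (d%:R * enorm w) ^+ 2 + (w *m M *m w^T) 0 0).
  rewrite linearZ/= -scalemxAr -!scalemxAl mxE [X in _ * X]mxE AE.
  by field; rewrite !gt_eqF.
rewrite dotpZr.
have -> : n%:R * (2 * (n%:R^-1 * dotp v w) - n%:R^-1 *
    (40 / c ^+ 2 * (d%:R * enorm w) ^+ 2 + (w *m M *m w^T) 0 0)) =
  2 * dotp v w - (40 / c ^+ 2 * (d%:R * enorm w) ^+ 2 + (w *m M *m w^T) 0 0).
  by field; rewrite !gt_eqF.
have := M_le w; rewrite [(eta + _) * _]mulrDl.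
move=> h'; rewrite -!addrA lerD2l -!opprD lerN2.
set z := 40 / _ * _; set x := eta * _.
by rewrite (_ : _ + (x + z) = z + ((w *m I theta0 *m w^T) 0 0 + x)) ?lerD2l//; ring.
Qed.

Lemma affine_gap_le : n%:R * \int[Q]_(t in S) ((psi t - phi t) ^+ 2) <= (e * c) ^+ 2.
Proof.
have := concentrated_mean mS Q1 mgap gap_bound.
rewrite subr0 => h; have := le_trans (ler_norm _) h.
move=> /(ler_wpM2l (ltW nR0)).
have -> : (e * c) ^+ 2 = n%:R * (e * r) ^+ 2 by rewrite exprMn -nr2 [(e * r) ^+ 2]exprMn mulrCA.
exact.
Qed.

Lemma affine_gap_integrable : Q.-integrable S (fun t => ((psi t - phi t) ^+ 2)%:E).
Proof. exact: (concentrated_integrable mS mgap gap_bound). Qed.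

End with_prior.

Lemma L1_ge (w : 'rV[R]_d) : exists x y : R,
  [/\ 2 * dotp v w - (w *m I theta0 *m w^T) 0 0
        - (eta + 40 / c ^+ 2) * (d%:R * enorm w) ^+ 2 <= n%:R * x,
      n%:R * y <= (e * c) ^+ 2 &
      (((Num.max 0 (Num.sqrt x - Num.sqrt y)) ^+ 2)%:E <= L1 I psi theta0 n c)%E].
Proof.
have [Q hQ] := Q_exists.
exists (van_trees_information I S phi Q q n), (\int[Q]_(t in S) ((psi t - phi t) ^+ 2)).
split; [exact: van_trees_information_ge|exact: affine_gap_le|].
apply: ereal_sup_ubound; exists phi, Q, q; split => //.
- exact: abs_continuous_affine.
- exact: bump_prior_nice.
- exact: affine_gap_integrable.
Qed.

End van_trees_bound.
Lemma sqrt_gap_ge {R : realType} (n x y V b g : R) : 0 < n -> 0 <= V -> 0 <= b -> 0 <= g ->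
  V - b <= n * x -> n * y <= g ^+ 2 ->
  V - b - 2 * g * Num.sqrt V <= n * (Num.max 0 (Num.sqrt x - Num.sqrt y)) ^+ 2.
Proof.
move=> n0 V0 b0 g0 nx ny.
have [neg|pos] := leP (V - b) 0.
  apply: (@le_trans _ _ 0); last by rewrite mulr_ge0 ?sqr_ge0// ltW.
  by rewrite subr_le0 (le_trans neg)// !mulr_ge0// sqrtr_ge0.
pose z := Num.sqrt (V - b).
have z0 : 0 <= z by exact: sqrtr_ge0.
have n0' := ltW n0.
have z2 : z ^+ 2 = V - b by rewrite sqr_sqrtr// ltW.
have zV : z <= Num.sqrt V by rewrite ler_wsqrtr// gerBl.
have sx : z <= Num.sqrt n * Num.sqrt x by rewrite -sqrtrM// ler_wsqrtr.
have sy : Num.sqrt n * Num.sqrt y <= g.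
  by rewrite -sqrtrM// -(ger0_norm g0) -sqrtr_sqr; exact: ler_wsqrtr.
have -> : n * (Num.max 0 (Num.sqrt x - Num.sqrt y)) ^+ 2 =
    (Num.sqrt n * Num.max 0 (Num.sqrt x - Num.sqrt y)) ^+ 2.
  by rewrite exprMn sqr_sqrtr// ltW.
rewrite maxr_pMr ?sqrtr_ge0// mulr0 mulrBr.
set t := Num.sqrt n * _ - _.
have tz : z - g <= t by rewrite lerB.
apply: (@le_trans _ _ (z ^+ 2 - 2 * g * z)).
  by rewrite -z2 lerB// ler_wpM2l// mulr_ge0.
have [zg|zg] := leP z g.
  apply: (@le_trans _ _ 0); last exact: sqr_ge0.
  have -> : z ^+ 2 - 2 * g * z = - (z * (g + (g - z))) by ring.
  by rewrite oppr_le0 mulr_ge0// addr_ge0// subr_ge0.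
apply: (@le_trans _ _ ((z - g) ^+ 2)).
  have -> : (z - g) ^+ 2 = z ^+ 2 - 2 * g * z + g ^+ 2 by ring.
  by rewrite lerDl sqr_ge0.
have h : 0 <= z - g by rewrite subr_ge0 ltW.
by rewrite lerXn2r ?nnegrE ?le_max ?lexx//= tz orbT.
Qed.

Lemma regular_fisher_ball {R : realType} {d : nat} (I : 'rV[R]_d -> 'M[R]_d)
    (psi : 'rV[R]_d -> R) (theta0 : 'rV[R]_d) (e eta : R) :
  C1_at psi theta0 -> (forall i j, C1_at (fun t => I t i j) theta0) ->
  0 < e -> 0 < eta ->
  exists2 r : R, 0 < r & forall t, eball theta0 r t ->
  ({for t, continuous psi} /\
   `|psi t - psi theta0 - dotp (gradient psi theta0) (t - theta0)| <= e * enorm (t - theta0)) /\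
  forall i j, {for t, continuous (fun t => I t i j)} /\ `|I t i j - I theta0 i j| <= eta.
Proof.
move=> psi_C1 I_C1 e0 eta0.
have [near_psi _] := psi_C1.
have [r1 r10 h1] := differentiable_expansion (nbhs_singleton near_psi) e0.
have near_I : \forall t \near theta0, forall ij : 'I_d * 'I_d,
    {for t, continuous (fun t => I t ij.1 ij.2)} /\
    `|I t ij.1 ij.2 - I theta0 ij.1 ij.2| <= eta.
  apply: (@filter_forall _ _ (fun (ij : 'I_d * 'I_d) (t : 'rV[R]_d) =>
    {for t, continuous (fun t => I t ij.1 ij.2)} /\
    `|I t ij.1 ij.2 - I theta0 ij.1 ij.2| <= eta) _ (nbhs_filter theta0)) => -[i j] /=.
  have [nd _] := I_C1 i j.
  have cI : {for theta0, continuous (fun t : 'rV[R]_d => I t i j)}.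
    by apply: differentiable_continuous; exact: nbhs_singleton nd.
  have nI : \forall t \near theta0, `|I t i j - I theta0 i j| <= eta.
    have /cvgrPdist_le/(_ _ eta0) := cI.
    by apply: filterS => t; rewrite distrC.
  apply: filterS2 nd nI => t dt It; split => //.
  exact: differentiable_continuous.
have : \forall t \near theta0, differentiable psi t /\ forall ij : 'I_d * 'I_d,
    {for t, continuous (fun t => I t ij.1 ij.2)} /\
    `|I t ij.1 ij.2 - I theta0 ij.1 ij.2| <= eta.
  by apply: filterS2 near_psi near_I.
move=> /nbhs_normP[r2 /= r20 h2].
exists (Num.min r1 r2); first by rewrite lt_min r10.
move=> t; rewrite /eball /= lt_min => /andP[t1 t2].
have [|dt hI] := h2 t.
  by rewrite /= distrC (le_lt_trans (norm_le_enorm _)).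
split; last by move=> i j; exact: (hI (i, j)).
split; first exact: differentiable_continuous.
have := h1 (t - theta0); rewrite [theta0 + _]addrC subrK => h.
rewrite (le_trans (h _))//; first exact: le_lt_trans (norm_le_enorm _) t1.
by rewrite ler_wpM2l ?norm_le_enorm// ltW.
Qed.

Lemma L1_asymptotics {R : realType} {d : nat} (d_gt0 : (0 < d)%N)
    {dX : measure_display}
    {X : measurableType dX} (nu : {sigma_finite_measure set X -> \bar R})
    (Theta : set 'rV[R]_d)
    (p : 'rV[R]_d -> X -> R) (xi : 'rV[R]_d -> X -> 'rV[R]_d)
    (psi : 'rV[R]_d -> R) (theta0 : 'rV[R]_d) (e0 : R) :
  (forall t, Theta t -> hellinger_differentiable nu Theta p t (xi t)) ->
  (interior Theta) theta0 ->
  fisher_information nu (xi theta0) \in unitmx ->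
  C1_at psi theta0 ->
  (forall i j, C1_at (fun t => fisher_information nu (xi t) i j) theta0) ->
  let I := fun t => fisher_information nu (xi t) in
  let V := qform_inv (gradient psi theta0) (I theta0) in
  0 < e0 -> exists c0 : R, forall c, c0 <= c ->
  exists N, forall n, (N <= n)%N ->
  ((V - e0)%:E <= n%:R%:E * L1 I psi theta0 n c)%E.
Proof.
move=> P_hellinger theta0_interior I_invertible psi_C1 I_C1 I V e00.
have V0 : 0 <= V by exact: (V_ge0 psi P_hellinger theta0_interior I_invertible).
pose w := gradient psi theta0 *m invmx (I theta0).
pose K := (d%:R * enorm w) ^+ 2.
have K0 : 0 <= K by exact: sqr_ge0.
have I_sym t : (I t)^T = I t.
  apply/matrixP => i j; rewrite !mxE; congr (_ * _).
  by apply: eq_Rintegral => x _; rewrite mulrC.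
have I0_ge0 (y : 'rV[R]_d) : 0 <= (y *m I theta0 *m y^T) 0 0.
  have [mxi ixi _] := P_hellinger _ (interior_subset theta0_interior).
  have [_ <-] := fisher_quadratic y mxi ixi.
  by rewrite mulr_ge0// Rintegral_ge0// => x _; exact: sqr_ge0.
pose g := e0 / (4 * (Num.sqrt V + 1)).
have sV : 0 <= Num.sqrt V by exact: sqrtr_ge0.
have g0 : 0 < g by rewrite divr_gt0// mulr_gt0// ltr_wpDl.
exists (1 + 120 * K / e0) => c hc.
have c1 : 1 <= c by apply: le_trans hc; rewrite lerDl; exact: divr_ge0 (mulr_ge0 _ K0) (ltW e00).
have c0 : 0 < c by exact: lt_le_trans c1.
have cK : 120 * K / e0 <= c by apply: le_trans hc; rewrite lerDr.
have c2 : 0 < c ^+ 2 by rewrite exprn_gt0.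
have [r r0 hr] := regular_fisher_ball psi_C1 I_C1
  (divr_gt0 g0 c0) (divr_gt0 (ltr0Sn R 19) c2).
have [N hN] := local_scale (divr_gt0 r0 c0).
exists N => n nN; have [n0 /andP[s0 sr] s2] := hN n nN.
have nR0 : 0 < n%:R :> R by rewrite ltr0n.
have inball t : local_ball theta0 n c t -> eball theta0 r t.
  move=> h; apply: lt_trans h _; rewrite mulrC -ltr_pdivlMr//.
have eta_small : 20 / c ^+ 2 * c ^+ 2 < 40 by rewrite divfK ?ltr_nat// lt0r_neq0.
have [x [y [hx hy hL]]] := @L1_ge R d I psi theta0 n c (g / c) (20 / c ^+ 2)
  d_gt0 n0 c0 (ltW (divr_gt0 g0 c0)) I_sym I0_ge0
  (fun t St => (hr t (inball t St)).1) (fun t St => (hr t (inball t St)).2)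
  eta_small w.
have nn : (0 <= n%:R%:E :> \bar R)%E by rewrite lee_fin.
apply: le_trans (lee_wpmul2l nn hL).
rewrite -EFinM lee_fin.
have b0 : 0 <= 60 / c ^+ 2 * K by rewrite mulr_ge0// divr_ge0// ltW.
have hx' : V - 60 / c ^+ 2 * K <= n%:R * x.
  apply: le_trans hx; rewrite dotp_least_favourable// fisher_least_favourable// -/K -/V.
  have -> : 20 / c ^+ 2 + 40 / c ^+ 2 = 60 / c ^+ 2 by rewrite -mulrDl; congr (_ / _); ring.
  by rewrite lerD2r mulr_natl mulr2n addrK.
have hy' : n%:R * y <= g ^+ 2 by move: hy; rewrite divfK// gt_eqF.
apply: le_trans (sqrt_gap_ge nR0 V0 b0 (ltW g0) hx' hy').
rewrite -addrA lerD2l -opprD lerN2.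
have h1 : 60 / c ^+ 2 * K <= e0 / 2.
  rewrite mulrAC ler_pdivrMr//.
  apply: (@le_trans _ _ (e0 / 2 * c)).
    by move: cK; rewrite ler_pdivrMr// => cK; rewrite mulrAC ler_pdivlMr// mulrC [e0 * _]mulrC (le_trans _ cK)// mulrA -natrM.
  apply: ler_wpM2l; first by rewrite divr_ge0// ltW.
  by rewrite expr2; apply: ler_peMr => //; exact: ltW.
have h2 : 2 * g * Num.sqrt V <= e0 / 2.
  have -> : e0 / 2 = 2 * g * (Num.sqrt V + 1).
    by rewrite /g; field; rewrite gt_eqF// ltr_wpDl.
  by apply: ler_wpM2l; [rewrite mulr_ge0// ltW|rewrite lerDl].
rewrite [leRHS]splitr.
exact: lerD.
Qed.
Section exponential_bounds.
Context {R : realType}.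
Implicit Types x y : R.

Let partial_exp x m : R := \sum_(i < m) x ^+ i / i`!%:R.

Let partial_expE x m : series (exp_coeff x) m = partial_exp x m.
Proof. by rewrite /series/= big_mkord. Qed.

Let term_ge0 x i : 0 <= x -> 0 <= x ^+ i / i`!%:R.
Proof. by move=> x0; rewrite divr_ge0 ?exprn_ge0. Qed.

Lemma expR_ge_partial x m : 0 <= x -> \sum_(i < m) x ^+ i / i`!%:R <= expR x.
Proof.
move=> x0; rewrite -/(partial_exp x m) -partial_expE /expR.
apply: nondecreasing_cvgn_le; last exact: is_cvg_series_exp_coeff.
apply/nondecreasing_seqP => n; rewrite !partial_expE /partial_exp big_ord_recr/=.
by rewrite lerDl term_ge0.
Qed.

(** For small arguments each term of the series is at most half of the previous
    one, so that the tail is at most twice its first term. *)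
Lemma expR_le_partial x m : 0 <= x <= 2^-1 ->
  expR x <= \sum_(i < m) x ^+ i / i`!%:R + 2 * (x ^+ m / m`!%:R).
Proof.
move=> /andP[x0 x1]; rewrite -/(partial_exp x m) /expR.
apply: limr_le; first exact: is_cvg_series_exp_coeff.
near=> n; rewrite partial_expE.
have mn : (m <= n)%N by near: n; exact: nbhs_infty_ge.
suff H k : partial_exp x (m + k) + 2 * (x ^+ (m + k) / (m + k)`!%:R) <=
    partial_exp x m + 2 * (x ^+ m / m`!%:R).
  apply: le_trans (H (n - m)%N); rewrite subnKC// lerDl mulr_ge0// term_ge0//.
elim: k => [|k IH]; first by rewrite addn0.
apply: le_trans IH; rewrite addnS /partial_exp big_ord_recr/= -addrA lerD2l.
set j := (m + k)%N.
have -> : x ^+ j.+1 / j.+1`!%:R = x ^+ j / j`!%:R * (x / j.+1%:R).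
  rewrite exprSr factS natrM; field.
  by rewrite addrC natr1 !pnatr_eq0 -!lt0n fact_gt0.
have t0 := term_ge0 j x0.
set t := x ^+ j / _ in t0 *.
rewrite (mulrDl 1 1 t : 2 * t = 1 * t + 1 * t) mul1r lerD2l.
rewrite mulrCA ler_piMr//.
apply: (@le_trans _ _ (2 * x)).
  rewrite ler_wpM2l// ler_pdivrMr// ler_peMr// ler1n//.
by rewrite mulrC -ler_pdivlMr// div1r.
Unshelve. all: by end_near. Qed.

Let y1 : R := 3149 / 10 ^+ 4.

Let exp_y1 : (137 * 10 ^+ 5 + 1218) / 10 ^+ 7 <= expR y1.
Proof.
have y10 : 0 <= y1 by rewrite /y1; lra.
apply: le_trans (expR_ge_partial 7 y10).
rewrite !big_ord_recr big_ord0/= /y1 /factorial/=; lra.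
Qed.

Lemma constant_C_term_le (e : R) :
  e ^+ 2 * (expR (- (e ^+ 2 / 8)) / 2 - 1 / 4) <= (289 * 10 ^+ 3 + 535) / 10 ^+ 6.
Proof.
pose y := e ^+ 2 / 8.
have y0 : 0 <= y by rewrite divr_ge0// sqr_ge0.
have -> : e ^+ 2 = 8 * y by rewrite /y; field.
have -> : 8 * y / 8 = y by field.
rewrite expRN; set X := expR y.
have X0 : 0 < X by exact: expR_gt0.
have XL : (137 * 10 ^+ 5 + 1218) / 10 ^+ 7 * (1 + (y - y1)) <= X.
  have -> : X = expR y1 * expR (y - y1) by rewrite -expRD addrC subrK.
  have h : 0 <= 1 + (y - y1) by rewrite /y1; lra.
  apply: (le_trans (ler_wpM2r h exp_y1)).
  by rewrite ler_wpM2l ?expR_ge1Dx// expR_ge0.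
have sq := sqr_ge0 (y - (3149 * 10 ^+ 3 + 285) / 10 ^+ 7).
have key : 4 * y <= ((289 * 10 ^+ 3 + 535) / 10 ^+ 6 + 2 * y) * X.
  have U0 : 0 <= (289 * 10 ^+ 3 + 535) / 10 ^+ 6 + 2 * y by lra.
  apply: le_trans (ler_wpM2l U0 XL); rewrite /y1.
  clear XL X0 U0; clearbody X; nra.
have -> : 8 * y * (X^-1 / 2 - 1 / 4) = (4 * y) / X - 2 * y.
  by field; rewrite gt_eqF.
by rewrite lerBlDr ler_pdivrMr.
Qed.

Lemma constant_C_term_ge :
  (289 * 10 ^+ 3 + 525) / 10 ^+ 6 <= (159 / 100 : R) ^+ 2 * (expR (- ((159 / 100) ^+ 2 / 8)) / 2 - 1 / 4).
Proof.
pose y : R := (159 / 100) ^+ 2 / 8.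
have y01 : 0 <= y <= 2^-1 by rewrite /y; apply/andP; split; lra.
have h := expR_le_partial 6 y01.
rewrite expRN -/y; set X := expR y in h *.
have X0 : 0 < X by exact: expR_gt0.
have XU : X <= (137 * 10 ^+ 3 + 165) / 10 ^+ 5.
  apply: le_trans h _; rewrite !big_ord_recr big_ord0/= /y /factorial/=; lra.
have XI : 1 <= (137 * 10 ^+ 3 + 165) / 10 ^+ 5 * X^-1 by rewrite ler_pdivlMr// mul1r.
move: XI; move: (X^-1) => Z XI; clear h XU X0; lra.
Qed.

Lemma constant_C_ubound : has_ubound
  [set e ^+ 2 * (expR (- (e ^+ 2 / 8)) / 2 - 1 / 4) | e in [set e : R | 0 <= e]].
Proof. by exists ((289 * 10 ^+ 3 + 535) / 10 ^+ 6) => _ [e _ <-]; exact: constant_C_term_le. Qed.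

Lemma constant_C_approx : `|constant_C R - (289 * 100 + 53) / 10 ^+ 5| <= 5 / 10 ^+ 6.
Proof.
have hU : constant_C R <= (289 * 10 ^+ 3 + 535) / 10 ^+ 6.
  apply: ge_sup; first by exists (0 ^+ 2 * (expR (- (0 ^+ 2 / 8)) / 2 - 1 / 4)), 0; rewrite //= lexx.
  by move=> _ [e _ <-]; exact: constant_C_term_le.
have hL : (289 * 10 ^+ 3 + 525) / 10 ^+ 6 <= constant_C R.
  apply: le_trans constant_C_term_ge _; apply: ub_le_sup; first exact: constant_C_ubound.
  by exists (159 / 100) => //=; lra.
by rewrite ler_norml; apply/andP; split; lra.
Qed.

Lemma constant_C_le1 : constant_C R <= 1.
Proof. by have := constant_C_approx; rewrite ler_norml => /andP[_]; lra. Qed.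

End exponential_bounds.
Lemma constant_C_mul_le {R : realType} (V : R) (l : \bar R) : 0 <= V ->
  (forall u : R, 0 <= u ->
     ((V * (u ^+ 2 * (expR (- (u ^+ 2 / 8)) / 2 - 1 / 4)))%:E <= l)%E) ->
  ((constant_C R * V)%:E <= l)%E.
Proof.
move=> V0 h; move: V0; rewrite le_eqVlt => /orP[/eqP V0|V0].
  by have := h 0 (lexx _); rewrite -V0 mul0r mulr0.
move: l h => [l| |] h; last by have := h 0 (lexx _).
- rewrite lee_fin -ler_pdivlMr//; apply: ge_sup.
    by exists (0 ^+ 2 * (expR (- (0 ^+ 2 / 8)) / 2 - 1 / 4)), 0; rewrite //= lexx.
  move=> _ [u u0 <-]; rewrite ler_pdivlMr// mulrC -lee_fin; exact: h.
- exact: leey.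
Qed.

Theorem proposition3 (R : realType) (d : nat) (d_gt0 : (0 < d)%N)
    (dX : measure_display) (X : measurableType dX)
    (nu : {sigma_finite_measure set X -> \bar R})
    (Theta : set 'rV[R]_d) (P : 'rV[R]_d -> probability X R)
    (p : 'rV[R]_d -> X -> R) (xi : 'rV[R]_d -> X -> 'rV[R]_d)
    (psi : 'rV[R]_d -> R) (theta0 : 'rV[R]_d)
    (P_density : has_density nu P Theta p)
    (P_hellinger : forall t, Theta t ->
       hellinger_differentiable nu Theta p t (xi t))
    (theta0_interior : (interior Theta) theta0)
    (I_invertible : fisher_information nu (xi theta0) \in unitmx)
    (psi_C1 : C1_at psi theta0)
    (I_C1 : forall i j,
       C1_at (fun t => fisher_information nu (xi t) i j) theta0) :
  let I := fun t => fisher_information nu (xi t) in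
  let V := qform_inv (gradient psi theta0) (I theta0) in
  let C := constant_C R in
  [/\ (V%:E <= liminf_scaled (L1 I psi theta0))%E,
      forall gamma gamma0,
        regularity_R nu Theta p theta0 gamma gamma0 ->
        fisher_defect nu (p theta0) gamma0 = 0 ->
        (V%:E <= liminf_scaled (L2 P psi theta0))%E,
      (V%:E <= liminf_scaled (L3 P psi theta0))%E,
      ((C * V)%:E <= liminf_scaled (L4 P psi theta0))%E
        /\ `|C - (289 * 100 + 53) / 10 ^+ 5| <= 5 / 10 ^+ 6 &
      (V%:E <= liminf_scaled (minimax_risk P psi theta0))%E
        /\ ((C * V)%:E <= liminf_scaled (minimax_risk P psi theta0))%E].
Proof.
move=> I V C.
have V0 : 0 <= V by exact: (V_ge0 psi P_hellinger theta0_interior I_invertible).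
have L3_ge : (V%:E <= liminf_scaled (L3 P psi theta0))%E.
  apply: liminf_scaled_ge => e e0.
  have [c0 hc] := L2_L3_asymptotics P_density P_hellinger theta0_interior I_invertible psi_C1 e0.
  by exists c0 => c /hc[N hN]; exists N => n /hN[].
have minimax_ge : (V%:E <= liminf_scaled (minimax_risk P psi theta0))%E.
  apply: liminf_scaled_ge => e e0.
  exact: (minimax_asymptotics P_density P_hellinger theta0_interior I_invertible psi_C1 e0).
split.
- apply: liminf_scaled_ge => e e0.
  exact: (L1_asymptotics d_gt0 P_hellinger theta0_interior I_invertible psi_C1 I_C1 e0).
- move=> gamma gamma0 _ _; apply: liminf_scaled_ge => e e0.
  have [c0 hc] := L2_L3_asymptotics P_density P_hellinger theta0_interior I_invertible psi_C1 e0.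
  by exists c0 => c /hc[N hN]; exists N => n /hN[].
- exact: L3_ge.
- split; last exact: constant_C_approx.
  apply: (constant_C_mul_le V0) => u u0; apply: liminf_scaled_ge => e e0.
  exact: (L4_asymptotics P_density P_hellinger theta0_interior I_invertible psi_C1 u0 e0).
- split; first exact: minimax_ge.
  apply: le_trans minimax_ge; rewrite lee_fin.
  exact: ler_piMl V0 constant_C_le1.
Qed.
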